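(* Let $\Bbbk$ be an algebraically closed field of characteristic zero, let $n\ge 3$, and let $Q$ be the cyclic quiver with vertices $0,\dots,n-1$ and arrows $a_i:i\to i+1$ (indices modulo $n$). Let $\sigma$ be a graded automorphism of $\Bbbk Q$, so that $\sigma(e_i)=e_{\sigma(i)}$ and $\sigma(a_i)=q_ia_{\sigma(i)}$ for a permutation $i\mapsto\sigma(i)$ of the vertices and scalars $q_i\in\Bbbk^\times$. Let $A=\Bbbk Q[x;\sigma]$, let $x_i=xe_i=e_{\sigma(i)}x$, and let $\mathfrak Q$ be the quiver with vertices $0,\dots,n-1$ and arrows $a_i:i\to i+1$, $x_i:\sigma(i)\to i$, so that $A=\Bbbk\mathfrak Q/(\omega)$ where $$\omega=\sum_{i}\bigl(x_ia_i-q_ia_{\sigma(i)}x_{i+1}\bigr).$$ Suppose that $q_i=q_{\sigma(i-1)}$ for all $i$. Let $p_i\in\Bbbk^\times$ be scalars with $p_{\sigma(i)}=p_{i+1}$ for all $i$, and define a graded automorphism $\phi$ by $$\phi(e_i)=e_{\sigma(i-1)},\qquad \phi(a_i)=p_ia_{\sigma(i-1)},\qquad \phi(x_i)=p_i^{-1}x_{\sigma(i-1)}.$$ Then the normal extension $$\mathcal D(\mathfrak Q,\omega,\phi)=\Bbbk\mathfrak Q/(\omega a-\phi(a)\omega : a\in\mathfrak Q_1)$$ of $A$ is twisted Calabi--Yau of dimension three.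
   Context: Path algebras: paths are composed left to right ($pq$ is nonzero only if the target of $p$ is the source of $q$); $e_i$ is the trivial path at vertex $i$; path algebras are graded by path length; $\mathfrak Q_1$ denotes the set of arrows of $\mathfrak Q$. The formulas for $\phi$ define an automorphism of $\Bbbk\mathfrak Q$ and of $A$; in the relations of $\mathcal D(\mathfrak Q,\omega,\phi)$, $\phi(a)$ is regarded as an element of $\Bbbk\mathfrak Q$. Skew polynomial ring: $R[x;\sigma]$ is generated over $R$ by $x$ subject to $xr=\sigma(r)x$ for $r\in R$ (free as a left $R$-module on powers of $x$). Twisted Calabi--Yau: with $A^e=A\otimes_\Bbbk A^{\mathrm{op}}$, an algebra $A$ is homologically smooth if $A$ has a finite length resolution by finitely generated projective $A^e$-modules; it is twisted Calabi--Yau of dimension $d$ if moreover there is an invertible $(A,A)$-bimodule $U$ with $\mathrm{Ext}^i_{A^e}(A,A^e)\cong U$ for $i=d$ and $0$ for $i\ne d$, as right $A^e$-modules. *)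

(* Defs.v *)
From HB Require Import structures.
From mathcomp Require Import all_boot all_order all_algebra perm.
From mathcomp Require Import finmap monalg.
From mathcomp Require Import boolp.

Set Implicit Arguments.
Unset Strict Implicit.
Unset Printing Implicit Defensive.

Import GRing.Theory.
Local Open Scope ring_scope.
Local Open Scope quotient_scope.

Record submod (R : pzRingType) (V : lmodType R) := Submod {
  smem :> V -> Prop;
  smem0 : smem 0;
  smemD : forall x y, smem x -> smem y -> smem (x + y);
  smemZ : forall a x, smem x -> smem (a *: x) }.

Section QuotientModule.
Variables (R : pzRingType) (V : lmodType R) (N : submod V).

Definition smemb : {pred V} := fun x => `[< N x >].

Fact smemb_zmod_closed : zmod_closed smemb.
Proof.
split; first exact/asboolP/smem0.
move=> x y /asboolP Nx /asboolP Ny; apply/asboolP; apply: smemD => //.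
by rewrite -scaleN1r; apply: smemZ.
Qed.

Definition smem_zmodClosed : zmodClosed V :=
  HB.pack smemb (GRing.isZmodClosed.Build V smemb smemb_zmod_closed).

Definition lquot : Type := Quotient.quot smem_zmodClosed.
HB.instance Definition _ := GRing.Zmodule.on lquot.

Definition lpi (x : V) : lquot := \pi_(Quotient.quot smem_zmodClosed) x.

Lemma lpi_eq x y : lpi x = lpi y <-> N (x - y).
Proof.
rewrite /lpi; split=> [/eqP|H].
  by rewrite -Quotient.idealrBE => /asboolP.
by apply/eqP; rewrite -Quotient.idealrBE; apply/asboolP.
Qed.

Definition lrepr (q : lquot) : V := repr (q : Quotient.quot smem_zmodClosed).

Lemma lreprK : cancel lrepr lpi.
Proof. by move=> q; rewrite /lpi /lrepr reprK. Qed.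

Lemma lrepr_lpi x : N (lrepr (lpi x) - x).
Proof. by apply/lpi_eq; rewrite lreprK. Qed.

Fact lpi_is_zmod_morphism : zmod_morphism lpi.
Proof. exact: (@pi_is_zmod_morphism V _ _ (Quotient.quot smem_zmodClosed)). Qed.
HB.instance Definition _ :=
  GRing.isZmodMorphism.Build V lquot lpi lpi_is_zmod_morphism.

Definition lquot_scale (a : R) (q : lquot) : lquot := lpi (a *: lrepr q).

Lemma lpi_scale a x : lquot_scale a (lpi x) = lpi (a *: x).
Proof. by apply/lpi_eq; rewrite -scalerBr; apply/smemZ/lrepr_lpi. Qed.

Fact lquot_scalerA a b q :
  lquot_scale a (lquot_scale b q) = lquot_scale (a * b) q.
Proof. by rewrite -[q]lreprK !lpi_scale scalerA. Qed.
Fact lquot_scale1r : left_id 1 lquot_scale.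
Proof. by move=> q; rewrite -[q]lreprK !lpi_scale scale1r. Qed.
Fact lquot_scalerDr : right_distributive lquot_scale +%R.
Proof.
by move=> a p q; rewrite -[p]lreprK -[q]lreprK -raddfD !lpi_scale scalerDr raddfD.
Qed.
Fact lquot_scalerDl q : {morph lquot_scale^~ q : a b / a + b}.
Proof. by move=> a b; rewrite -[q]lreprK !lpi_scale scalerDl raddfD. Qed.

HB.instance Definition _ := GRing.Zmodule_isLmodule.Build R lquot
  lquot_scalerA lquot_scale1r lquot_scalerDr lquot_scalerDl.

Fact lpi_is_scalable : scalable lpi.
Proof. by move=> a x; rewrite -lpi_scale. Qed.
HB.instance Definition _ :=
  GRing.isScalable.Build R V lquot *:%R lpi lpi_is_scalable.

End QuotientModule.

Section Span.
Variables (R : pzRingType) (V : lmodType R) (S : V -> Prop).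

Definition lspan_mem (x : V) : Prop :=
  forall N : submod V, (forall s, S s -> N s) -> N x.

Fact lspan_mem0 : lspan_mem 0.
Proof. by move=> N _; apply: smem0. Qed.
Fact lspan_memD x y : lspan_mem x -> lspan_mem y -> lspan_mem (x + y).
Proof. by move=> Sx Sy N SN; apply: smemD; [apply: Sx | apply: Sy]. Qed.
Fact lspan_memZ a x : lspan_mem x -> lspan_mem (a *: x).
Proof. by move=> Sx N SN; apply: smemZ; apply: Sx. Qed.

Definition lspan : submod V := Submod lspan_mem0 lspan_memD lspan_memZ.

Lemma lspan_sub s : S s -> lspan s.
Proof. by move=> Ss N; apply. Qed.

End Span.

Section ImagePreimage.
Variables (R : pzRingType) (U V : lmodType R) (f : {linear U -> V}).

Definition limage : submod V.
Proof.
exists (fun y => exists x, f x = y).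
- by exists 0; rewrite linear0.
- by move=> _ _ [x <-] [y <-]; exists (x + y); rewrite linearD.
- by move=> a _ [x <-]; exists (a *: x); rewrite linearZ.
Defined.

Definition lpreimage (N : submod V) : submod U.
Proof.
exists (fun x => N (f x)).
- by rewrite linear0; apply: smem0.
- by move=> x y Nx Ny; rewrite linearD; apply: smemD.
- by move=> a x Nx; rewrite linearZ; apply: smemZ.
Defined.

Definition lker_mem : pred U := fun x => f x == 0.

Fact lker_submod_closed : submod_closed lker_mem.
Proof.
split=> [|a x y]; rewrite !unfold_in /lker_mem ?linear0 //.
by move=> /eqP fx /eqP fy; rewrite linearP fx fy scaler0 addr0.
Qed.
HB.instance Definition _ :=
  GRing.isSubmodClosed.Build R U lker_mem lker_submod_closed.

Definition lker : Type := {x : U | lker_mem x}.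
HB.instance Definition _ := SubChoice.on lker.
HB.instance Definition _ := [SubChoice_isSubLmodule of lker by <:].

End ImagePreimage.

Definition zero_submod (R : pzRingType) (V : lmodType R) : submod V :=
  limage (\0 : {linear V -> V}).

(* A k-algebra is a ring with a central structure map k -> A.  The library's
   [algType] would require [1 != 0], which a quotient algebra need not
   satisfy. *)
HB.mixin Record isPzAlgebra (k : fieldType) A of GRing.PzRing A := {
  pzC : k -> A;
  pzC_is_zmod_morphism : zmod_morphism pzC;
  pzC_is_monoid_morphism : monoid_morphism pzC;
  pzC_central : forall (c : k) (x : A), pzC c * x = x * pzC c }.

#[short(type="pzAlgType")]
HB.structure Definition PzAlgebra (k : fieldType) :=
  {A of isPzAlgebra k A & GRing.PzRing A}.

Section StructureMap.
Variables (k : fieldType) (A : pzAlgType k).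
HB.instance Definition _ := GRing.isZmodMorphism.Build k A (@pzC k A)
  (@pzC_is_zmod_morphism k A).
HB.instance Definition _ := GRing.isMonoidMorphism.Build k A (@pzC k A)
  (@pzC_is_monoid_morphism k A).

Definition opp_pzC (c : k) : A^c := pzC c.
Fact opp_pzC_is_zmod_morphism : zmod_morphism opp_pzC.
Proof. exact: (@pzC_is_zmod_morphism k A). Qed.
Fact opp_pzC_is_monoid_morphism : monoid_morphism opp_pzC.
Proof.
split=> [|c d]; first exact: (rmorph1 (@pzC k A)).
by rewrite mulrC; exact: (rmorphM (@pzC k A)).
Qed.
Fact opp_pzC_central (c : k) (x : A^c) : opp_pzC c * x = x * opp_pzC c.
Proof. exact/esym/(@pzC_central k A). Qed.
HB.instance Definition _ := isPzAlgebra.Build k (A^c)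
  opp_pzC_is_zmod_morphism opp_pzC_is_monoid_morphism opp_pzC_central.

Definition kspace : Type := A.
HB.instance Definition _ := GRing.Zmodule.on kspace.
Definition kscale (c : k) (x : kspace) : kspace := pzC c * (x : A).
Fact kscaleA a b x : kscale a (kscale b x) = kscale (a * b) x.
Proof. by rewrite /kscale mulrA -rmorphM. Qed.
Fact kscale1 : left_id 1 kscale.
Proof. by move=> x; rewrite /kscale rmorph1 mul1r. Qed.
Fact kscaleDr : right_distributive kscale +%R.
Proof. by move=> c x y; rewrite /kscale mulrDr. Qed.
Fact kscaleDl x : {morph kscale^~ x : a b / a + b}.
Proof. by move=> a b; rewrite /kscale rmorphD mulrDl. Qed.
HB.instance Definition _ := GRing.Zmodule_isLmodule.Build k kspace
  kscaleA kscale1 kscaleDr kscaleDl.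
End StructureMap.

Section QuotientRing.
Variables (R : pzRingType) (S : R -> Prop).

Definition ideal_gen : submod R^o :=
  lspan (V := R^o) (fun x => exists a s b, S s /\ x = a * s * b).

Lemma ideal_genMl (a x : R) : ideal_gen x -> ideal_gen (a * x).
Proof. exact: (smemZ (s := ideal_gen)). Qed.

Lemma ideal_genMr (a x : R) : ideal_gen x -> ideal_gen (x * a).
Proof.
move=> Ix N SN.
pose P : R^o -> Prop := fun y : R => N (y * a).
have P0 : P 0 by rewrite /P mul0r; apply: smem0.
have PD y z : P y -> P z -> P (y + z).
  by move=> Ny Nz; rewrite /P mulrDl; apply: smemD.
have PZ (c : R) y : P y -> P (c *: y).
  by move=> Ny; rewrite /P -mulrA; apply: (smemZ (s := N)).
apply: (Ix (Submod P0 PD PZ)) => _ [b [s [c [Ss ->]]]] /=.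
by apply: SN; exists b, s, (c * a); rewrite !mulrA.
Qed.

Lemma ideal_gen_sub s : S s -> ideal_gen s.
Proof. by move=> Ss; apply: lspan_sub; exists 1, s, 1; rewrite mul1r mulr1. Qed.

Definition qring : Type := lquot ideal_gen.
HB.instance Definition _ := GRing.Zmodule.on qring.

Definition qproj (x : R) : qring := lpi ideal_gen x.
Fact qproj_is_zmod_morphism : zmod_morphism qproj.
Proof. exact: (@lpi_is_zmod_morphism R R^o ideal_gen). Qed.
HB.instance Definition _ :=
  GRing.isZmodMorphism.Build R qring qproj qproj_is_zmod_morphism.

Lemma qproj_eq x y : qproj x = qproj y <-> ideal_gen (x - y).
Proof. exact: lpi_eq. Qed.

Definition qrepr (x : qring) : R := lrepr x.
Lemma qreprK : cancel qrepr qproj. Proof. exact: lreprK. Qed.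
Lemma qrepr_qproj x : ideal_gen (qrepr (qproj x) - x).
Proof. exact: lrepr_lpi. Qed.

Definition qring_one : qring := qproj 1.
Definition qring_mul (x y : qring) : qring := qproj (qrepr x * qrepr y).

Lemma qring_mulE x y : qring_mul (qproj x) (qproj y) = qproj (x * y).
Proof.
apply/qproj_eq; set x' := qrepr _; set y' := qrepr _.
have -> : x' * y' - x * y = (x' - x) * y' + x * (y' - y).
  by rewrite mulrBl mulrBr addrA subrK.
by apply: (smemD (s := ideal_gen));
  [apply: ideal_genMr | apply: ideal_genMl]; apply: qrepr_qproj.
Qed.

Fact qring_mulA : associative qring_mul.
Proof.
by move=> x y z; rewrite -[x]qreprK -[y]qreprK -[z]qreprK !qring_mulE mulrA.
Qed.
Fact qring_mul1r : left_id qring_one qring_mul.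
Proof. by move=> x; rewrite -[x]qreprK qring_mulE mul1r. Qed.
Fact qring_mulr1 : right_id qring_one qring_mul.
Proof. by move=> x; rewrite -[x]qreprK qring_mulE mulr1. Qed.
Fact qring_mulDl : left_distributive qring_mul +%R.
Proof.
move=> x y z; rewrite -[x]qreprK -[y]qreprK -[z]qreprK -raddfD !qring_mulE.
by rewrite mulrDl raddfD.
Qed.
Fact qring_mulDr : right_distributive qring_mul +%R.
Proof.
move=> x y z; rewrite -[x]qreprK -[y]qreprK -[z]qreprK -raddfD !qring_mulE.
by rewrite mulrDr raddfD.
Qed.
HB.instance Definition _ := GRing.Zmodule_isPzRing.Build qring
  qring_mulA qring_mul1r qring_mulr1 qring_mulDl qring_mulDr.

Fact qproj_is_monoid_morphism : monoid_morphism qproj.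
Proof. by split=> // x y; rewrite -qring_mulE. Qed.
HB.instance Definition _ :=
  GRing.isMonoidMorphism.Build R qring qproj qproj_is_monoid_morphism.

End QuotientRing.

Section QuotientAlgebra.
Variables (k : fieldType) (A : pzAlgType k) (S : A -> Prop).
Definition qpzC (c : k) : qring S := qproj S (pzC c).
Fact qpzC_is_zmod_morphism : zmod_morphism qpzC.
Proof. by move=> c d; rewrite /qpzC !rmorphB. Qed.
Fact qpzC_is_monoid_morphism : monoid_morphism qpzC.
Proof. by split=> [|c d]; rewrite /qpzC ?rmorph1 ?rmorphM. Qed.
Fact qpzC_central c (x : qring S) : qpzC c * x = x * qpzC c.
Proof. by rewrite -[x]qreprK -!rmorphM pzC_central. Qed.
HB.instance Definition _ := isPzAlgebra.Build k (qring S)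
  qpzC_is_zmod_morphism qpzC_is_monoid_morphism qpzC_central.
End QuotientAlgebra.

(* [punits] lists the local units: for the paths of a quiver these are the
   trivial paths, whose sum is the unit of the path algebra. *)
HB.mixin Record isPartialMonoid M of Choice M := {
  pmul : M -> M -> option M;
  punits : seq M;
  pmulA : forall x y z,
    obind (pmul x) (pmul y z) = obind (fun t => pmul t z) (pmul x y);
  pmul1m : forall x, pmap (fun e => pmul e x) punits = [:: x];
  pmulm1 : forall x, pmap (pmul x) punits = [:: x] }.

#[short(type="pmonoidType")]
HB.structure Definition PartialMonoid := {M of isPartialMonoid M & Choice M}.

Section LinearExtension.
Variables (k : fieldType) (K : choiceType) (V : lmodType k) (h : K -> V).

Definition malg_lift (f : {malg k[K]}) : V := \sum_(x <- msupp f) f@_x *: h x.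

Lemma malg_liftw (d : {fset K}) f : (msupp f `<=` d)%fset ->
  malg_lift f = \sum_(x <- d) f@_x *: h x.
Proof.
move=> le_fd; apply: big_fset_incl => // x _ /mcoeff_outdom ->.
by rewrite scale0r.
Qed.

Fact malg_lift_is_linear : linear malg_lift.
Proof.
move=> a f g; pose d := (msupp f `|` msupp g)%fset.
have fd : (msupp f `<=` d)%fset by apply: fsubsetUl.
have gd : (msupp g `<=` d)%fset by apply: fsubsetUr.
have afd : (msupp (a *: f + g) `<=` d)%fset.
  apply: fsubset_trans (msuppD_le _ _) _.
  by rewrite fsubUset gd (fsubset_trans (msuppZ_le _ _) fd).
rewrite (malg_liftw afd) (malg_liftw fd) (malg_liftw gd) scaler_sumr -big_split.
by apply: eq_bigr => x _ /=; rewrite mcoeffD mcoeffZ scalerDl scalerA.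
Qed.
HB.instance Definition _ :=
  GRing.isLinear.Build k {malg k[K]} V *:%R malg_lift malg_lift_is_linear.

Lemma malg_liftU x : malg_lift << x >> = h x.
Proof.
by rewrite (malg_liftw (@msuppU_le _ _ _ _)) big_seq_fset1 mcoeffUU scale1r.
Qed.

End LinearExtension.

Lemma malg_linear_ext (k : fieldType) (K : choiceType) (V : lmodType k)
    (f g : {malg k[K]} -> V) :
  linear f -> linear g -> (forall x, f << x >> = g << x >>) -> f =1 g.
Proof.
move=> lf lg fg u; rewrite [u]monalgE.
pose f' := GRing.isLinear.Build _ _ _ _ f lf.
pose g' := GRing.isLinear.Build _ _ _ _ g lg.
pose F : {linear {malg k[K]} -> V} := HB.pack f f'.
pose G : {linear {malg k[K]} -> V} := HB.pack g g'.
rewrite -[LHS]/(F _) -[RHS]/(G _) !linear_sum; apply: eq_bigr => x _.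
have -> : << u@_x *g x >> = u@_x *: << x >> :> {malg k[K]}.
  by apply/malgP => y; rewrite mcoeffZ !mcoeffU mulrnAr mulr1.
by rewrite !linearZ /= fg.
Qed.

Section PartialMonoidAlgebra.
Variables (k : fieldType) (M : pmonoidType).

Definition pmalg : Type := {malg k[M]}.
HB.instance Definition _ := GRing.Lmodule.on pmalg.

Definition pmb (x : M) : pmalg := << x >>.
Definition pmalg_one : pmalg := \sum_(e <- punits) pmb e.
Definition pmalg_mul (f g : pmalg) : pmalg :=
  \sum_(x <- msupp f) f@_x *: \sum_(y <- msupp g) g@_y *: oapp pmb 0 (pmul x y).

Lemma pmalg_mulE f g : pmalg_mul f g =
  malg_lift (fun x => malg_lift (fun y => oapp pmb 0 (pmul x y)) g) f.
Proof. by []. Qed.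

Fact pmalg_mul_linearl g : linear (pmalg_mul^~ g).
Proof. by move=> a f f'; rewrite !pmalg_mulE linearP. Qed.

Fact pmalg_mul_linearr f : linear (pmalg_mul f).
Proof.
move=> a g g'; rewrite !pmalg_mulE /malg_lift scaler_sumr -big_split /=.
apply: eq_bigr => x _; rewrite -[\sum_(y <- msupp (_ + _)) _]/(malg_lift _ _).
by rewrite linearP scalerDr !scalerA mulrC.
Qed.

Lemma pmalg_mulbb x y : pmalg_mul (pmb x) (pmb y) = oapp pmb 0 (pmul x y).
Proof. by rewrite pmalg_mulE !malg_liftU. Qed.

Lemma pmalg_ext (V : lmodType k) (f g : pmalg -> V) :
  linear f -> linear g -> (forall x, f (pmb x) = g (pmb x)) -> f =1 g.
Proof. exact: malg_linear_ext. Qed.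

Fact pmalg_mulDl : left_distributive pmalg_mul +%R.
Proof. by move=> f g h; have := pmalg_mul_linearl h 1 f g; rewrite !scale1r. Qed.
Fact pmalg_mulDr : right_distributive pmalg_mul +%R.
Proof. by move=> f g h; have := pmalg_mul_linearr f 1 g h; rewrite !scale1r. Qed.
Lemma pmalg_mul0f f : pmalg_mul 0 f = 0.
Proof. by have := pmalg_mul_linearl f (-1) 0 0; rewrite scaler0 addr0 scaleN1r addNr. Qed.
Lemma pmalg_mulf0 f : pmalg_mul f 0 = 0.
Proof. by have := pmalg_mul_linearr f (-1) 0 0; rewrite scaler0 addr0 scaleN1r addNr. Qed.

Lemma pmalg_sum_pmap (s : seq M) (F : M -> option M) :
  \sum_(e <- s) oapp pmb 0 (F e) = \sum_(y <- pmap F s) pmb y.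
Proof.
elim: s => [|e s IHs]; rewrite ?big_nil //= big_cons IHs.
by case: (F e) => [y|] /=; rewrite ?big_cons ?add0r.
Qed.

Fact pmalg_mul1f : left_id pmalg_one pmalg_mul.
Proof.
move=> f; apply: (pmalg_ext (f := pmalg_mul pmalg_one) (g := id)) => //.
  exact: pmalg_mul_linearr.
move=> x; rewrite /pmalg_one.
rewrite (big_morph (pmalg_mul^~ (pmb x)) (fun _ _ => pmalg_mulDl _ _ _) (pmalg_mul0f _)).
under eq_bigr do rewrite pmalg_mulbb.
by rewrite (pmalg_sum_pmap _ (fun e => pmul e x)) pmul1m big_seq1.
Qed.

Fact pmalg_mulf1 : right_id pmalg_one pmalg_mul.
Proof.
move=> f; apply: (pmalg_ext (f := pmalg_mul^~ pmalg_one) (g := id)) => //.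
  exact: pmalg_mul_linearl.
move=> x; rewrite /pmalg_one.
rewrite (big_morph (pmalg_mul (pmb x)) (fun _ _ => pmalg_mulDr _ _ _) (pmalg_mulf0 _)).
under eq_bigr do rewrite pmalg_mulbb.
by rewrite pmalg_sum_pmap pmulm1 big_seq1.
Qed.

Fact pmalg_mulA : associative pmalg_mul.
Proof.
have lr := pmalg_mul_linearr; have ll := pmalg_mul_linearl.
move=> f g h.
apply: (pmalg_ext (f := fun f => pmalg_mul f (pmalg_mul g h))
                  (g := fun f => pmalg_mul (pmalg_mul f g) h)).
- by move=> a u v; rewrite ll.
- by move=> a u v; rewrite !ll.
move=> x.
apply: (pmalg_ext (f := fun g => pmalg_mul (pmb x) (pmalg_mul g h))
                  (g := fun g => pmalg_mul (pmalg_mul (pmb x) g) h)).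
- by move=> a u v; rewrite ll lr.
- by move=> a u v; rewrite lr ll.
move=> y.
apply: (pmalg_ext (f := fun h => pmalg_mul (pmb x) (pmalg_mul (pmb y) h))
                  (g := fun h => pmalg_mul (pmalg_mul (pmb x) (pmb y)) h)).
- by move=> a u v; rewrite !lr.
- by move=> a u v; rewrite lr.
move=> z; rewrite !pmalg_mulbb; have := pmulA x y z.
case: (pmul y z) => [t|]; case: (pmul x y) => [w|] /= E;
  by rewrite ?pmalg_mulbb ?pmalg_mul0f ?pmalg_mulf0 ?E // -?E.
Qed.

HB.instance Definition _ := GRing.Zmodule_isPzRing.Build pmalg
  pmalg_mulA pmalg_mul1f pmalg_mulf1 pmalg_mulDl pmalg_mulDr.

Fact pmalg_scalerAl (c : k) (x y : pmalg) : c *: (x * y) = (c *: x) * y.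
Proof.
by have := pmalg_mul_linearl y c x 0; rewrite addr0 pmalg_mul0f addr0.
Qed.
Fact pmalg_scalerAr (c : k) (x y : pmalg) : c *: (x * y) = x * (c *: y).
Proof.
by have := pmalg_mul_linearr x c y 0; rewrite addr0 pmalg_mulf0 addr0.
Qed.

Definition pmalgC (c : k) : pmalg := c *: pmalg_one.
Fact pmalgC_is_zmod_morphism : zmod_morphism pmalgC.
Proof. by move=> c d; rewrite /pmalgC scalerBl. Qed.
Fact pmalgC_is_monoid_morphism : monoid_morphism pmalgC.
Proof.
split=> [|c d]; first exact: scale1r.
rewrite /pmalgC -[pmalg_one]/(1 : pmalg).
by rewrite -pmalg_scalerAl -pmalg_scalerAr mulr1 scalerA.
Qed.
Fact pmalgC_central c x : pmalgC c * x = x * pmalgC c.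
Proof.
rewrite /pmalgC -[pmalg_one]/(1 : pmalg).
by rewrite -pmalg_scalerAl -pmalg_scalerAr mul1r mulr1.
Qed.
HB.instance Definition _ := isPzAlgebra.Build k pmalg
  pmalgC_is_zmod_morphism pmalgC_is_monoid_morphism pmalgC_central.

End PartialMonoidAlgebra.

Section TensorAlgebra.
Variables (k : fieldType) (A B : pzAlgType k).

Definition puretens : Type := (A * B)%type.
HB.instance Definition _ := Choice.on puretens.
Definition puretens_mul (x y : puretens) : option puretens :=
  Some (x.1 * y.1, x.2 * y.2).
Definition puretens_units : seq puretens := [:: (1, 1)].
Fact puretens_mulA x y z : obind (puretens_mul x) (puretens_mul y z) =
  obind (fun t => puretens_mul t z) (puretens_mul x y).
Proof. by rewrite /puretens_mul /= !mulrA. Qed.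
Fact puretens_mul1 x : pmap (fun e => puretens_mul e x) puretens_units = [:: x].
Proof. by case: x => a b; rewrite /= !mul1r. Qed.
Fact puretens_mulr1 x : pmap (puretens_mul x) puretens_units = [:: x].
Proof. by case: x => a b; rewrite /= !mulr1. Qed.
HB.instance Definition _ := isPartialMonoid.Build puretens
  puretens_mulA puretens_mul1 puretens_mulr1.

Local Notation pt a b := (pmb k ((a, b) : puretens)).

(* A (x) B is the algebra with basis the pairs (a, b), multiplied
   componentwise, modulo bilinearity.  The linear span of the relators below
   is already a two-sided ideal. *)
Inductive bilinear_rel : pmalg k puretens -> Prop :=
| BilinDl a a' b : bilinear_rel (pt (a + a') b - pt a b - pt a' b)
| BilinDr a b b' : bilinear_rel (pt a (b + b') - pt a b - pt a b')
| BilinZl c a b : bilinear_rel (pt (pzC c * a) b - c *: pt a b)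
| BilinZr c a b : bilinear_rel (pt a (pzC c * b) - c *: pt a b).

Definition tensalg : Type := qring bilinear_rel.
HB.instance Definition _ := PzAlgebra.on tensalg.

Definition tens (a : A) (b : B) : tensalg := qproj bilinear_rel (pt a b).

End TensorAlgebra.

Definition env (k : fieldType) (A : pzAlgType k) : pzRingType := tensalg A (A^c).

Section RegularBimodule.
Variables (k : fieldType) (A : pzAlgType k).

(* A as a left A^e-module, (a (x) b) m = a m b *)
Definition regbimod : Type := A.
HB.instance Definition _ := GRing.Zmodule.on regbimod.

Definition biact (f : pmalg k (puretens A (A^c))) (m : A) : A :=
  malg_lift (V := kspace A) (fun p : puretens A (A^c) => p.1 * m * (p.2 : A)) f.
Definition regbimod_scale (r : env A) (m : regbimod) : regbimod :=
  biact (qrepr r) m.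

Lemma biact_linear m : linear (fun f => biact f m : kspace A).
Proof. by move=> c f g; rewrite /biact linearP. Qed.
Lemma biactD f g m : biact (f + g) m = biact f m + biact g m.
Proof. by have := biact_linear m 1 f g; rewrite !scale1r. Qed.
Lemma biactB f g m : biact (f - g) m = biact f m - biact g m.
Proof.
by have := biact_linear m (-1) g f; rewrite !scaleN1r ![- _ + _]addrC.
Qed.
Lemma biactZ c f m : biact (c *: f) m = pzC c * biact f m.
Proof.
by have := biact_linear m c f 0; rewrite !addr0 => ->; rewrite /biact linear0 addr0.
Qed.
Lemma biactU p m : biact (pmb k p) m = p.1 * m * (p.2 : A).
Proof. exact: (malg_liftU (V := kspace A)). Qed.
Lemma biactDr f m m' : biact f (m + m') = biact f m + biact f m'.
Proof.
rewrite /biact /malg_lift -big_split /=; apply: eq_bigr => p _.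
by rewrite mulrDr mulrDl scalerDr.
Qed.

Lemma biactM f g m : biact (f * g) m = biact f (biact g m).
Proof.
apply: (pmalg_ext (V := kspace A) (f := fun f => biact (f * g) m)
                  (g := fun f => biact f (biact g m))).
- by move=> c u v; rewrite mulrDl -pmalg_scalerAl biactD biactZ.
- by move=> c u v; rewrite biactD biactZ.
move=> p.
apply: (pmalg_ext (V := kspace A) (f := fun g => biact (pmb k p * g) m)
                  (g := fun g => biact (pmb k p) (biact g m))).
- by move=> c u v; rewrite mulrDr -pmalg_scalerAr biactD biactZ.
- move=> c u v; rewrite biactD biactZ biactDr; congr (_ + _).
  by rewrite !biactU /GRing.scale /= /kscale !mulrA pzC_central.
move=> q; rewrite -[pmb k p * _]/(pmalg_mul _ _) pmalg_mulbb /= !biactU /=.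
by rewrite -[p.2 * q.2]/((q.2 : A) * (p.2 : A)) !mulrA.
Qed.

Lemma biact_rel f m : bilinear_rel f -> biact f m = 0.
Proof.
case=> [a a' b|a b b'|c a b|c a b];
  rewrite !biactB ?biactZ !biactU /=.
- by rewrite !mulrDl addrAC addrK subrr.
- by rewrite mulrDr addrAC addrK subrr.
- by rewrite !mulrA subrr.
by rewrite -[pzC c * b]/((b : A) * pzC c) mulrA -pzC_central subrr.
Qed.

Lemma biact0 f : biact f 0 = 0.
Proof. by have := biactDr f 0 0; rewrite addr0 => /(congr1 (+%R^~ (- biact f 0))); rewrite addrK subrr. Qed.

Lemma biact_ideal f m : ideal_gen (@bilinear_rel k A (A^c)) f -> biact f m = 0.
Proof.
move=> If.
pose T : pzRingType := pmalg k (puretens A (A^c)).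
pose P : T^o -> Prop := fun g => forall m, biact g m = 0.
have P0 : P 0 by move=> m'; rewrite /biact linear0.
have PD x y : P x -> P y -> P (x + y).
  by move=> hx hy m'; rewrite biactD hx hy addr0.
have PZ (a : T) x : P x -> P (a *: x).
  by move=> hx m'; rewrite -[a *: x]/(a * x : T) biactM hx biact0.
apply: (If (Submod P0 PD PZ)) => _ [a [s [b [rs ->]]]] m' /=.
by rewrite !biactM (biact_rel _ rs) biact0.
Qed.

Lemma regbimod_scale_qproj f (m : regbimod) :
  regbimod_scale (qproj _ f : env A) m = biact f m.
Proof.
by apply/subr0_eq; rewrite /regbimod_scale -biactB; apply/biact_ideal/qrepr_qproj.
Qed.

Fact regbimod_scaleA r s m :
  regbimod_scale r (regbimod_scale s m) = regbimod_scale (r * s) m.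
Proof.
rewrite -[r]qreprK -[s]qreprK -rmorphM !regbimod_scale_qproj.
by rewrite biactM.
Qed.
Fact regbimod_scale1 : left_id 1 regbimod_scale.
Proof.
move=> m; rewrite -(rmorph1 (qproj _)) regbimod_scale_qproj.
rewrite -[1]/(pmalg_one k _) /pmalg_one big_seq1 biactU /=.
by rewrite mul1r mulr1.
Qed.
Fact regbimod_scaleDr : right_distributive regbimod_scale +%R.
Proof. by move=> r m m'; apply: biactDr. Qed.
Fact regbimod_scaleDl m : {morph regbimod_scale^~ m : r s / r + s}.
Proof.
by move=> r s; rewrite -[r]qreprK -[s]qreprK -raddfD !regbimod_scale_qproj biactD.
Qed.
HB.instance Definition _ := GRing.Zmodule_isLmodule.Build (env A) regbimod
  regbimod_scaleA regbimod_scale1 regbimod_scaleDr regbimod_scaleDl.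

Lemma regbimod_scale_tens a b (m : regbimod) :
  (tens a b : env A) *: m = a * (m : A) * (b : A).
Proof. by rewrite [LHS]regbimod_scale_qproj biactU. Qed.

End RegularBimodule.

Definition projective (R : pzRingType) (P : lmodType R) : Prop :=
  forall (M N : lmodType R) (g : {linear M -> N}) (f : {linear P -> N}),
    (forall y, exists x, g x = y) ->
    exists h : {linear P -> M}, forall p, g (h p) = f p.

Definition fin_gen (R : pzRingType) (P : lmodType R) : Prop :=
  exists (m : nat) (g : 'I_m -> P),
    forall x, exists c : 'I_m -> R, x = \sum_i c i *: g i.

Record proj_resolution (R : pzRingType) (M : lmodType R) := ProjResolution {
  res_obj :> nat -> lmodType R;
  res_d : forall i, {linear res_obj i.+1 -> res_obj i};
  res_aug : {linear res_obj 0 -> M};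
  res_proj : forall i, projective (res_obj i);
  res_aug_surj : forall m, exists p, res_aug p = m;
  res_exact0 : forall p, res_aug p = 0 <-> exists q, res_d 0 q = p;
  res_exact : forall i p, res_d i p = 0 <-> exists q, res_d i.+1 q = p }.

Definition finite_length (R : pzRingType) (M : lmodType R)
    (P : proj_resolution M) : Prop :=
  exists l : nat, forall i, (l < i)%N -> forall p : P i, p = 0.

Section Dual.
Variables (R : pzRingType) (P : lmodType R).

(* Hom_R(P, R) with its right R-module structure (f s)(p) = f(p) s; right
   R-modules are left modules over the converse ring [R^c]. *)
Definition dual : Type := {linear P -> R^o}.
HB.instance Definition _ := gen_eqMixin dual.
HB.instance Definition _ := gen_choiceMixin dual.

Lemma dualP (f g : dual) : (f : P -> R) =1 g -> f = g.
Proof.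
case: f g => [f [[f1] [f2]]] [g [[g1] [g2]]] /= /funext fg.
case: _ / fg in g1 g2 *.
by congr GRing.Linear.Pack; congr GRing.Linear.Class;
  [congr Algebra.isNmodMorphism.Axioms_ | congr GRing.isScalable.Axioms_];
  apply: Prop_irrelevance.
Qed.

Definition dual_zero : dual := (\0 : {linear P -> R^o}).
Definition dual_add (f g : dual) : dual := (f \+ g : {linear P -> R^o}).
Definition dual_opp (f : dual) : dual := (\- f : {linear P -> R^o}).

Fact dual_addA : associative dual_add.
Proof. by move=> f g h; apply: dualP => x; apply: addrA. Qed.
Fact dual_addC : commutative dual_add.
Proof. by move=> f g; apply: dualP => x; apply: addrC. Qed.
Fact dual_add0 : left_id dual_zero dual_add.
Proof. by move=> f; apply: dualP => x; apply: add0r. Qed.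
Fact dual_addN : left_inverse dual_zero dual_opp dual_add.
Proof. by move=> f; apply: dualP => x; apply: addNr. Qed.
HB.instance Definition _ := GRing.isZmodule.Build dual
  dual_addA dual_addC dual_add0 dual_addN.

Section Scale.
Variables (s : R) (f : dual).
Definition dual_scale_fun (p : P) : R^o := (f p : R) * s.
Fact dual_scale_fun_is_linear : linear dual_scale_fun.
Proof.
move=> a p q; rewrite /dual_scale_fun linearP mulrDl.
by congr (_ + _); rewrite -[LHS]mulrA.
Qed.
HB.instance Definition _ := GRing.isLinear.Build R P R^o *:%R
  dual_scale_fun dual_scale_fun_is_linear.
End Scale.
Definition dual_scale (s : R^c) (f : dual) : dual :=
  (dual_scale_fun s f : {linear P -> R^o}).

Fact dual_scaleA s t f : dual_scale s (dual_scale t f) = dual_scale (s * t) f.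
Proof. by apply: dualP => x; rewrite /= /dual_scale_fun -mulrA. Qed.
Fact dual_scale1 : left_id 1 dual_scale.
Proof. by move=> f; apply: dualP => x; apply: mulr1. Qed.
Fact dual_scaleDr : right_distributive dual_scale +%R.
Proof. by move=> s f g; apply: dualP => x; apply: mulrDl. Qed.
Fact dual_scaleDl f : {morph dual_scale^~ f : s t / s + t}.
Proof. by move=> s t; apply: dualP => x; apply: mulrDr. Qed.
HB.instance Definition _ := GRing.Zmodule_isLmodule.Build (R^c) dual
  dual_scaleA dual_scale1 dual_scaleDr dual_scaleDl.

End Dual.

Section DualMap.
Variables (R : pzRingType) (P Q : lmodType R) (d : {linear P -> Q}).
Definition dual_map (f : dual Q) : dual P :=
  ((f : {linear Q -> R^o}) \o d : {linear P -> R^o}).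
Fact dual_map_is_linear : linear dual_map.
Proof. by move=> s f g; apply: dualP. Qed.
HB.instance Definition _ := GRing.isLinear.Build (R^c) (dual Q) (dual P) *:%R
  dual_map dual_map_is_linear.
End DualMap.

Section Ext.
Variables (R : pzRingType) (M : lmodType R) (P : proj_resolution M).

Definition cocycles (i : nat) : Type := lker (dual_map (res_d P i)).
HB.instance Definition _ i := GRing.Lmodule.on (cocycles i).

Definition coboundaries (i : nat) : submod (dual (P i)) :=
  if i is j.+1 then limage (dual_map (res_d P j)) else zero_submod (dual (P 0)).

Definition Ext (i : nat) : lmodType (R^c) :=
  lquot (lpreimage (val : {linear cocycles i -> dual (P i)}) (coboundaries i)).

End Ext.

(* Ext^i_R(M, R) is computed from some projective resolution of M; it does not
   depend on the choice, so the two predicates below need not share one. *)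
Definition Ext_iso (R : pzRingType) (M : lmodType R) (i : nat)
    (X : lmodType (R^c)) : Prop :=
  exists P : proj_resolution M, exists theta : {linear Ext P i -> X},
    bijective theta.

Definition Ext_vanishes (R : pzRingType) (M : lmodType R) (i : nat) : Prop :=
  exists P : proj_resolution M, forall x : Ext P i, x = 0.

Section Bimodules.
Variables (k : fieldType) (A : pzAlgType k).

(* A (k-central) bimodule is a right A^e-module through u (a (x) b) = b u a. *)
Definition bimodType := lmodType ((env A)^c).

Definition bimod_actl (U : bimodType) (a : A) (u : U) : U :=
  (tens 1 (a : A^c) : (env A)^c) *: u.
Definition bimod_actr (U : bimodType) (u : U) (b : A) : U :=
  (tens b (1 : A^c) : (env A)^c) *: u.

Section TensorOverA.
Variables U V : bimodType.

Local Notation pt u v := (<< (u, v) >> : {malg int[(U * V)%type]}).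

Inductive balanced_rel : {malg int[(U * V)%type]} -> Prop :=
| BalDl u u' v : balanced_rel (pt (u + u') v - pt u v - pt u' v)
| BalDr u v v' : balanced_rel (pt u (v + v') - pt u v - pt u v')
| BalA u a v : balanced_rel (pt (bimod_actr u a) v - pt u (bimod_actl a v)).

Definition tens_over : lmodType int := lquot (lspan balanced_rel).

Definition tens_elt (u : U) (v : V) : tens_over := lpi _ (pt u v).

(* U (x)_A V is isomorphic to A as a bimodule; its bimodule structure is
   a (u (x) v) b = (a u) (x) (v b). *)
Definition tens_over_iso_regular : Prop :=
  exists theta : {additive tens_over -> A},
    bijective theta /\
    forall a u v b, theta (tens_elt (bimod_actl a u) (bimod_actr v b)) =
                    a * theta (tens_elt u v) * b.

End TensorOverA.

Definition invertible_bimod (U : bimodType) : Prop :=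
  exists V : bimodType, tens_over_iso_regular U V /\ tens_over_iso_regular V U.

Definition homologically_smooth : Prop :=
  exists P : proj_resolution (regbimod A : lmodType (env A)),
    finite_length P /\ forall i, fin_gen (P i).

Definition twisted_calabi_yau (d : nat) : Prop :=
  homologically_smooth /\
  exists U : bimodType, invertible_bimod U /\
    Ext_iso (regbimod A : lmodType (env A)) d U /\
    forall i, i <> d -> Ext_vanishes (regbimod A : lmodType (env A)) i.

End Bimodules.

Record quiver := Quiver {
  qvert : finType;
  qarr : finType;
  qsrc : qarr -> qvert;
  qtgt : qarr -> qvert }.

Section PathAlgebra.
Variables (k : fieldType) (Q : quiver).

Fixpoint composable (v : qvert Q) (s : seq (qarr Q)) : bool :=
  if s is a :: s' then (qsrc a == v) && composable (qtgt a) s' else true.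
Definition endpoint (v : qvert Q) (s : seq (qarr Q)) : qvert Q :=
  last v (map (@qtgt Q) s).

Lemma composable_cat v s t :
  composable v (s ++ t) = composable v s && composable (endpoint v s) t.
Proof. by elim: s v => //= a s IHs v; rewrite IHs andbA. Qed.
Lemma endpoint_cat v s t : endpoint v (s ++ t) = endpoint (endpoint v s) t.
Proof. by rewrite /endpoint map_cat last_cat. Qed.

(* A path is its source together with its sequence of arrows, read from left
   to right; the trivial path at v is (v, [::]). *)
Definition qpath : Type :=
  {p : qvert Q * seq (qarr Q) | composable p.1 p.2}.
HB.instance Definition _ := SubChoice.on qpath.

Definition psrc (p : qpath) : qvert Q := (val p).1.
Definition ptgt (p : qpath) : qvert Q := endpoint (val p).1 (val p).2.
Definition plen (p : qpath) : nat := size (val p).2.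

Definition ptriv (v : qvert Q) : qpath :=
  exist (fun p => composable p.1 p.2) (v, [::]) isT.
Fact parr_subproof (a : qarr Q) : composable (qsrc a) [:: a].
Proof. by rewrite /= eqxx. Qed.
Definition parr (a : qarr Q) : qpath :=
  exist (fun p => composable p.1 p.2) (qsrc a, [:: a]) (parr_subproof a).

(* [insub] never fails here, see [pcatP] *)
Definition pcat (p q : qpath) : option qpath :=
  if ptgt p == psrc q then insub (psrc p, (val p).2 ++ (val q).2) else None.

Lemma pcatP p q : ptgt p = psrc q ->
  exists2 r, pcat p q = Some r & val r = (psrc p, (val p).2 ++ (val q).2).
Proof.
move=> pq; rewrite /pcat pq eqxx.
case: insubP => [r _ rE|]; first by exists r.
rewrite /= composable_cat (valP p) /= -/(ptgt p) pq.
by rewrite (valP q).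
Qed.

Lemma pcat_None p q : ptgt p != psrc q -> pcat p q = None.
Proof. by rewrite /pcat => /negPf ->. Qed.

Fact pcatA x y z :
  obind (pcat x) (pcat y z) = obind (fun t => pcat t z) (pcat x y).
Proof.
have [yz|nyz] := eqVneq (ptgt y) (psrc z); last first.
  rewrite [pcat y z]pcat_None //=.
  have [xy|nxy] := eqVneq (ptgt x) (psrc y); last by rewrite [pcat x y]pcat_None.
  have [r -> rE] := pcatP xy; rewrite /= pcat_None //.
  by rewrite /ptgt rE /= endpoint_cat -/(ptgt x) xy.
have [s -> sE] := pcatP yz; rewrite /=.
have ss : psrc s = psrc y by rewrite /psrc sE.
have [xy|nxy] := eqVneq (ptgt x) (psrc y); last first.
  by rewrite [pcat x y]pcat_None //= pcat_None // ss.
have [r -> rE] := pcatP xy; rewrite /=.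
have rz : ptgt r = psrc z by rewrite /ptgt rE /= endpoint_cat -/(ptgt x) xy.
have xs : ptgt x = psrc s by rewrite ss.
have [t -> tE] := pcatP xs; have [u -> uE] := pcatP rz.
by congr Some; apply: val_inj; rewrite tE uE sE /psrc rE /= catA.
Qed.

Definition punits_path : seq qpath := map ptriv (enum (qvert Q)).

Lemma pmap_enum1 (F : qvert Q -> option qpath) v x :
  F v = Some x -> (forall w, w != v -> F w = None) ->
  pmap F (enum (qvert Q)) = [:: x].
Proof.
move=> Fv Fw.
have -> : pmap F (enum (qvert Q)) = pmap F (filter (pred1 v) (enum (qvert Q))).
  elim: (enum _) => //= w s IHs.
  by have [->|/Fw ->] := eqVneq w v; rewrite /= ?Fv IHs.
rewrite filter_pred1_uniq ?enum_uniq ?mem_enum //.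
by rewrite /= Fv.
Qed.

Fact punits_path1 x : pmap (fun e => pcat e x) punits_path = [:: x].
Proof.
rewrite /punits_path; have -> (s : seq (qvert Q)) :
    pmap (fun e => pcat e x) (map ptriv s) = pmap (fun v => pcat (ptriv v) x) s.
  by elim: s => //= v s ->.
apply: (pmap_enum1 (v := psrc x)) => [|w wx]; last by rewrite pcat_None.
have [r -> rE] := @pcatP (ptriv (psrc x)) x erefl.
by congr Some; apply: val_inj; rewrite rE /psrc /=; case: (sval x).
Qed.

Fact punits_pathr x : pmap (pcat x) punits_path = [:: x].
Proof.
rewrite /punits_path; have -> (s : seq (qvert Q)) :
    pmap (pcat x) (map ptriv s) = pmap (fun v => pcat x (ptriv v)) s.
  by elim: s => //= v s ->.
apply: (pmap_enum1 (v := ptgt x)) => [|w wx]; last by rewrite pcat_None // eq_sym.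
have [r -> rE] := @pcatP x (ptriv (ptgt x)) erefl.
by congr Some; apply: val_inj; rewrite rE /= cats0 /psrc /=; case: (sval x).
Qed.

HB.instance Definition _ := isPartialMonoid.Build qpath
  pcatA punits_path1 punits_pathr.

Definition pathalg : Type := pmalg k qpath.
HB.instance Definition _ := GRing.Lmodule.on pathalg.
HB.instance Definition _ := PzAlgebra.on pathalg.

Definition pvert (v : qvert Q) : pathalg := pmb k (ptriv v).
Definition parrow (a : qarr Q) : pathalg := pmb k (parr a).

Definition homogeneous (d : nat) (f : pathalg) : Prop :=
  forall p, p \in msupp (f : {malg k[qpath]}) -> plen p = d.

Definition graded_automorphism (f : pathalg -> pathalg) : Prop :=
  [/\ linear f, monoid_morphism f, bijective f &
      forall d x, homogeneous d x -> homogeneous d (f x)].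

Definition normal_ext (omega : pathalg) (phi : pathalg -> pathalg)
    : pzAlgType k :=
  qring (fun x : pathalg => exists a : qarr Q,
    x = omega * parrow a - phi (parrow a) * omega).

End PathAlgebra.

Definition cyclic_quiver (n : nat) : quiver :=
  {| qvert := 'I_n; qarr := 'I_n; qsrc := id; qtgt := fun i => ordS i |}.

(* the arrow [inl i] is a_i : i -> i+1 and [inr i] is x_i : sigma(i) -> i *)
Definition ore_quiver (n : nat) (sigma : {perm 'I_n}) : quiver :=
  {| qvert := 'I_n; qarr := ('I_n + 'I_n)%type;
     qsrc := fun b => match b with inl i => i | inr i => sigma i end;
     qtgt := fun b => match b with inl i => ordS i | inr i => i end |}.

Section OreQuiver.
Variables (k : fieldType) (n : nat) (sigma : {perm 'I_n}).

Definition arr_a (i : 'I_n) : pathalg k (ore_quiver sigma) :=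
  parrow k (inl i : qarr (ore_quiver sigma)).
Definition arr_x (i : 'I_n) : pathalg k (ore_quiver sigma) :=
  parrow k (inr i : qarr (ore_quiver sigma)).

Definition ore_omega (q : 'I_n -> k) : pathalg k (ore_quiver sigma) :=
  \sum_(i < n) (arr_x i * arr_a i
                 - q i *: (arr_a (sigma i) * arr_x (ordS i))).

End OreQuiver.

(* Main.v *)
(* The automorphism sigma rotates the cycle, sigma(i) = i + r.  With a and x the
   sums of the arrows a_i and x_i, and w = omega, the algebra D is generated over
   the e_i by a, w, x, homogeneous for the rotation degrees 1, 1 - r, -r, subject
   to x a = w + kap a x, w a = lam a w, x w = mu w x with diagonal coefficients
   kap, lam, mu, invariant under rotation by 1 - r.  So D is an iterated Ore
   extension: the monomials x^s w^j a^l e_i span it, and they are independent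
   because the relations define a right D-module structure on their formal span.

   As a bimodule D has a Koszul resolution with terms of rank 1, 3, 3, 1, cut out
   by the idempotents sum_i e_i (x) e_(i+c), whose entries other than a constant
   one are twisted differences g1 y (x) 1 - g2 1 (x) y for y = a, w, x.
   Exactness follows by expanding the left tensor factor in the monomial basis
   and comparing leading coordinates, one variable at a time.  Exchanging the
   tensor factors turns the dual complex into a complex of the same kind, which
   resolves D with its right action twisted by the automorphism
   e_i -> e_(i+2(1-r)), a -> (mu kap)^-1 a, w -> w, x -> x (mu kap). *)

From HB Require Import structures.
Require Import Defs.
From mathcomp Require Import all_boot all_order all_algebra perm.
From mathcomp Require Import finmap monalg boolp ring.

Set Implicit Arguments.
Unset Strict Implicit.
Unset Printing Implicit Defensive.

Import GRing.Theory.
Local Open Scope ring_scope.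

(** * The enveloping algebra *)

(** The relation x a = w + kap a x could eliminate w and shrink the bimodule resolution to ranks 1,
    2, 2, 1. Keeping w as a third variable makes right multiplication by each variable a shift on a
    suitable part of the monomial basis, so that exactness becomes division with remainder. The
    price is the constant entry -1, the derivative of the linear term w. The middle differential
    consists of the noncommutative derivatives of the three relations, and the last one is the
    syzygy given by the overlap x w a.

    The twisting automorphism nu is forced: the generator of the top Ext group must be killed by the
    three entries of the last differential, which says nu(x) = x mu kap, nu(w) = w and mu kap nu(a)
    = a. Two facts make the coefficients fit: they are invariant under the degree 1 - r of w, hence
    commute with w, and mu(i + 1) = lam(i), which closes the overlap. *)

Lemma ideal_gen_vanish (T : pzRingType) (W : zmodType) (f : {additive T -> W})
    (S : T -> Prop) :
  (forall a s b, S s -> f (a * s * b) = 0) ->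
  forall x, ideal_gen S x -> f x = 0.
Proof.
move=> fS x Ix.
(* The kernel of [f] is only an additive subgroup, while [ideal_gen] is a span inside a left module;
   the quantified left factor makes the predicate a submodule. *)
pose Q : T^o -> Prop := fun g => forall a : T, f (a * (g : T)) = 0.
have Q0 : Q 0 by move=> a; rewrite mulr0 raddf0.
have QD y z : Q y -> Q z -> Q (y + z).
  by move=> hy hz a; rewrite mulrDr raddfD hy hz addr0.
have QZ (c : T) y : Q y -> Q (c *: y).
  by move=> hy a; rewrite -[c *: y]/(c * (y : T)) mulrA hy.
have : Q x.
  apply: (Ix (Submod Q0 QD QZ)) => _ [a [s [b [Ss ->]]]] c /=.
  by rewrite -mulrA mulrA mulrA fS.
by move=> /(_ 1); rewrite mul1r.
Qed.

Lemma pmalg_vanish (k : fieldType) (M : pmonoidType) (W : lmodType k)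
    (f : {linear pmalg k M -> W}) (s : pmalg k M) :
  (forall x y, f (pmb k x * s * pmb k y) = 0) -> forall a b, f (a * s * b) = 0.
Proof.
move=> fs a b.
apply: (pmalg_ext (f := fun a => f (a * s * b)) (g := fun=> 0)).
- by move=> c u v; rewrite !mulrDl -!pmalg_scalerAl linearP.
- by move=> c u v; rewrite scaler0 addr0.
move=> x; apply: (pmalg_ext (f := fun b => f (pmb k x * s * b)) (g := fun=> 0)).
- by move=> c u v; rewrite !mulrDr -!pmalg_scalerAr linearP.
- by move=> c u v; rewrite scaler0 addr0.
by [].
Qed.

Section TensorLift.
Variables (k : fieldType) (A B : pzAlgType k).
Local Notation pt a b := (pmb k ((a, b) : puretens A B)).
Variables (W : lmodType k) (beta : A -> B -> W).
Hypothesis betaDl : forall a a' b, beta (a + a') b = beta a b + beta a' b.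
Hypothesis betaDr : forall a b b', beta a (b + b') = beta a b + beta a b'.
Hypothesis betaZl : forall c a b, beta (pzC c * a) b = c *: beta a b.
Hypothesis betaZr : forall c a b, beta a (pzC c * b) = c *: beta a b.

Definition pretens_lift : pmalg k (puretens A B) -> W :=
  malg_lift (fun p : puretens A B => beta p.1 p.2).

Fact pretens_lift_lin : linear pretens_lift.
Proof. by move=> c f g; rewrite /pretens_lift linearP. Qed.
HB.instance Definition _ := GRing.isLinear.Build k _ W *:%R _ pretens_lift_lin.

Lemma pretens_liftU p : pretens_lift (pmb k p) = beta p.1 p.2.
Proof. exact: malg_liftU. Qed.

Lemma pretens_lift_ideal f : ideal_gen (@bilinear_rel k A B) f -> pretens_lift f = 0.
Proof.
apply: ideal_gen_vanish => a s b rs; apply: pmalg_vanish => x y {a b}.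
(* Multiplication by basis elements on both sides sends the pair (a, b) to (x.1 a y.1, x.2 b y.2),
   so every bilinearity relator keeps its form. *)
have [g [gE gB gZ gU]] : exists g : pmalg k (puretens A B) -> W,
    [/\ forall u, pretens_lift (pmb k x * u * pmb k y) = g u,
       forall u v, g (u - v) = g u - g v,
       forall c u, g (c *: u) = c *: g u &
       forall a b, g (pt a b) = beta (x.1 * a * y.1) (x.2 * b * y.2)].
  exists (fun u => pretens_lift (pmb k x * u * pmb k y)); split=> // [u v|c u|a b].
  - by rewrite mulrBr mulrBl linearB.
  - by rewrite -pmalg_scalerAr -pmalg_scalerAl linearZ.
  rewrite -[X in X * _]/(pmalg_mul _ _) pmalg_mulbb.
  by rewrite -[_ * _]/(pmalg_mul _ _) pmalg_mulbb pretens_liftU.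
rewrite -[LHS]/(pretens_lift (pmb k x * s * pmb k y)) gE.
case: rs => [a a' b|a b b'|c a b|c a b].
- rewrite (gB _ (pt a' b)) (gB _ (pt a b)) (gU (a + a')) (gU a) (gU a').
  by rewrite !(mulrDr, mulrDl) betaDl addrAC addrK subrr.
- rewrite (gB _ (pt a b')) (gB _ (pt a b)) (gU a (b + b')) (gU a b) (gU a b').
  by rewrite !(mulrDr, mulrDl) betaDr addrAC addrK subrr.
- rewrite (gB _ (c *: pt a b)) (gZ c) (gU (pzC c * a)) (gU a).
  by rewrite (mulrA x.1) -(pzC_central c x.1) -!mulrA betaZl subrr.
rewrite (gB _ (c *: pt a b)) (gZ c) (gU a (pzC c * b)) (gU a b).
by rewrite (mulrA x.2) -(pzC_central c x.2) -!mulrA betaZr subrr.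
Qed.

Definition tens_lift (r : tensalg A B) : W := pretens_lift (qrepr r).

Lemma tens_liftT a b : tens_lift (tens a b) = beta a b.
Proof.
rewrite -[RHS](pretens_liftU ((a, b) : puretens A B)); apply/subr0_eq.
by rewrite -linearB; apply/pretens_lift_ideal/qrepr_qproj.
Qed.

Fact tens_lift_zmod : zmod_morphism tens_lift.
Proof.
move=> r s; apply/subr0_eq; rewrite /tens_lift -!linearB.
apply: pretens_lift_ideal; apply/qproj_eq.
by rewrite raddfB /= !qreprK.
Qed.

End TensorLift.

HB.lock Definition etens (k : fieldType) (A : pzAlgType k) (a b : A) : env A :=
  tens a (b : A^c).
HB.lock Definition lft (k : fieldType) (A : pzAlgType k) (a : A) : env A :=
  etens a 1.
HB.lock Definition rgt (k : fieldType) (A : pzAlgType k) (b : A) : env A :=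
  etens 1 b.

Section Enveloping.
Variables (k : fieldType) (A : pzAlgType k).
Local Notation R := (env A).
Local Notation pt a b := (pmb k ((a, b) : puretens A (A^c))).

Lemma etensDl (a a' b : A) : etens (a + a') b = etens a b + etens a' b.
Proof.
apply/eqP; rewrite -subr_eq0 opprD addrA; apply/eqP.
rewrite etens.unlock /tens -!rmorphB -(rmorph0 (qproj _)); apply/qproj_eq.
by rewrite subr0; apply/ideal_gen_sub/BilinDl.
Qed.

Lemma etensDr (a b b' : A) : etens a (b + b') = etens a b + etens a b'.
Proof.
apply/eqP; rewrite -subr_eq0 opprD addrA; apply/eqP.
rewrite etens.unlock /tens -!rmorphB -(rmorph0 (qproj _)); apply/qproj_eq.
by rewrite subr0; apply/ideal_gen_sub/BilinDr.
Qed.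

Lemma etens_Zl c (a b : A) :
  etens (pzC c * a) b = qproj (@bilinear_rel k A (A^c)) (c *: pt a b).
Proof. by rewrite etens.unlock; apply/qproj_eq/ideal_gen_sub/BilinZl. Qed.

Lemma etens_Zr c (a b : A) :
  etens a (pzC c * b) = qproj (@bilinear_rel k A (A^c)) (c *: pt a b).
Proof.
have -> : pzC c * b = (pzC c : A^c) * (b : A^c) :> A by rewrite pzC_central.
by rewrite etens.unlock; apply/qproj_eq/ideal_gen_sub/BilinZr.
Qed.

Lemma etensZ c (a b : A) : etens (pzC c * a) b = etens a (pzC c * b).
Proof. by rewrite etens_Zl etens_Zr. Qed.

Lemma etensM (a b a' b' : A) : etens a b * etens a' b' = etens (a * a') (b' * b).
Proof.
rewrite etens.unlock /tens -rmorphM -[_ * _ in LHS]/(pmalg_mul _ _).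
by rewrite pmalg_mulbb.
Qed.

Lemma etens11 : etens (1 : A) 1 = 1.
Proof.
rewrite etens.unlock -(rmorph1 (qproj _)) -[1 in RHS]/(pmalg_one k _) /pmalg_one.
by rewrite big_seq1.
Qed.

Lemma env_ind (P : R -> Prop) :
  P 0 -> (forall r s, P r -> P s -> P (r + s)) ->
  (forall a b, P (etens a b)) -> forall r, P r.
Proof.
move=> P0 PD PT r; rewrite -[r]qreprK.
rewrite [qrepr r]monalgE raddf_sum /=.
elim/big_ind: _ => // -[a b] _.
have -> : << (qrepr r)@_(a, b) *g (a, b) >> = (qrepr r)@_(a, b) *: pt a b.
  by apply/malgP => y; rewrite mcoeffZ !mcoeffU mulrnAr mulr1.
by rewrite -etens_Zl.
Qed.

Section Lift.
Variables (W : lmodType k) (beta : A -> A -> W).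
Hypothesis betaDl : forall a a' b, beta (a + a') b = beta a b + beta a' b.
Hypothesis betaDr : forall a b b', beta a (b + b') = beta a b + beta a b'.
Hypothesis betaZl : forall c a b, beta (pzC c * a) b = c *: beta a b.
Hypothesis betaZr : forall c a b, beta a (pzC c * b) = c *: beta a b.

Definition env_lift (r : R) : W :=
  tens_lift (A := A) (B := A^c) beta r.

Let betaZr' c a (b : A^c) : beta a (pzC c * b) = c *: beta a b.
Proof. by rewrite -betaZr pzC_central. Qed.

Lemma env_liftT a b : env_lift (etens a b) = beta a b.
Proof. by rewrite etens.unlock; exact: (tens_liftT (B := A^c) betaDl betaDr betaZl betaZr'). Qed.

Fact env_lift_zmod : zmod_morphism env_lift.
Proof. exact: (tens_lift_zmod (B := A^c) betaDl betaDr betaZl betaZr'). Qed.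

End Lift.

Fact lft_zmod : zmod_morphism (@lft k A).
Proof.
by move=> a b; apply/esym/eqP; rewrite lft.unlock subr_eq -etensDl subrK.
Qed.
HB.instance Definition _ := GRing.isZmodMorphism.Build A R (@lft k A) lft_zmod.
Fact lft_monoid : monoid_morphism (@lft k A).
Proof. by split=> [|a b]; rewrite lft.unlock ?etens11 // etensM mulr1. Qed.
HB.instance Definition _ := GRing.isMonoidMorphism.Build A R (@lft k A) lft_monoid.

Fact rgt_zmod : zmod_morphism (@rgt k A).
Proof.
by move=> a b; apply/esym/eqP; rewrite rgt.unlock subr_eq -etensDr subrK.
Qed.
HB.instance Definition _ := GRing.isZmodMorphism.Build A R (@rgt k A) rgt_zmod.

Lemma rgt1 : rgt (1 : A) = 1. Proof. by rewrite rgt.unlock etens11. Qed.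
Lemma rgtM (a b : A) : rgt a * rgt b = rgt (b * a).
Proof. by rewrite rgt.unlock etensM mul1r. Qed.
Lemma etensE (a b : A) : etens a b = lft a * rgt b.
Proof. by rewrite lft.unlock rgt.unlock etensM !mulr1. Qed.
Lemma lft_rgt (a b : A) : lft a * rgt b = rgt b * lft a.
Proof. by rewrite lft.unlock rgt.unlock !etensM !mulr1 !mul1r. Qed.
Lemma lft_pzC c : lft (pzC c : A) = rgt (pzC c).
Proof. by rewrite lft.unlock rgt.unlock -[pzC c]mulr1 etensZ. Qed.
End Enveloping.

(* The enveloping algebra seen through its two embeddings only. *)
Record enveloping (k : fieldType) (A : pzAlgType k) (R : pzRingType)
    (l : {rmorphism A -> R}) (r : {additive A -> R}) : Prop := Enveloping {
  enveloping_r1 : r 1 = 1;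
  enveloping_rM : forall a b, r (a * b) = r b * r a;
  enveloping_lr : forall a b, l a * r b = r b * l a;
  enveloping_C : forall c : k, l (pzC c) = r (pzC c);
  enveloping_ind : forall P : R -> Prop, P 0 ->
    (forall u v, P u -> P v -> P (u + v)) ->
    (forall a b, P (l a * r b)) -> forall u, P u;
  enveloping_lift : forall (W : lmodType k) (beta : A -> A -> W),
    (forall a a' b, beta (a + a') b = beta a b + beta a' b) ->
    (forall a b b', beta a (b + b') = beta a b + beta a b') ->
    (forall c a b, beta (pzC c * a) b = c *: beta a b) ->
    (forall c a b, beta a (pzC c * b) = c *: beta a b) ->
    exists F : {additive R -> W}, forall a b, F (l a * r b) = beta a b }.

Lemma env_enveloping (k : fieldType) (A : pzAlgType k) :
  enveloping (@lft k A) (@rgt k A).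
Proof.
split.
- exact: rgt1.
- by move=> a b; apply/esym/rgtM.
- exact: lft_rgt.
- exact: lft_pzC.
- move=> P P0 PD PT; apply: env_ind => // a b; rewrite etensE; apply: PT.
move=> W beta bDl bDr bZl bZr.
exists (HB.pack_for {additive env A -> W} (env_lift beta)
  (GRing.isZmodMorphism.Build _ _ _ (env_lift_zmod bDl bDr bZl bZr))) => a b /=.
by rewrite -etensE env_liftT.
Qed.

Section Swap.
Variables (k : fieldType) (A : pzAlgType k) (R : pzRingType).
Variables (l : {rmorphism A -> R}) (r : {additive A -> R}).
Hypothesis E : enveloping l r.

Lemma enveloping_central c u : l (pzC c) * u = u * l (pzC c).
Proof.
elim/(enveloping_ind E): u => [|u v IHu IHv|a b]; first by rewrite mulr0 mul0r.
  by rewrite mulrDr mulrDl IHu IHv.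
rewrite mulrA -rmorphM pzC_central rmorphM -mulrA (enveloping_C E).
by rewrite -(enveloping_rM E) -pzC_central (enveloping_rM E) mulrA.
Qed.

(** [R] as a k-space through [l]: a target for [enveloping_lift], which produces maps into
    k-spaces. *)
Definition lscaled : Type := R.
HB.instance Definition _ := GRing.Zmodule.on lscaled.
Definition lscaled_scale (c : k) (u : lscaled) : lscaled := l (pzC c) * (u : R).
Fact lscaledA a b u : lscaled_scale a (lscaled_scale b u) = lscaled_scale (a * b) u.
Proof. by rewrite /lscaled_scale mulrA -!rmorphM. Qed.
Fact lscaled1 : left_id 1 lscaled_scale.
Proof. by move=> u; rewrite /lscaled_scale !rmorph1 mul1r. Qed.
Fact lscaledDr : right_distributive lscaled_scale +%R.
Proof. by move=> c u v; rewrite /lscaled_scale mulrDr. Qed.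
Fact lscaledDl u : {morph lscaled_scale^~ u : a b / a + b}.
Proof. by move=> a b; rewrite /lscaled_scale !rmorphD mulrDl. Qed.
HB.instance Definition _ := GRing.Zmodule_isLmodule.Build k lscaled
  lscaledA lscaled1 lscaledDr lscaledDl.

(** The map a (x) b -> b (x) nu(a) reverses products because [l] preserves them and [r] reverses
    them. With the identity it is the flip that dualises the Koszul complex; with the twisting
    automorphism it defines the twisted bimodule. *)
Lemma enveloping_swap (nu : {rmorphism A -> A}) :
  (forall c, nu (pzC c) = pzC c) ->
  exists sw : {additive R -> R},
    [/\ forall u v, sw (u * v) = sw v * sw u, sw 1 = 1,
        forall a, sw (l a) = r (nu a) & forall a, sw (r a) = l a].
Proof.
move=> nuC.
have [||||sw swE] := @enveloping_lift _ _ _ _ _ E lscaled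
  (fun a b => l b * r (nu a)).
- by move=> a a' b; rewrite !raddfD /= mulrDr.
- by move=> a b b'; rewrite !raddfD /= mulrDl.
- move=> c a b; rewrite rmorphM nuC (enveloping_rM E) -(enveloping_C E).
  by rewrite mulrA -enveloping_central.
- by move=> c a b; rewrite rmorphM -mulrA.
exists (sw : {additive R -> R}).
have r1 := enveloping_r1 E.
have swl a : sw (l a) = r (nu a) by rewrite -[l a]mulr1 -r1 swE rmorph1 mul1r.
have swr a : sw (r a) = l a.
  by rewrite -[r a]mul1r -(rmorph1 l) swE rmorph1 r1 mulr1.
split=> //; last by rewrite -r1 swr rmorph1.
move=> u v.
elim/(enveloping_ind E): u => [|u u' IHu IHu'|a b].
- by rewrite mul0r raddf0 mulr0.
- by rewrite mulrDl raddfD /= IHu IHu' -mulrDr -raddfD.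
elim/(enveloping_ind E): v => [|v v' IHv IHv'|a' b'].
- by rewrite mulr0 raddf0 mul0r.
- by rewrite mulrDr raddfD /= IHv IHv' -mulrDl -raddfD.
have -> : l a * r b * (l a' * r b') = l (a * a') * r (b' * b).
  rewrite rmorphM (enveloping_rM E) !mulrA; congr (_ * _).
  by rewrite -!mulrA (enveloping_lr E).
rewrite !swE !rmorphM (enveloping_rM E) !mulrA; congr (_ * _).
by rewrite -!mulrA (enveloping_lr E).
Qed.

End Swap.

(** * Resolutions given by matrices *)

Section Summand.
Variables (R : pzRingType) (m : nat) (A : 'M[R]_m).

(** The summand R^m A is encoded as the kernel of v -> v A - v, from which it inherits its module
    structure. *)
Definition fix_defect (v : 'rV[R]_m) : 'rV[R]_m := v *m A - v.
Fact fix_defect_linear : linear fix_defect.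
Proof.
move=> c u v; rewrite /fix_defect mulmxDl -scalemxAl opprD scalerBr.
by rewrite addrACA.
Qed.
HB.instance Definition _ :=
  GRing.isLinear.Build R _ _ *:%R fix_defect fix_defect_linear.

Definition summand : Type := Defs.lker fix_defect.
HB.instance Definition _ := GRing.Lmodule.on summand.

Definition svec (u : summand) : 'rV[R]_m := val (u : Defs.lker fix_defect).

Lemma svecP u : svec u *m A = svec u.
Proof.
by have := valP (u : Defs.lker fix_defect); rewrite /lker_mem /= subr_eq0 => /eqP.
Qed.

Fact mk_subproof (v : 'rV[R]_m) : v *m A = v -> lker_mem fix_defect v.
Proof. by move=> vA; rewrite /lker_mem /= /fix_defect vA subrr. Qed.

Definition smk (v : 'rV[R]_m) (vA : v *m A = v) : summand :=
  exist (fun v => lker_mem fix_defect v) v (mk_subproof vA).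

Lemma svec_inj : injective svec.
Proof. exact: val_inj. Qed.

Fact svec_linear : linear svec.
Proof. by move=> c u v; rewrite /svec linearP. Qed.
HB.instance Definition _ := GRing.isLinear.Build R _ _ *:%R svec svec_linear.

Hypothesis AA : A *m A = A.

Definition sproj (v : 'rV[R]_m) : summand.
Proof. by apply: (@smk (v *m A)); rewrite -mulmxA AA. Defined.

Lemma svec_sproj v : svec (sproj v) = v *m A.
Proof. by []. Qed.

Lemma sproj_svec u : sproj (svec u) = u.
Proof. by apply: svec_inj; rewrite svec_sproj svecP. Qed.

Fact sproj_linear : linear sproj.
Proof.
by move=> c u v; apply: svec_inj; rewrite !linearP /= !svec_sproj mulmxDl scalemxAl.
Qed.
HB.instance Definition _ := GRing.isLinear.Build R _ _ *:%R sproj sproj_linear.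

Definition sgen (j : 'I_m) : summand := sproj (delta_mx 0 j).

Lemma sgen_sum u : u = \sum_j svec u 0 j *: sgen j.
Proof.
rewrite -[LHS]sproj_svec [svec u in LHS]row_sum_delta linear_sum /=.
by apply: eq_bigr => j _; rewrite linearZ.
Qed.

Lemma summand_fin_gen : fin_gen summand.
Proof. by exists m, sgen => u; exists (svec u 0); apply: sgen_sum. Qed.

Lemma summand_projective : projective summand.
Proof.
move=> M N g f g_surj.
have [x xE] : exists x : 'I_m -> M, forall j, g (x j) = f (sgen j).
  have /choice[x xE] : forall j, exists y, g y = f (sgen j) by move=> j; apply: g_surj.
  by exists x.
(* The coordinates of [u] itself serve as coefficients, so the lift is linear although the [sgen j]
   need not be free. *)
pose h (u : summand) : M := \sum_j svec u 0 j *: x j.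
have h_lin : linear h.
  move=> c u v; rewrite /h scaler_sumr -big_split /=; apply: eq_bigr => j _.
  by rewrite linearP !mxE scalerDl scalerA.
exists (HB.pack_for {linear summand -> M} h (GRing.isLinear.Build R _ _ *:%R h h_lin)).
move=> u /=; rewrite /h linear_sum [in RHS](sgen_sum u) linear_sum.
by apply: eq_bigr => j _; rewrite !linearZ /= xE.
Qed.

(** Identifies Hom(R^m A, R) with the columns w such that A w = w; transposed differentials become
    left multiplications. *)
Definition dcol (f : dual summand) : 'cV[R]_m := \col_j (f (sgen j) : R).

Lemma dcolE (f : dual summand) u : f u = (svec u *m dcol f) 0 0 :> R.
Proof.
rewrite {1}(sgen_sum u) linear_sum mxE; apply: eq_bigr => j _.
by rewrite linearZ mxE.
Qed.

Lemma dcolP f : A *m dcol f = dcol f.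
Proof.
apply/colP => j; rewrite [RHS]mxE dcolE svec_sproj.
by rewrite -rowE !mxE; apply: eq_bigr => i _; rewrite !mxE.
Qed.

Lemma dcol_inj : injective dcol.
Proof. by move=> f g fg; apply: dualP => u; rewrite !dcolE fg. Qed.

Section OfCol.
Variable w : 'cV[R]_m.
Definition dual_of_col_fun (u : summand) : R^o := (svec u *m w) 0 0.
Fact dual_of_col_linear : linear dual_of_col_fun.
Proof.
by move=> c u v; rewrite /dual_of_col_fun linearP mulmxDl -scalemxAl !mxE.
Qed.
HB.instance Definition _ :=
  GRing.isLinear.Build R _ _ *:%R dual_of_col_fun dual_of_col_linear.
Definition dual_of_col : dual summand := (dual_of_col_fun : {linear summand -> R^o}).
End OfCol.

Lemma dual_of_colE w u : dual_of_col w u = (svec u *m w) 0 0 :> R.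
Proof. by []. Qed.

Lemma dcolK w : A *m w = w -> dcol (dual_of_col w) = w.
Proof.
move=> Aw; apply/colP => j; rewrite mxE dual_of_colE svec_sproj.
by rewrite -mulmxA Aw -rowE mxE.
Qed.

Lemma dcolD f g : dcol (f + g) = dcol f + dcol g.
Proof. by apply/colP => j; rewrite !mxE. Qed.
Lemma dcolZ (c : R^c) f : dcol (c *: f) = \col_j (dcol f j 0 * (c : R)).
Proof. by apply/colP => j; rewrite !mxE. Qed.

End Summand.

Section SummandMap.
Variables (R : pzRingType) (m m' : nat) (A : 'M[R]_m) (A' : 'M[R]_m').
Variable B : 'M[R]_(m, m').
Hypothesis BA : B *m A' = B.

Definition smap (u : summand A) : summand A'.
Proof. by apply: (@smk _ _ _ (svec u *m B)); rewrite -mulmxA BA. Defined.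

Lemma svec_smap u : svec (smap u) = svec u *m B.
Proof. by []. Qed.

Fact smap_linear : linear smap.
Proof.
move=> c u v; apply: svec_inj.
rewrite [RHS](svec_linear c (smap u)) !svec_smap (svec_linear c u).
by rewrite mulmxDl scalemxAl.
Qed.
HB.instance Definition _ := GRing.isLinear.Build R _ _ *:%R smap smap_linear.

Hypothesis AA : A *m A = A.
Hypothesis AA' : A' *m A' = A'.
Hypothesis AB : A *m B = B.

Lemma dcol_smap (f : dual (summand A')) :
  dcol AA (dual_map smap f) = B *m dcol AA' f.
Proof.
apply/colP => j; rewrite [LHS]mxE /= (dcolE AA') svec_smap svec_sproj.
by rewrite -(mulmxA _ A) AB -rowE -row_mul !mxE.
Qed.

End SummandMap.

Section MatrixResolution.
Variables (R : pzRingType) (M : lmodType R) (rk : nat -> nat).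
Variables (A : forall i, 'M[R]_(rk i)) (B : forall i, 'M[R]_(rk i.+1, rk i)).
Variable aug : {linear 'rV[R]_(rk 0) -> M}.
Hypothesis AA : forall i, A i *m A i = A i.
Hypothesis AB : forall i, A i.+1 *m B i = B i.
Hypothesis BA : forall i, B i *m A i = B i.
Hypothesis BB : forall i, B i.+1 *m B i = 0.
Hypothesis augA : forall v, aug (v *m A 0) = aug v.
Hypothesis aug_surj : forall y, exists v, aug v = y.
Hypothesis augB : forall v, aug (v *m B 0) = 0.
Hypothesis exact0 : forall v : 'rV_(rk 0), v *m A 0 = v -> aug v = 0 ->
  exists u, v = u *m B 0.
Hypothesis exactS : forall i (v : 'rV_(rk i.+1)), v *m A i.+1 = v ->
  v *m B i = 0 -> exists u, v = u *m B i.+1.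

Let dm i : {linear summand (A i.+1) -> summand (A i)} :=
  @smap R _ _ (A i.+1) (A i) (B i) (BA i).

Definition mx_aug (u : summand (A 0)) : M := aug (svec u).
Fact mx_aug_linear : linear mx_aug.
Proof. by move=> c u v; rewrite /mx_aug !linearP. Qed.
HB.instance Definition _ := GRing.isLinear.Build R _ _ *:%R mx_aug mx_aug_linear.

Fact mx_aug_surj y : exists u, mx_aug u = y.
Proof.
by have [v <-] := aug_surj y; exists (sproj (AA 0) v); rewrite /mx_aug svec_sproj.
Qed.

Fact mx_exact0 u : mx_aug u = 0 <-> exists v, dm 0 v = u.
Proof.
split=> [/exact0|[v <-]]; last by rewrite /mx_aug svec_smap augB.
case=> [|v uE]; first exact: svecP.
exists (sproj (AA 1) v); apply: svec_inj.
by rewrite svec_smap svec_sproj -mulmxA AB.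
Qed.

Fact mx_exact i u : dm i u = 0 <-> exists v, dm i.+1 v = u.
Proof.
split=> [/(congr1 (@svec _ _ _))|[v <-]]; last first.
  by apply: svec_inj; rewrite !svec_smap -mulmxA BB mulmx0 linear0.
rewrite svec_smap linear0 => /exactS[|v uE]; first exact: svecP.
exists (sproj (AA _) v); apply: svec_inj.
by rewrite svec_smap svec_sproj -mulmxA AB.
Qed.

Definition mx_resolution : proj_resolution M :=
  ProjResolution (fun i => summand_projective (AA i)) mx_aug_surj
    mx_exact0 mx_exact.

Lemma mx_resolution_fin_gen i : fin_gen (mx_resolution i).
Proof. exact: summand_fin_gen. Qed.

Lemma mx_resolution_finite d :
  (forall i, (d < i)%N -> rk i = 0) -> finite_length mx_resolution.
Proof.
move=> rk0; exists d => i /rk0 rki u.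
apply: svec_inj; apply/rowP => -[j lj]; exfalso.
by move: lj; rewrite rki.
Qed.

(** The column w' may be arbitrary: as B A = B, replacing w' by A w' does not change B w'. *)
Definition mx_coboundary i : 'cV[R]_(rk i) -> Prop :=
  if i is j.+1 then fun w => exists w', w = B j *m w' else fun w => w = 0.

Lemma mx_cocycleP i (z : cocycles mx_resolution i) :
  B i *m dcol (AA i) (val z) = 0.
Proof.
have /eqP z0 := valP z.
rewrite -(@dcol_smap _ _ _ (A i.+1) _ _ (BA i) (AA _) (AA _) (AB i)).
by rewrite -[dual_map _ _]/(dual_map (res_d mx_resolution i) (val z)) z0;
  apply/colP => j; rewrite !mxE.
Qed.

Lemma mx_coboundaryP i (f : dual (mx_resolution i)) :
  coboundaries mx_resolution i f <-> mx_coboundary (dcol (AA i) f).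
Proof.
case: i f => [|i] f /=.
  split=> [[g <-]|f0]; first by apply/colP => j; rewrite !mxE.
  have -> : f = 0.
    by apply: (@dcol_inj _ _ _ (AA 0) f 0); rewrite f0; apply/colP => j; rewrite !mxE.
  by exists 0.
split=> [[g <-]|[w fE]].
  by exists (dcol (AA i) g); rewrite -(@dcol_smap _ _ _ (A i.+1) _ _ (BA i) (AA _) (AA _) (AB i)).
exists (@dual_of_col _ _ (A i) (A i *m w)).
apply: (@dcol_inj _ _ _ (AA i.+1) (dual_map (dm i) _) f).
rewrite -[dual_map _ _]/(dual_map (dm i) _).
rewrite (@dcol_smap _ _ _ (A i.+1) _ _ (BA i) (AA _) (AA _) (AB i)) dcolK ?mulmxA ?AA //.
by rewrite BA -fE.
Qed.

Lemma mx_Ext_vanishes i :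
  (forall w : 'cV_(rk i), A i *m w = w -> B i *m w = 0 -> mx_coboundary w) ->
  Ext_vanishes M i.
Proof.
move=> van; exists mx_resolution => x; rewrite -[x]lreprK -(raddf0 (lpi _)).
apply/lpi_eq; rewrite subr0 /=; apply/mx_coboundaryP/van; first exact: dcolP.
exact: mx_cocycleP.
Qed.

Variables (d : nat) (X : lmodType (R^c)) (theta : {additive 'cV[R]_(rk d) -> X}).
Hypothesis thetaZ : forall (c : R) (w : 'cV[R]_(rk d)),
  theta (\col_j (w j 0 * c)) = (c : R^c) *: theta w.
Hypothesis thetaA : forall w, theta (A d *m w) = theta w.
Hypothesis theta_surj : forall y, exists w, theta w = y.
Hypothesis theta_cob : forall w, mx_coboundary w -> theta w = 0.
Hypothesis theta_ker : forall w, A d *m w = w -> theta w = 0 -> mx_coboundary w.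
Hypothesis top : forall w : 'cV[R]_(rk d), B d *m w = 0.

Definition mx_Ext_map (x : Ext mx_resolution d) : X :=
  theta (dcol (AA d) (val (lrepr x))).

Lemma mx_Ext_map_pi z : mx_Ext_map (lpi _ z) = theta (dcol (AA d) (val z)).
Proof.
apply/subr0_eq; rewrite /mx_Ext_map -raddfB.
have /mx_coboundaryP := lrepr_lpi (lpreimage (val : {linear cocycles mx_resolution d -> dual (mx_resolution d)}) (coboundaries mx_resolution d)) z.
move=> /theta_cob <-; congr (theta _).
by apply/colP => j; rewrite !mxE.
Qed.

Fact mx_Ext_map_linear : linear mx_Ext_map.
Proof.
move=> c x y; rewrite -[x]lreprK -[y]lreprK -linearZ -linearD !mx_Ext_map_pi /=.
by rewrite dcolD raddfD dcolZ thetaZ.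
Qed.

(** By [top] every column fixed by A is a cocycle, so Ext^d is the module of fixed columns modulo
    coboundaries. On fixed columns [theta] has exactly this kernel, and by [thetaA] it is still
    surjective there. *)
Lemma mx_Ext_iso : Ext_iso M d X.
Proof.
exists mx_resolution.
exists (HB.pack_for {linear Ext mx_resolution d -> X} mx_Ext_map
  (GRing.isLinear.Build _ _ _ *:%R mx_Ext_map mx_Ext_map_linear)) => /=.
have inj (x : Ext mx_resolution d) : mx_Ext_map x = 0 -> x = 0.
  rewrite -[x]lreprK mx_Ext_map_pi => /theta_ker x0.
  rewrite -(raddf0 (lpi _)); apply/lpi_eq; rewrite subr0 /=.
  by apply/mx_coboundaryP/x0/dcolP.
have surj y : exists x, mx_Ext_map x = y.
  have [w wy] := theta_surj y.
  pose f := @dual_of_col _ _ (A d) (A d *m w).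
  have fE : dcol (AA d) f = A d *m w by rewrite dcolK // mulmxA AA.
  have fz : lker_mem (dual_map (res_d mx_resolution d)) f.
    apply/eqP; apply: (@dcol_inj _ _ _ (AA d.+1) (dual_map (dm d) _) 0).
    rewrite -[dual_map _ _]/(dual_map (dm d) _).
    rewrite (@dcol_smap _ _ _ (A d.+1) _ _ (BA d) (AA _) (AA _) (AB d)) top.
    by apply/colP => j; rewrite !mxE.
  have [z zE] : exists z : cocycles mx_resolution d, val z = f.
    by exists (exist _ f fz : Defs.lker (dual_map (res_d mx_resolution d))).
  by exists (lpi _ z); rewrite mx_Ext_map_pi zE fE thetaA.
have /choice[g gE] := surj.
exists g => // x; apply/subr0_eq/inj.
have -> : mx_Ext_map (g (mx_Ext_map x) - x) =
    mx_Ext_map (g (mx_Ext_map x)) - mx_Ext_map x.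
  by have := mx_Ext_map_linear (-1) x (g (mx_Ext_map x)); rewrite !scaleN1r ![- _ + _]addrC.
by rewrite gE subrr.
Qed.

End MatrixResolution.

(** * Twisted bimodules *)

Section Twist.
Variables (k : fieldType) (A : pzAlgType k) (nu : {rmorphism A -> A}).
Local Notation R := (env A).
Variable sw : {additive R -> R}.
Hypothesis swM : forall u v, sw (u * v) = sw v * sw u.
Hypothesis sw1 : sw 1 = 1.

(* When [sw] sends [b (x) c] to [c (x) nu(b)], this is [A] with [b (x) c]
   acting as u |-> c u nu(b), i.e. with right multiplication twisted by [nu]. *)
Definition twisted : Type := A.
HB.instance Definition _ := GRing.Zmodule.on twisted.

Definition twisted_scale (r : R^c) (u : twisted) : twisted :=
  (sw (r : R) *: (u : regbimod A) : regbimod A).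

Fact twisted_scaleA r s u :
  twisted_scale r (twisted_scale s u) = twisted_scale (r * s) u.
Proof.
have e : sw ((r * s : R^c) : R) = sw (r : R) * sw (s : R) by exact: swM.
by rewrite /twisted_scale scalerA -e.
Qed.
Fact twisted_scale1 : left_id 1 twisted_scale.
Proof.
move=> u; have e : sw ((1 : R^c) : R) = 1 by exact: sw1.
by rewrite /twisted_scale e scale1r.
Qed.
Fact twisted_scaleDr : right_distributive twisted_scale +%R.
Proof. by move=> r u v; rewrite /twisted_scale scalerDr. Qed.
Fact twisted_scaleDl u : {morph twisted_scale^~ u : r s / r + s}.
Proof.
move=> r s; have e : sw ((r + s : R^c) : R) = sw (r : R) + sw (s : R) by exact: raddfD.
rewrite /twisted_scale e.
exact: (regbimod_scaleDl (u : regbimod A) (sw (r : R)) (sw (s : R))).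
Qed.
HB.instance Definition _ := GRing.Zmodule_isLmodule.Build (R^c) twisted
  twisted_scaleA twisted_scale1 twisted_scaleDr twisted_scaleDl.

Definition twisted_bimod : bimodType A := twisted.

Lemma twisted_scaleE (r : R) (u : twisted_bimod) :
  (r : R^c) *: u = (sw r *: (u : regbimod A) : regbimod A).
Proof. by []. Qed.

Hypothesis swl : forall a, sw (lft a) = rgt (nu a).
Hypothesis swr : forall a, sw (rgt a) = lft a.

Lemma lft_scale a (u : regbimod A) : lft a *: u = a * (u : A).
Proof.
by rewrite lft.unlock etens.unlock [LHS]regbimod_scale_tens mulr1.
Qed.

Lemma rgt_scale a (u : regbimod A) : rgt a *: u = (u : A) * a.
Proof.
by rewrite rgt.unlock etens.unlock [LHS]regbimod_scale_tens mul1r.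
Qed.

Lemma twisted_actl a (u : twisted_bimod) : bimod_actl a u = a * (u : A).
Proof.
rewrite -(lft_scale a u) -swr -twisted_scaleE /bimod_actl.
by rewrite rgt.unlock etens.unlock.
Qed.

Lemma twisted_actr b (u : twisted_bimod) : bimod_actr u b = (u : A) * nu b.
Proof.
rewrite -(rgt_scale (nu b) u) -swl -twisted_scaleE /bimod_actr.
by rewrite lft.unlock etens.unlock.
Qed.

End Twist.

Section IntLift.
Variables (K : choiceType) (W : zmodType) (h : K -> W).

(** Universal property of the free abelian group, of which [tens_over] is a quotient. *)
Definition int_lift (z : {malg int[K]}) : W := \sum_(x <- msupp z) h x *~ z@_x.

Lemma int_liftw (d : {fset K}) z : (msupp z `<=` d)%fset ->
  int_lift z = \sum_(x <- d) h x *~ z@_x.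
Proof.
move=> le_zd; apply: big_fset_incl => // x _ /mcoeff_outdom ->.
by rewrite mulr0z.
Qed.

Fact int_lift_zmod : zmod_morphism int_lift.
Proof.
move=> f g; pose d := (msupp f `|` msupp g)%fset.
have fd : (msupp f `<=` d)%fset by apply: fsubsetUl.
have gd : (msupp g `<=` d)%fset by apply: fsubsetUr.
have fgd : (msupp (f - g) `<=` d)%fset by apply: msuppB_le.
rewrite (int_liftw fgd) (int_liftw fd) (int_liftw gd) -sumrB.
by apply: eq_bigr => x _; rewrite mcoeffB mulrzBr.
Qed.
HB.instance Definition _ :=
  GRing.isZmodMorphism.Build {malg int[K]} W int_lift int_lift_zmod.

Lemma int_liftU x : int_lift << x >> = h x.
Proof.
by rewrite (int_liftw (@msuppU_le _ _ _ _)) big_seq_fset1 mcoeffUU.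
Qed.

End IntLift.

Section TwistInverse.
Variables (k : fieldType) (A : pzAlgType k) (nu : {rmorphism A -> A}).
Variables (U V : bimodType A) (fU : {additive U -> A}) (fV : {additive V -> A}).
Hypothesis fU_bij : bijective fU.
Hypothesis fV_bij : bijective fV.

(* Both factors are identified with [A]: on [U] the right action is twisted by
   [nu], on [V] by its inverse. *)
Hypothesis fUl : forall a u, fU (bimod_actl a u) = a * fU u.
Hypothesis fUr : forall b u, fU (bimod_actr u b) = fU u * nu b.
Hypothesis fVl : forall a v, nu (fV (bimod_actl a v)) = nu a * nu (fV v).
Hypothesis fVr : forall b v, nu (fV (bimod_actr v b)) = nu (fV v) * b.
Hypothesis nu_bij : bijective nu.

(** The isomorphism is u (x) v -> u nu(v), with inverse a -> a (x) v1 where nu(v1) = 1. Any v is v1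
    multiplied on the left by the element of A that it stands for, and balancing moves this factor
    to u. *)
Lemma twist_tens_iso : tens_over_iso_regular U V.
Proof.
pose h (p : U * V) : A := fU p.1 * nu (fV p.2).
pose th : {additive {malg int[(U * V)%type]} -> A} := int_lift h.
have thU p : th << p >> = h p by exact: int_liftU.
have th_bal z : lspan (@balanced_rel k A U V) z -> th z = 0.
  move=> Iz.
  have P0 : th 0 = 0 by rewrite raddf0.
  have PD x y : th x = 0 -> th y = 0 -> th (x + y) = 0.
    by move=> hx hy; rewrite raddfD hx hy addr0.
  have PZ (a : int) x : th x = 0 -> th (a *: x) = 0.
    by move=> hx; rewrite -[a]intz scaler_int raddfMz hx mul0rz.
  apply: (Iz (@Submod _ _ (fun z => th z = 0) P0 PD PZ)) => s /=.
  case=> [u u' v|u v v'|u a v]; rewrite !raddfB !thU /h /=.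
  - by rewrite raddfD /= mulrDl addrAC addrK subrr.
  - by rewrite !raddfD /= mulrDr addrAC addrK subrr.
  by rewrite fUr fVl mulrA subrr.
pose theta (t : tens_over U V) : A := th (lrepr t).
have thetaE z : theta (lpi _ z) = th z.
  by apply/subr0_eq; rewrite -raddfB; apply/th_bal/lrepr_lpi.
have theta_zmod : zmod_morphism theta.
  by move=> s t; rewrite -[s]lreprK -[t]lreprK -raddfB !thetaE raddfB.
pose thA : {additive tens_over U V -> A} :=
  HB.pack theta (GRing.isZmodMorphism.Build _ _ _ theta_zmod).
have [gU gUK fUK] := fU_bij.
have [gV gVK fVK] := fV_bij.
have [mu nuK muK] := nu_bij.
exists thA; split; last first.
  move=> a u v b; rewrite /= !thetaE !thU /h /= fUl fVr.
  by rewrite !mulrA.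
pose v1 := gV (mu 1).
have v1E : nu (fV v1) = 1 by rewrite fVK muK.
have t1 (t : tens_over U V) : exists u, t = tens_elt u v1.
  have bDl u u' v : tens_elt (u + u') v = tens_elt u v + tens_elt u' v.
    apply/subr0_eq; rewrite opprD addrA -!raddfB -(raddf0 (lpi _)).
    by apply/lpi_eq; rewrite subr0; apply/lspan_sub/BalDl.
  have bA u a v : tens_elt (bimod_actr u a) v = tens_elt u (bimod_actl a v).
    by apply/lpi_eq/lspan_sub/BalA.
  have b0 v : tens_elt 0 v = 0.
    by apply: (@addrI _ (tens_elt 0 v)); rewrite -bDl !addr0.
  have bN u v : tens_elt (- u) v = - tens_elt u v.
    by apply/eqP; rewrite -addr_eq0 -bDl addNr b0.
  have bn u v n : tens_elt (u *+ n) v = tens_elt u v *+ n.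
    by elim: n => [|n IHn]; rewrite ?mulr0n ?b0 // !mulrS bDl IHn.
  have bz u v (c : int) : tens_elt (u *~ c) v = tens_elt u v *~ c.
    by case: c => c; rewrite ?NegzE ?mulrNz ?bN -!pmulrn bn.
  have pure u v : tens_elt u v = tens_elt (bimod_actr u (fV v)) v1.
    rewrite bA; congr tens_elt; apply: (can_inj gVK); apply: (can_inj nuK).
    by rewrite fVl v1E mulr1.
  rewrite -[t]lreprK [lrepr t]monalgE raddf_sum.
  elim/big_ind: _ => [|x y [u ->] [u' ->]|[u v] _].
  - by exists 0; rewrite b0.
  - by exists (u + u'); rewrite bDl.
  exists (bimod_actr u (fV v) *~ (lrepr t)@_(u, v)); rewrite bz -pure.
  rewrite -[RHS]raddfMz; congr (lpi _ _); apply/malgP => y.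
  by rewrite mcoeffU raddfMz /= mcoeffU; case: (_ == _); rewrite ?mul0rz //= mulr1n intz.
exists (fun a => tens_elt (gU a) v1) => [t|a] /=.
  have [u ->] := t1 t.
  by rewrite thetaE thU /h /= v1E mulr1 gUK.
by rewrite thetaE thU /h /= v1E mulr1 fUK.
Qed.

End TwistInverse.

Section TwistedInverse.
Variables (k : fieldType) (A : pzAlgType k) (nu mu : {rmorphism A -> A}).
Hypotheses (nuK : cancel nu mu) (muK : cancel mu nu).
Variables sw sw' : {additive env A -> env A}.
Hypotheses (swM : forall u v, sw (u * v) = sw v * sw u) (sw1 : sw 1 = 1).
Hypotheses (swl : forall a, sw (lft a) = rgt (nu a)).
Hypotheses (swr : forall a, sw (rgt a) = lft a).
Hypotheses (swM' : forall u v, sw' (u * v) = sw' v * sw' u) (sw1' : sw' 1 = 1).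
Hypotheses (swl' : forall a, sw' (lft a) = rgt (mu a)).
Hypotheses (swr' : forall a, sw' (rgt a) = lft a).
Let U := twisted_bimod swM sw1.
Let V := twisted_bimod swM' sw1'.

Definition untwist (u : U) : A := u.
Fact untwist_zmod : zmod_morphism untwist. Proof. by []. Qed.
HB.instance Definition _ := GRing.isZmodMorphism.Build U A untwist untwist_zmod.
Definition untwist' (v : V) : A := v.
Fact untwist'_zmod : zmod_morphism untwist'. Proof. by []. Qed.
HB.instance Definition _ := GRing.isZmodMorphism.Build V A untwist' untwist'_zmod.

Lemma twisted_tens_iso : tens_over_iso_regular U V.
Proof.
apply: (@twist_tens_iso _ _ nu U V untwist untwist').
- by exists id.
- by exists id.
- by move=> a u; rewrite /untwist (twisted_actl swr).
- by move=> b u; rewrite /untwist (twisted_actr swl).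
- by move=> a v; rewrite /untwist' (twisted_actl swr') rmorphM.
- by move=> b v; rewrite /untwist' (twisted_actr swl') rmorphM muK.
by exists mu.
Qed.

End TwistedInverse.

(** * Twisted Koszul complexes *)

Section Koszul.
Variables (k : fieldType) (D : pzAlgType k) (R : pzRingType).
Variables (l : {rmorphism D -> R}) (r : {additive D -> R}).
Hypothesis E : enveloping l r.
Variables (I : choiceType) (bas : I -> D) (co : {additive D -> {malg k[I]}}).
Hypothesis coZ : forall c d, co (pzC c * d) = c *: co d.
Hypothesis coK : forall d, d = \sum_(m <- msupp (co d)) pzC (co d)@_m * bas m.
Hypothesis co_bas : forall m, co (bas m) = << m >>.

Lemma coord_ex m : exists F : {additive R -> D},
  forall u v, F (l u * r v) = pzC (co u)@_m * v.
Proof.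
have [||||F FE] := @enveloping_lift _ _ _ _ _ E (kspace D)
   (fun u v => pzC (co u)@_m * v); last by exists (F : {additive R -> D}).
- by move=> a a' b; rewrite raddfD /= mcoeffD rmorphD mulrDl.
- by move=> a b b'; rewrite mulrDr.
- by move=> c a b; rewrite coZ mcoeffZ rmorphM -mulrA.
by move=> c a b; rewrite mulrA -pzC_central -mulrA.
Qed.

(** R is D (x) D, free over its right factor on the basis [bas] of the left one; [coord m] is the
    coefficient of [bas m], an element of D. *)
Definition coord m : {additive R -> D} := projT1 (cid (coord_ex m)).

Lemma coordE m u v : coord m (l u * r v) = pzC (co u)@_m * v.
Proof. exact: (projT2 (cid (coord_ex m))). Qed.

Lemma coord_bas m m' v : coord m (l (bas m') * r v) = if m == m' then v else 0.
Proof.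
rewrite coordE co_bas mcoeffU eq_sym; case: eqP => _; last by rewrite raddf0 mul0r.
by rewrite mulr1n rmorph1 mul1r.
Qed.

Lemma coord_expand z : exists F : seq I, [/\ uniq F,
  z = \sum_(m <- F) l (bas m) * r (coord m z) & forall m, m \notin F -> coord m z = 0].
Proof.
elim/(enveloping_ind E): z => [|u v [F [uF uE u0]] [G [uG vE v0]]|a b].
- by exists [::]; split=> // [|m _]; rewrite ?big_nil ?raddf0.
- have ext H K (z : R) : uniq H -> uniq K -> {subset H <= K} ->
      (forall m, m \notin H -> coord m z = 0) ->
      \sum_(m <- H) l (bas m) * r (coord m z) =
      \sum_(m <- K) l (bas m) * r (coord m z).
    move=> uH uK HK z0; rewrite [RHS](bigID (mem H)) /= [X in _ = _ + X]big1 ?addr0.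
      rewrite -[RHS]big_filter; apply: perm_big; apply: uniq_perm => //.
        exact: filter_uniq.
      by move=> m; rewrite mem_filter; apply/idP/andP => [mH|[]//]; split=> //; apply: HK.
    by move=> m mH; rewrite z0 // raddf0 mulr0.
  exists (undup (F ++ G)); split=> [||m].
  - exact: undup_uniq.
  - rewrite {1}uE {1}vE (ext F (undup (F ++ G)) u) ?undup_uniq //; last first.
      by move=> m mF; rewrite mem_undup mem_cat mF.
    rewrite (ext G (undup (F ++ G)) v) ?undup_uniq //; last first.
      by move=> m mG; rewrite mem_undup mem_cat mG orbT.
    rewrite -big_split; apply: eq_bigr => m _ /=.
    by rewrite !raddfD /= mulrDr.
  by rewrite mem_undup mem_cat negb_or raddfD /= => /andP[/u0 -> /v0 ->]; rewrite addr0.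
exists (enum_fset (msupp (co a))); split=> [||m ma].
- exact: fset_uniq.
- rewrite {1}(coK a) raddf_sum mulr_suml /=; apply: eq_bigr => m _.
  rewrite coordE rmorphM (enveloping_rM E) -(enveloping_C E) -mulrA.
  by rewrite (enveloping_central E) mulrA.
by rewrite coordE mcoeff_outdom // raddf0 mul0r.
Qed.

Lemma coord_inj z : (forall m, coord m z = 0) -> z = 0.
Proof.
move=> z0; have [F [_ -> _]] := coord_expand z.
by rewrite big1 // => m _; rewrite z0 raddf0 mulr0.
Qed.

Lemma coord_mulr m z y : coord m (z * r y) = y * coord m z.
Proof.
elim/(enveloping_ind E): z => [|u v IHu IHv|u v].
- by rewrite mul0r !raddf0 mulr0.
- by rewrite mulrDl !raddfD /= IHu IHv mulrDr.
rewrite -mulrA -(enveloping_rM E) !coordE.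
by rewrite mulrA pzC_central -mulrA.
Qed.

(** [l y] commutes with the right factor, so it only transports coordinates along [s]; injectivity
    on the support prevents two of them from merging. *)
Lemma coord_mull (X : pred I) (s : I -> I) (f : I -> k) y z :
  (forall m, ~~ X m -> coord m z = 0) ->
  {in X &, injective s} ->
  (forall m, X m -> bas m * y = pzC (f m) * bas (s m)) ->
  (forall m, X m -> coord (s m) (z * l y) = pzC (f m) * coord m z) /\
  (forall m, (forall m', X m' -> m != s m') -> coord m (z * l y) = 0).
Proof.
move=> zX s_inj sE; have [F [uF zE z0]] := coord_expand z.
have key m : coord m (z * l y) =
    \sum_(i <- F | X i && (m == s i)) pzC (f i) * coord i z.
  rewrite [in LHS]zE mulr_suml raddf_sum big_mkcondr /= [RHS]big_mkcond /=.
  apply: eq_bigr => i _; case: ifP => [Xi|/negbT /zX ->]; last first.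
    by rewrite raddf0 mulr0 mul0r raddf0.
  rewrite -mulrA -(enveloping_lr E) mulrA -rmorphM sE // rmorphM.
  rewrite -mulrA (enveloping_central E) -mulrA (enveloping_C E).
  by rewrite -(enveloping_rM E) coord_bas.
split=> [m Xm|m ms]; rewrite key; last first.
  by apply: big1 => i /andP[Xi /eqP mi]; have := ms i Xi; rewrite mi eqxx.
have [mF|mF] := boolP (m \in F); last first.
  rewrite z0 // mulr0; apply: big1 => i /andP[Xi /eqP mi].
  by rewrite z0 ?mulr0 // -(s_inj _ _ Xm Xi mi).
rewrite (big_rem m) //= Xm eqxx /= big_seq_cond big1 ?addr0 // => i.
case/and3P; rewrite mem_rem_uniq // inE => /andP[/negP im _] Xi /eqP mi.
by case: im; rewrite (s_inj _ _ Xm Xi mi).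
Qed.

Variable N : nat.
Local Notation Z := 'I_N.+2.
Variable e : Z -> D.
Hypothesis eM : forall i j, e i * e j = if i == j then e i else 0.
Hypothesis e_sum : \sum_i e i = 1.

Definition diag (f : Z -> k) : D := \sum_i pzC (f i) * e i.
(** The left module R wt(c) is the sum over i of D e_i (x) e_(i+c) D, a projective bimodule. *)
Definition wt (c : Z) : R := \sum_i l (e i) * r (e (i + c)).
Definition has_deg (d : Z) (y : D) := forall i, e i * y = y * e (i + d).

Lemma e_diag i f : e i * diag f = pzC (f i) * e i.
Proof.
rewrite mulr_sumr (bigD1 i) //= big1 ?addr0 => [|j ji].
  by rewrite mulrA -pzC_central -mulrA eM eqxx.
by rewrite mulrA -pzC_central -mulrA eM eq_sym (negPf ji) mulr0.
Qed.

Lemma diag_e i f : diag f * e i = pzC (f i) * e i.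
Proof.
rewrite mulr_suml (bigD1 i) //= big1 ?addr0 => [|j ji].
  by rewrite -mulrA eM eqxx.
by rewrite -mulrA eM (negPf ji) mulr0.
Qed.

Lemma has_degM d d' y y' : has_deg d y -> has_deg d' y' -> has_deg (d + d') (y * y').
Proof. by move=> hy hy' i; rewrite mulrA hy -mulrA hy' mulrA addrA. Qed.

Lemma deg_diag d y f : has_deg d y -> y * diag (fun i => f (i - d)) = diag f * y.
Proof.
move=> hy; rewrite mulr_sumr mulr_suml [RHS](reindex_inj (addIr (- d))) /=.
apply: eq_bigr => i _; rewrite mulrA -pzC_central -!mulrA hy.
by congr (_ * (_ * e _)); ring.
Qed.

Lemma wtE c : wt c = \sum_i l (e i) * r (e (i + c)).
Proof. by []. Qed.

Lemma wt_l i c : wt c * l (e i) = l (e i) * r (e (i + c)).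
Proof.
rewrite mulr_suml (bigD1 i) //= big1 ?addr0 => [|j ji].
  by rewrite -mulrA -(enveloping_lr E) mulrA -rmorphM eM eqxx.
rewrite -mulrA -(enveloping_lr E) mulrA -rmorphM eM (negPf ji).
by rewrite rmorph0 mul0r.
Qed.

Lemma wtM c : wt c * wt c = wt c.
Proof.
rewrite {2}/wt mulr_sumr; apply: eq_bigr => i _.
by rewrite mulrA wt_l -mulrA -(enveloping_rM E) eM eqxx.
Qed.

(** Left and right multiplication by a homogeneous y shift the weight by the same amount, so their
    difference maps one weight summand to another. *)
Lemma l_wt d y c : has_deg d y -> l y * wt c = wt (d + c) * l y.
Proof.
move=> hy; rewrite mulr_sumr mulr_suml [RHS](reindex_inj (addIr (- d))) /=.
apply: eq_bigr => i _; rewrite mulrA -!rmorphM.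
rewrite -[in RHS]mulrA -(enveloping_lr E) mulrA -rmorphM hy.
by congr (l (_ * e _) * r (e _)); ring.
Qed.

Lemma r_wt d y c : has_deg d y -> r y * wt c = wt (d + c) * r y.
Proof.
move=> hy; rewrite mulr_sumr mulr_suml; apply: eq_bigr => i _.
rewrite mulrA -(enveloping_lr E) -!mulrA -!(enveloping_rM E) hy.
by congr (_ * r (_ * e _)); ring.
Qed.

Lemma diag_deg f : has_deg 0 (diag f).
Proof. by move=> i; rewrite addr0 e_diag diag_e. Qed.

(** A diagonal coefficient passes from the right factor to the left one, shifted by the weight;
    hence [tdiff] carries all its coefficients on the left. *)
Lemma r_diag_wt f c : r (diag f) * wt c = l (diag (fun i => f (i + c))) * wt c.
Proof.
rewrite !mulr_sumr; apply: eq_bigr => i _.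
rewrite mulrA -(enveloping_lr E) -!mulrA -(enveloping_rM E) e_diag.
rewrite mulrA -rmorphM diag_e rmorphM (enveloping_rM E) -(enveloping_C E).
by rewrite -(enveloping_central E) mulrA -(enveloping_central E) -mulrA.
Qed.

Definition tdiff (y : D) (g1 g2 : Z -> k) : R :=
  l (diag g1) * l y - l (diag g2) * r y.

Lemma tdiff_wt d y g1 g2 c : has_deg d y ->
  tdiff y g1 g2 * wt c = wt (d + c) * tdiff y g1 g2.
Proof.
move=> hy; rewrite mulrBl mulrBr -!mulrA (l_wt _ hy) (r_wt _ hy) !mulrA.
by rewrite !(l_wt _ (diag_deg _)) !add0r.
Qed.

(* A twisted difference in [y], seen as a map from weight [d + c] to [c]. *)
Definition is_tdiff (d : Z) (y : D) (c : Z) (x : R) : Prop :=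
  exists g1 g2, [/\ forall i, g1 i != 0, forall i, g2 i != 0 &
    x = tdiff y g1 g2 * wt c].

Definition has_wt (c : Z) (z : R) := z * wt c = z.

Lemma has_wtM c z u : has_wt c u -> has_wt c (z * u).
Proof. by rewrite /has_wt -mulrA => ->. Qed.
Lemma has_wtD c z u : has_wt c z -> has_wt c u -> has_wt c (z + u).
Proof. by rewrite /has_wt mulrDl => -> ->. Qed.
Lemma has_wtN c z : has_wt c z -> has_wt c (- z).
Proof. by rewrite /has_wt mulNr => ->. Qed.
Lemma has_wtB c z u : has_wt c z -> has_wt c u -> has_wt c (z - u).
Proof. by move=> ? ?; apply/has_wtD/has_wtN. Qed.
Lemma wt_has_wt c z : has_wt c (z * wt c).
Proof. by rewrite /has_wt -mulrA wtM. Qed.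

Lemma is_tdiff_wt d y c x : is_tdiff d y c x -> has_wt c x.
Proof. by case=> g1 [g2 [_ _ ->]]; apply: wt_has_wt. Qed.

(** The flip negates weights and exchanges the two terms, so a difference from weight d + c to c
    becomes one from -c to -(d + c). [r_diag_wt] brings the coefficients back to the left. *)
Lemma is_tdiff_swap (sw : {additive R -> R}) d y c x :
  (forall u v, sw (u * v) = sw v * sw u) ->
  (forall a, sw (l a) = r a) -> (forall a, sw (r a) = l a) ->
  has_deg d y -> is_tdiff d y c x -> is_tdiff d y (- (d + c)) (sw x).
Proof.
move=> swM swl swr hy [g1 [g2 [g1n0 g2n0 ->]]].
have sw_wt b : sw (wt b) = wt (- b).
  rewrite raddf_sum [RHS](reindex_inj (addIr b)) /=; apply: eq_bigr => i _.
  by rewrite swM swl swr addrK.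
set b := - (d + c).
have -> : sw (tdiff y g1 g2 * wt c) = sw (tdiff y g1 g2) * wt b.
  by rewrite (tdiff_wt _ _ _ hy) swM sw_wt.
exists (fun i => - g2 (i + d + b)), (fun i => - g1 (i + b)).
split=> [i|i|]; rewrite ?oppr_eq0 //.
have diagN f : diag (fun i => - f i) = - diag f.
  by rewrite -sumrN; apply: eq_bigr => i _; rewrite rmorphN mulNr.
rewrite raddfB /= !swM !swl swr /tdiff !diagN !rmorphN !mulNr opprK addrC.
rewrite !mulrDl !mulNr; congr (- _ + _).
  rewrite -[in LHS]mulrA r_diag_wt mulrA -!rmorphM; congr (l _ * _).
  rewrite -(deg_diag _ hy); congr (_ * diag _).
  by apply/funext => i; rewrite subrK.
by rewrite -mulrA r_diag_wt mulrA -(enveloping_lr E).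
Qed.

Variable en : I -> Z.
Hypothesis bas_e : forall m i, bas m * e i = if en m == i then bas m else 0.

Definition supp (X : pred I) (z : R) := forall m, ~~ X m -> coord m z = 0.

Lemma supp0 X : supp X 0.
Proof. by move=> m _; rewrite raddf0. Qed.
Lemma suppD X u v : supp X u -> supp X v -> supp X (u + v).
Proof. by move=> hu hv m Xm; rewrite raddfD /= hu ?hv ?addr0. Qed.
Lemma suppN X u : supp X u -> supp X (- u).
Proof. by move=> hu m Xm; rewrite raddfN /= hu ?oppr0. Qed.
Lemma suppB X u v : supp X u -> supp X v -> supp X (u - v).
Proof. by move=> hu hv; apply/suppD/suppN. Qed.

Lemma supp_bas (X : pred I) m v : X m -> supp X (l (bas m) * r v).
Proof.
move=> Xm m' Xm'; rewrite coord_bas; case: eqP => // mE.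
by rewrite mE Xm in Xm'.
Qed.

Lemma bas_diag m g : bas m * diag g = pzC (g (en m)) * bas m.
Proof.
rewrite mulr_sumr (bigD1 (en m)) //= big1 ?addr0 => [|j ji].
  by rewrite mulrA -pzC_central -mulrA bas_e eqxx.
by rewrite mulrA -pzC_central -mulrA bas_e eq_sym (negPf ji) mulr0.
Qed.

Lemma coord_diag m g z : coord m (z * l (diag g)) = pzC (g (en m)) * coord m z.
Proof.
have h1 m' : ~~ (predT : pred I) m' -> coord m' z = 0 by [].
have h2 : {in predT &, injective (@id I)} by move=> ? ? _ _.
have h3 m' : (predT : pred I) m' -> bas m' * diag g = pzC (g (en m')) * bas (id m').
  by move=> _; apply: bas_diag.
by have [h _] := coord_mull h1 h2 h3; apply: h.
Qed.

Lemma supp_wt X c z : supp X z -> supp X (z * wt c).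
Proof.
move=> zX m Xm; rewrite mulr_sumr raddf_sum big1 // => i _.
rewrite mulrA coord_mulr.
have -> : e i = diag (fun j => (j == i)%:R).
  rewrite /diag (bigD1 i) //= eqxx rmorph1 mul1r big1 ?addr0 // => j ji.
  by rewrite (negPf ji) rmorph0 mul0r.
by rewrite coord_diag zX ?mulr0.
Qed.

Section TwistedDifference.
Variables (X X0 : pred I) (s : I -> I) (deg : I -> nat) (y : D) (d : Z).
Hypothesis sX : forall m, X m -> X (s m).
Hypothesis s_inj : {in X &, injective s}.
Hypothesis sE : forall m, X m -> bas m * y = bas (s m).
Hypothesis deg_s : forall m, X m -> deg (s m) = (deg m).+1.
Hypothesis X0E : forall m, X0 m = X m && (deg m == 0).
Hypothesis decX : forall m, X m -> deg m != 0 -> exists2 m', X m' & m = s m'.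
Hypothesis hy : has_deg d y.

(** The coordinate at [s m] involves that of z at m, and y times that of z at [s m]: a system
    triangular in [deg], which [tdiff_inj] solves downwards from the top degree. *)
Lemma coord_tdiff g1 g2 z : supp X z ->
  (forall m, X m -> coord (s m) (z * tdiff y g1 g2) =
     pzC (g1 (en m)) * coord m z -
     y * (pzC (g2 (en (s m))) * coord (s m) z)) /\
  supp X (z * tdiff y g1 g2).
Proof.
move=> zX.
have [m Xm|h1 h2] := @coord_mull X s
  (fun m => g1 (en m)) (diag g1 * y) z zX s_inj.
- by rewrite mulrA bas_diag -mulrA sE.
have dE m : coord m (z * tdiff y g1 g2) =
    coord m (z * l (diag g1 * y)) - y * (pzC (g2 (en m)) * coord m z).
  rewrite mulrBr raddfB /= -rmorphM; congr (_ - _).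
  by rewrite mulrA coord_mulr coord_diag.
split=> [m Xm|m Xm]; rewrite dE; first by rewrite h1.
by rewrite h2 ?zX ?mulr0 ?subr0 // => m' Xm'; apply: contraNneq Xm => ->; apply: sX.
Qed.

Lemma tdiff_supp c x z : is_tdiff d y c x -> supp X z -> supp X (z * x).
Proof.
case=> g1 [g2 [_ _ ->]] zX; rewrite mulrA; apply: supp_wt.
by have [] := coord_tdiff g1 g2 zX.
Qed.

(* Compare the coordinates of highest degree. *)
Lemma tdiff_inj c x z : is_tdiff d y c x -> has_wt (d + c) z ->
  supp X z -> (forall m, X m -> coord (s m) (z * x) = 0) -> z = 0.
Proof.
case=> g1 [g2 [g1n0 g2n0 ->]] zwt zX; rewrite (tdiff_wt _ _ _ hy) mulrA zwt.
have [+ _] := coord_tdiff g1 g2 zX => h h0.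
have [F [_ _ z0]] := coord_expand z.
pose B := \max_(m <- F) (deg m).+1.
have zB j m : X m -> (B <= deg m + j)%N -> coord m z = 0.
  elim: j m => [|j IHj] m Xm; first rewrite addn0 => Bm.
    apply: z0; apply/negP => mF.
    have : ((deg m).+1 <= B)%N by apply: leq_bigmax_seq.
    by rewrite leqNgt ltnS Bm.
  rewrite addnS -addSn -deg_s // => /(IHj _ (sX Xm)) sm0.
  have := h m Xm; rewrite h0 // sm0 !mulr0 subr0 => /esym /(congr1 ( *%R (pzC (g1 (en m))^-1))).
  by rewrite mulr0 mulrA -rmorphM mulVf // rmorph1 mul1r.
apply: coord_inj => m.
by have [Xm|/zX //] := boolP (X m); apply: (zB B); rewrite ?leq_addl.
Qed.

(** Division with remainder: modulo the difference, a final factor y of the left monomial can be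
    moved to the right factor up to a scalar, until the monomial has degree 0 in y. *)
Lemma tdiff_reduce c x z : is_tdiff d y c x -> has_wt c z ->
  supp X z -> exists u v, [/\ z = u * x + v, has_wt (d + c) u,
    has_wt c v & supp X0 v].
Proof.
case=> g1 [g2 [g1n0 g2n0 ->]] zwt zX.
suff [u [v [zE v0]]] : exists u v, z = u * tdiff y g1 g2 + v /\ supp X0 v.
  exists (u * wt (d + c)), (v * wt c); split.
  - rewrite -mulrA (tdiff_wt _ _ _ hy) (mulrA (wt _)) wtM //.
    by rewrite -(tdiff_wt _ _ _ hy) mulrA -mulrDl -zE.
  - exact: wt_has_wt.
  - exact: wt_has_wt.
  exact: supp_wt.
have [F [_ -> z0]] := coord_expand z.
elim/big_ind: _ => [|_ _ [u [v [-> v0]]] [u' [v' [-> v'0]]]|m _].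
- by exists 0, 0; rewrite mul0r addr0; split=> //; apply: supp0.
- exists (u + u'), (v + v'); rewrite mulrDl addrACA; split=> //; exact: suppD.
have [Xm|/zX ->] := boolP (X m); last first.
  by exists 0, 0; rewrite raddf0 mulr0 mul0r addr0; split=> //; apply: supp0.
move: (coord m z) => {zwt zX z F z0} t.
have [j dj] := ubnP (deg m); elim: j => // j IHj in m Xm t dj *.
have [d0|dn0] := eqVneq (deg m) 0.
  exists 0, (l (bas m) * r t); rewrite mul0r add0r; split=> //.
  by apply: supp_bas; rewrite X0E Xm d0.
have [m' Xm' mE] := decX Xm dn0.
(* Inverting g1 makes the leading term of [l (bas m') * r t'] times the difference equal to the
   given one; what is left over sits at m', one degree lower. *)
pose t' := pzC (g1 (en m'))^-1 * t.
have [|u [v [uvE v0]]] := IHj m' Xm' (pzC (g2 (en m')) * (y * t')).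
  by move: dj; rewrite mE deg_s.
exists (l (bas m') * r t' + u), v; split=> //.
rewrite mulrDl -addrA -uvE mulrBr.
have lc f u0 : l (bas m') * r u0 * l (diag f) = l (bas m') * r (pzC (f (en m')) * u0).
  rewrite -mulrA -(enveloping_lr E) mulrA -rmorphM bas_diag rmorphM.
  by rewrite -mulrA (enveloping_central E) -mulrA (enveloping_C E) -(enveloping_rM E).
rewrite 2!(mulrA (l (bas m') * r t')) !lc.
have -> : pzC (g1 (en m')) * t' = t.
  by rewrite mulrA -rmorphM mulfV // rmorph1 mul1r.
have -> : l (bas m') * r (pzC (g2 (en m')) * t') * r y =
    l (bas m') * r (pzC (g2 (en m')) * (y * t')).
  by rewrite -mulrA -(enveloping_rM E) !mulrA pzC_central.
by rewrite subrK -mulrA -(enveloping_lr E) mulrA -rmorphM sE // -mE.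
Qed.

End TwistedDifference.


(** * Exactness by division in three variables *)

Section ThreeVariables.
Variables (a w x : D) (ga gw gx : Z).
Hypotheses (a_deg : has_deg ga a) (w_deg : has_deg gw w) (x_deg : has_deg gx x).
Variables (sa sw sx : I -> I) (da dw dx : I -> nat).
(** In x^s w^j a^t e_i, right multiplication by a variable is a shift of exponents if no variable
    further to the right occurs: always for a, on [degA0] for w, on [degAW0] for x. Hence the
    differences are divided out in the order a, w, x. *)
Definition degA0 : pred I := fun m => da m == 0.
Definition degAW0 : pred I := fun m => degA0 m && (dw m == 0).
Definition degAWX0 : pred I := fun m => degAW0 m && (dx m == 0).
Hypothesis sa_inj : injective sa.
Hypothesis saE : forall m, bas m * a = bas (sa m).
Hypothesis da_s : forall m, da (sa m) = (da m).+1.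
Hypothesis da_dec : forall m, da m != 0 -> exists m', m = sa m'.
Hypothesis sw_stable : forall m, degA0 m -> degA0 (sw m).
Hypothesis sw_inj : {in degA0 &, injective sw}.
Hypothesis swE : forall m, degA0 m -> bas m * w = bas (sw m).
Hypothesis dw_s : forall m, degA0 m -> dw (sw m) = (dw m).+1.
Hypothesis dw_dec : forall m, degA0 m -> dw m != 0 -> exists2 m', degA0 m' & m = sw m'.
Hypothesis sx_stable : forall m, degAW0 m -> degAW0 (sx m).
Hypothesis sx_inj : {in degAW0 &, injective sx}.
Hypothesis sxE : forall m, degAW0 m -> bas m * x = bas (sx m).
Hypothesis dx_s : forall m, degAW0 m -> dx (sx m) = (dx m).+1.
Hypothesis dx_dec : forall m, degAW0 m -> dx m != 0 -> exists2 m', degAW0 m' & m = sx m'.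
Hypothesis bas0 : forall m, degAWX0 m -> bas m = e (en m).

(** Left multiples of a difference in a meet the elements free of a in the left factor only in 0, so
    the remainder of the division is unique. *)
Lemma tdiff_a_disj c c' f u : ga + c = c' -> is_tdiff ga a c f ->
  has_wt c' u -> supp degA0 (u * f) -> u = 0.
Proof.
move=> <- hf uwt uf0.
apply: (@tdiff_inj predT sa da a ga _ _ _ _ a_deg _ _ _ hf) => // [m1 m2 _ _|m _].
  exact: sa_inj.
by apply: uf0; rewrite /degA0 da_s.
Qed.

Lemma tdiff_a_inj c c' f u : ga + c = c' -> is_tdiff ga a c f ->
  has_wt c' u -> u * f = 0 -> u = 0.
Proof.
by move=> cc hf uwt uf0; apply: (tdiff_a_disj cc hf); rewrite // uf0; apply: supp0.
Qed.

Lemma tdiff_a_reduce c c' f z : ga + c = c' -> is_tdiff ga a c f ->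
  has_wt c z -> exists u v, [/\ z = u * f + v, has_wt c' u, has_wt c v & supp degA0 v].
Proof.
move=> <- hf zwt; apply: (@tdiff_reduce predT degA0 sa da a ga) => // m _.
by case/da_dec => m' ->; exists m'.
Qed.

Lemma tdiff_w_supp c f z : is_tdiff gw w c f -> supp degA0 z -> supp degA0 (z * f).
Proof. exact: (@tdiff_supp degA0 sw). Qed.

Lemma tdiff_w_disj c c' f u : gw + c = c' -> is_tdiff gw w c f ->
  has_wt c' u -> supp degA0 u -> supp degAW0 (u * f) -> u = 0.
Proof.
move=> <- hf uwt u0 uf0.
apply: (@tdiff_inj degA0 sw dw w gw _ _ _ _ w_deg _ _ _ hf) => // m m0.
by apply: uf0; rewrite /degAW0 dw_s // andbF.
Qed.

Lemma tdiff_w_reduce c c' f z : gw + c = c' -> is_tdiff gw w c f ->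
  has_wt c z -> supp degA0 z ->
  exists u v, [/\ z = u * f + v, has_wt c' u, has_wt c v & supp degAW0 v].
Proof.
by move=> <- hf zwt z0; apply: (@tdiff_reduce degA0 degAW0 sw dw w gw).
Qed.

Lemma tdiff_x_supp c f z : is_tdiff gx x c f -> supp degAW0 z -> supp degAW0 (z * f).
Proof. exact: (@tdiff_supp degAW0 sx). Qed.

Lemma tdiff_x_inj c c' f u : gx + c = c' -> is_tdiff gx x c f ->
  has_wt c' u -> supp degAW0 u -> u * f = 0 -> u = 0.
Proof.
move=> <- hf uwt u0 uf0.
apply: (@tdiff_inj degAW0 sx dx x gx _ _ _ _ x_deg _ _ _ hf) => // m m0.
by rewrite uf0 raddf0.
Qed.

Lemma tdiff_x_reduce c c' f z : gx + c = c' -> is_tdiff gx x c f ->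
  has_wt c z -> supp degAW0 z ->
  exists u v, [/\ z = u * f + v, has_wt c' u, has_wt c v & supp degAWX0 v].
Proof.
by move=> <- hf zwt z0; apply: (@tdiff_reduce degAW0 degAWX0 sx dx x gx).
Qed.

(** Without variables the left factor is a combination of the e_i, and weight c ties e_i to e_(i+c)
    on the right, so the right factors assemble into a single t. *)
Lemma supp_degAWX0 c v : has_wt c v -> supp degAWX0 v ->
  exists t, v = r t * wt c.
Proof.
move=> vwt v0; have [F [_ vE _]] := coord_expand v.
have {vE} : exists g : Z -> D, v = \sum_i l (e i) * r (g i).
  rewrite {1}vE; elim/big_ind: _ => [|_ _ [g ->] [h ->]|m _].
  - by exists (fun=> 0); rewrite big1 // => i _; rewrite /= raddf0 mulr0.
  - exists (fun i => g i + h i); rewrite -big_split; apply: eq_bigr => i _ /=.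
    by rewrite raddfD mulrDr.
  have [m0|/v0 ->] := boolP (degAWX0 m); last first.
    by exists (fun=> 0); rewrite raddf0 mulr0 big1 // => i _; rewrite mulr0.
  exists (fun i => if i == en m then coord m v else 0).
  rewrite (bigD1 (en m)) //= eqxx big1 ?addr0 ?bas0 // => i /negPf ->.
  by rewrite raddf0 mulr0.
case=> g vE; exists (\sum_i e (i + c) * g i).
rewrite -[LHS]vwt {1}vE mulr_suml [RHS]mulr_sumr; apply: eq_bigr => i _.
have ei_deg : has_deg 0 (e i).
  by move=> j; rewrite addr0 !eM eq_sym; case: eqP => // ->.
rewrite (enveloping_lr E) -[in LHS]mulrA (l_wt _ ei_deg) add0r wt_l.
rewrite mulrA -(enveloping_lr E) mulrA -(enveloping_lr E) -!mulrA.
rewrite -!(enveloping_rM E); congr (_ * r _).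
rewrite mulr_sumr (bigD1 i) //= big1 ?addr0 => [|j ji]; first by rewrite mulrA eM eqxx.
by rewrite mulrA eM (inj_eq (addIr c)) eq_sym (negPf ji) mul0r.
Qed.

(* [u omega] lies in [R alpha] only if [u] lies in [R alpha'], where
   [alpha' omega = - omega' alpha] is the commutation of the two differences. *)
Lemma tdiff_aw_regular c ca cw cwa al om om' al' u v :
  ga + c = ca -> gw + c = cw -> ga + cw = cwa ->
  is_tdiff ga a c al -> is_tdiff gw w c om -> is_tdiff gw w ca om' ->
  is_tdiff ga a cw al' -> om' * al + al' * om = 0 ->
  has_wt cw u -> has_wt ca v -> u * om + v * al = 0 ->
  exists2 t, has_wt cwa t & u = t * al' /\ v = t * om'.
Proof.
move=> hca hcw hcwa hal hom hom' hal' rel uwt vwt uv.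
have [t [n [uE twt nwt n0]]] := tdiff_a_reduce hcwa hal' uwt.
have vt_wt : has_wt ca (v - t * om').
  by apply/has_wtB/has_wtM/is_tdiff_wt/hom'.
have nE : (v - t * om') * al = - (n * om).
  have ra : al' * om = - (om' * al) by apply/eqP; rewrite -addr_eq0 addrC rel.
  apply/eqP; rewrite -addr_eq0 -uv uE mulrBl mulrDl -!mulrA ra mulrN.
  by rewrite -addrA addrC.
have v0 : v - t * om' = 0.
  apply: (tdiff_a_disj hca hal) => //; rewrite nE; apply/suppN.
  exact: tdiff_w_supp hom n0.
have n00 : n = 0.
  apply: (tdiff_w_disj hcw hom) => //.
  by move: nE; rewrite v0 mul0r => /esym/eqP; rewrite oppr_eq0 => /eqP ->; apply: supp0.
exists t => //; split; first by rewrite uE n00 addr0.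
exact/subr0_eq.
Qed.

Section Complex.
(* The complex R -> R^3 -> R^3 -> R of right multiplications by
   (y1 y2 y3), [[b1 a1 0] [b2 ep a2] [0 b3 a3]] up to ordering, and
   (al om xi); each entry but [ep] is a twisted difference. *)
Variables c ca cw cx cwa cxa cxw ct : Z.
Hypotheses (hca : ga + c = ca) (hcw : gw + c = cw) (hcx : gx + c = cx).
Hypotheses (haw : ga + cw = cwa) (hxa : ga + cx = cxa) (hxa' : cxa = cw).
Hypotheses (hxw : gw + cx = cxw) (hat : ga + cxw = ct).
Variables al om xi A1 B1 A2 ep C2 B3 C3 Y1 Y2 Y3 : R.
Hypotheses (hal : is_tdiff ga a c al) (hom : is_tdiff gw w c om).
Hypothesis hxi : is_tdiff gx x c xi.
Hypotheses (hA1 : is_tdiff gw w ca A1) (hB1 : is_tdiff ga a cw B1).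
Hypotheses (hA2 : has_wt ca A2) (hep : has_wt cw ep) (hC2 : is_tdiff ga a cx C2).
Hypotheses (hB3 : has_wt cw B3) (hC3 : is_tdiff gw w cx C3).
Hypotheses (hY1 : has_wt cwa Y1) (hY2 : is_tdiff gw w cxa Y2).
Hypothesis hY3 : is_tdiff ga a cxw Y3.
Hypothesis rel_wa : A1 * al + B1 * om = 0.
Hypothesis rel_xa : A2 * al + ep * om + C2 * xi = 0.
Hypothesis rel_xw : B3 * om + C3 * xi = 0.
Hypothesis rel_w : Y1 * B1 + Y2 * ep + Y3 * B3 = 0.
Hypothesis rel_x : Y2 * C2 + Y3 * C3 = 0.

Lemma koszul_exact3 z : has_wt ct z -> z * Y3 = 0 -> z = 0.
Proof. exact: tdiff_a_inj hat hY3. Qed.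

(** The last equation is a syzygy between a difference in a and one in w, so [tdiff_aw_regular]
    gives z for v2 and v3. Cancelling the injective B1 in the middle equation then gives v1. *)
Lemma koszul_exact2 v1 v2 v3 : has_wt cwa v1 -> has_wt cxa v2 -> has_wt cxw v3 ->
  v1 * A1 + v2 * A2 = 0 -> v1 * B1 + v2 * ep + v3 * B3 = 0 ->
  v2 * C2 + v3 * C3 = 0 ->
  exists2 z, has_wt ct z & [/\ v1 = z * Y1, v2 = z * Y2 & v3 = z * Y3].
Proof.
move=> w1 w2 w3 _ e2 e3.
have [|z zwt [v3E v2E]] :=
    tdiff_aw_regular hxa hxw hat hC2 hC3 hY2 hY3 rel_x w3 w2.
  by rewrite addrC.
exists z => //; split=> //; apply/subr0_eq.
apply: (tdiff_a_inj haw hB1); first by apply/has_wtB/has_wtM.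
rewrite mulrBl -mulrA -[RHS]e2 -[in LHS](addrK (Y2 * ep + Y3 * B3) (Y1 * B1)).
by rewrite addrA rel_w sub0r mulrN opprK mulrDr !mulrA -v2E -v3E addrA.
Qed.

(** Subtracting boundaries reduces u3, modulo C2 and C3, to an n' free of a and w. Dividing U2 by B1
    and comparing supports for a, w and x in turn forces n' = 0, which leaves a syzygy between al
    and om. *)
Lemma koszul_exact1 u1 u2 u3 : has_wt ca u1 -> has_wt cw u2 -> has_wt cx u3 ->
  u1 * al + u2 * om + u3 * xi = 0 ->
  exists v1 v2 v3, [/\ has_wt cwa v1, has_wt cxa v2, has_wt cxw v3 &
    [/\ u1 = v1 * A1 + v2 * A2, u2 = v1 * B1 + v2 * ep + v3 * B3 &
        u3 = v2 * C2 + v3 * C3]].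
Proof.
move=> w1 w2 w3 uE.
have [v2 [n [u3E v2wt nwt n0]]] := tdiff_a_reduce hxa hC2 w3.
have [v3 [n' [nE v3wt n'wt n'0]]] := tdiff_w_reduce hxw hC3 nwt n0.
have [U1 U1d] : exists U, U = u1 - v2 * A2 by eexists.
have [U2 U2d] : exists U, U = u2 - v2 * ep - v3 * B3 by eexists.
have U1wt : has_wt ca U1 by rewrite U1d; apply/has_wtB/has_wtM.
have U2wt : has_wt cw U2 by rewrite U2d; apply/has_wtB/has_wtM => //; apply/has_wtB/has_wtM.
have UE : U1 * al + U2 * om + n' * xi = 0.
  have xa : C2 * xi = - (A2 * al + ep * om).
    by apply/eqP; rewrite -addr_eq0 addrC rel_xa.
  have xw : C3 * xi = - (B3 * om).
    by apply/eqP; rewrite -addr_eq0 addrC rel_xw.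
  have n'E : n' * xi = u3 * xi + (v2 * A2 * al + (v2 * ep * om + v3 * B3 * om)).
    rewrite u3E nE !mulrDl -!mulrA xa xw !mulrN mulrDr.
    set S1 := v2 * _; set S2 := v2 * _; set O := v3 * _.
    by rewrite (addrA S1) [RHS]addrC addrACA subrr add0r addNKr.
  rewrite n'E U1d U2d !mulrBl -(addrA (u2 * om)) -opprD (addrACA (u1 * al)).
  rewrite -opprD addrACA addNr addr0.
  by rewrite -[RHS]uE.
have n'00 : n' = 0.
  have [m1 [m2 [U2E m1wt m2wt m20]]] := tdiff_a_reduce haw hB1 U2wt.
  have B1om : B1 * om = - (A1 * al).
    by apply/eqP; rewrite -addr_eq0 addrC rel_wa.
  have UE' : (U1 - m1 * A1) * al + m2 * om + n' * xi = 0.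
    rewrite -[RHS]UE U2E mulrBl (mulrDl (m1 * B1)) -(mulrA m1 B1) B1om mulrN -mulrA.
    by rewrite !addrA.
  have U10 : U1 - m1 * A1 = 0.
    apply: (tdiff_a_disj hca hal); first by apply/has_wtB/has_wtM/is_tdiff_wt/hA1.
    have -> : (U1 - m1 * A1) * al = - (m2 * om) - n' * xi.
      by apply/eqP; rewrite -subr_eq0 opprD !opprK addrA UE'.
    apply/suppB; first exact/suppN/(tdiff_w_supp hom).
    by move=> m m0; apply: (tdiff_x_supp hxi n'0); rewrite negb_and m0.
  have n'om : n' * xi = - (m2 * om).
    by apply/eqP; rewrite -addr_eq0 addrC -[X in _ == X]UE' U10 mul0r add0r.
  have m200 : m2 = 0.
    apply: (tdiff_w_disj hcw hom) => //.
    by rewrite -[m2 * om]opprK -n'om; apply/suppN/(tdiff_x_supp hxi).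
  by apply: (tdiff_x_inj hcx hxi) => //; rewrite n'om m200 mul0r oppr0.
move: UE; rewrite n'00 mul0r addr0 addrC => UE.
have [t twt [U2E U1E]] :=
  tdiff_aw_regular hca hcw haw hal hom hA1 hB1 rel_wa U2wt U1wt UE.
exists t, v2, v3; split=> //; split.
- by rewrite -U1E U1d subrK.
- by rewrite -U2E U2d addrAC subrK subrK.
by rewrite u3E nE n'00 addr0.
Qed.

Lemma koszul_exact0 z : has_wt c z -> exists u1 u2 u3 t,
  [/\ has_wt ca u1, has_wt cw u2, has_wt cx u3 &
      z = u1 * al + u2 * om + u3 * xi + r t * wt c].
Proof.
move=> zwt.
have [u1 [n1 [zE u1wt n1wt n1s]]] := tdiff_a_reduce hca hal zwt.
have [u2 [n2 [n1E u2wt n2wt n2s]]] := tdiff_w_reduce hcw hom n1wt n1s.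
have [u3 [n3 [n2E u3wt n3wt n3s]]] := tdiff_x_reduce hcx hxi n2wt n2s.
have [t n3E] := supp_degAWX0 n3wt n3s.
by exists u1, u2, u3, t; split=> //; rewrite zE n1E n2E n3E !addrA.
Qed.

(** At the rank one end the cokernel is described by the normal form r t wt(c) and not by a module,
    so that one statement serves the complex and its dual, whose augmentations differ. *)
Definition koszul_exactness : Prop :=
  [/\ forall z, has_wt c z -> exists u1 u2 u3 t,
        [/\ has_wt ca u1, has_wt cw u2, has_wt cx u3 &
            z = u1 * al + u2 * om + u3 * xi + r t * wt c],
      forall u1 u2 u3, has_wt ca u1 -> has_wt cw u2 -> has_wt cx u3 ->
        u1 * al + u2 * om + u3 * xi = 0 ->
        exists v1 v2 v3, [/\ has_wt cwa v1, has_wt cxa v2, has_wt cxw v3 &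
          [/\ u1 = v1 * A1 + v2 * A2, u2 = v1 * B1 + v2 * ep + v3 * B3 &
              u3 = v2 * C2 + v3 * C3]],
      forall v1 v2 v3, has_wt cwa v1 -> has_wt cxa v2 -> has_wt cxw v3 ->
        v1 * A1 + v2 * A2 = 0 -> v1 * B1 + v2 * ep + v3 * B3 = 0 ->
        v2 * C2 + v3 * C3 = 0 ->
        exists2 z, has_wt ct z & [/\ v1 = z * Y1, v2 = z * Y2 & v3 = z * Y3] &
      forall z, has_wt ct z -> z * Y3 = 0 -> z = 0].

Lemma koszul_exact : koszul_exactness.
Proof.
split; [exact: koszul_exact0 | exact: koszul_exact1 | exact: koszul_exact2 |].
exact: koszul_exact3.
Qed.

End Complex.

Lemma diagM f g : diag f * diag g = diag (fun i => f i * g i).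
Proof.
rewrite [LHS]mulr_suml; apply: eq_bigr => i _.
by rewrite -mulrA e_diag mulrA -rmorphM.
Qed.

Lemma diagN f : diag (fun i => - f i) = - diag f.
Proof. by rewrite -sumrN; apply: eq_bigr => i _; rewrite rmorphN mulNr. Qed.

Lemma diag1 : diag (fun=> 1) = 1.
Proof. by rewrite -e_sum; apply: eq_bigr => i _; rewrite rmorph1 mul1r. Qed.

Lemma r_diagM_wt f u c : r (diag f * u) * wt c = l (diag (fun i => f (i + c))) * r u * wt c.
Proof. by rewrite (enveloping_rM E) -mulrA r_diag_wt mulrA (enveloping_lr E). Qed.

Lemma tdiffM y z gz g1 g2 h1 h2 c c' : has_deg gz z -> gz + c = c' ->
  tdiff y g1 g2 * wt c' * (tdiff z h1 h2 * wt c) =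
  (l (diag g1 * y * (diag h1 * z)) - l (diag g1 * y * diag h2) * r z
   - l (diag g2 * diag h1 * z) * r y + l (diag g2 * diag h2) * r (z * y)) * wt c.
Proof.
move=> hz <-; rewrite -mulrA (mulrA (wt _)) -(tdiff_wt _ _ _ hz) -(mulrA _ (wt c)).
rewrite wtM mulrA; congr (_ * _).
rewrite /tdiff mulrBl !mulrBr opprB addrA addrAC.
congr (_ - _ - _ + _).
- by rewrite !rmorphM !mulrA.
- by rewrite !rmorphM !mulrA.
- by rewrite -mulrA -rmorphM -(enveloping_lr E) mulrA !rmorphM !mulrA.
rewrite -!mulrA (mulrA (r y)) -(enveloping_lr E) rmorphM (enveloping_rM E).
by rewrite !mulrA.
Qed.

(* Two twisted differences commute up to twisting as soon as the elements do. *)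
Lemma tdiff_square y z gy gz g1 g2 h1 h2 k1 k2 m1 m2 c cy cz :
  has_deg gy y -> has_deg gz z -> gy + c = cy -> gz + c = cz ->
  diag g1 * y * diag h2 + diag k2 * diag m1 * y = 0 ->
  diag g2 * diag h1 * z + diag k1 * z * diag m2 = 0 ->
  tdiff y g1 g2 * wt cz * (tdiff z h1 h2 * wt c) +
  tdiff z k1 k2 * wt cy * (tdiff y m1 m2 * wt c) =
  (l (diag g1 * y * (diag h1 * z) + diag k1 * z * (diag m1 * y)) +
   (l (diag g2 * diag h2) * r (z * y) + l (diag k2 * diag m2) * r (y * z))) * wt c.
Proof.
move=> hy hz hcy hcz ez ey.
rewrite (tdiffM _ _ _ _ _ hz hcz) (tdiffM _ _ _ _ _ hy hcy) -mulrDl.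
congr (_ * _); rewrite [in RHS]raddfD /=.
have -> : l (diag g1 * y * diag h2) = - l (diag k2 * diag m1 * y).
  by rewrite -raddfN; congr (l _); apply/eqP; rewrite -addr_eq0 ez.
have -> : l (diag g2 * diag h1 * z) = - l (diag k1 * z * diag m2).
  by rewrite -raddfN; congr (l _); apply/eqP; rewrite -addr_eq0 ey.
rewrite !mulNr !opprK.
set p1 := l _; set p2 := l _ * r z; set p3 := l _ * r y; set p4 := l _ * r (z * y).
set q1 := l _; set q4 := l _ * r (y * z).
rewrite -(addrA p1 p2) -(addrA q1) -opprD (addrC p3 p2) (addrAC p1) (addrAC q1).
by rewrite (addrACA (p1 + p4)) subrr addr0 addrACA.
Qed.

(** * The Koszul complex of the three commutation relations *)

Section Relations.
Variables lam kap mu : Z -> k.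
Hypotheses (lam_neq0 : forall i, lam i != 0) (kap_neq0 : forall i, kap i != 0).
Hypothesis xaE : x * a = w + diag kap * a * x.
Hypothesis waE : w * a = diag lam * a * w.
Hypothesis xwE : x * w = diag mu * w * x.
Hypothesis gwE : gw = ga + gx.
Hypothesis lam_per : forall i, lam (i + gw) = lam i.
Hypothesis kap_per : forall i, kap (i + gw) = kap i.
Hypothesis muE : forall i, mu (i + ga) = lam i.

Let mu_lam i : mu i = lam (i - ga).
Proof. by rewrite -muE subrK. Qed.
Let mu_per i : mu (i + gw) = mu i.
Proof. by rewrite !mu_lam addrAC lam_per. Qed.
Let mu_neq0 i : mu i != 0.
Proof. by rewrite mu_lam. Qed.
Let lam_x i : lam (i + gx) = mu i.
Proof. by rewrite mu_lam -[RHS]lam_per gwE; congr lam; ring. Qed.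

Let w_diag f : (forall i, f (i + gw) = f i) -> w * diag f = diag f * w.
Proof.
move=> fper; rewrite -(deg_diag _ w_deg); congr (_ * diag _).
by apply/funext => i; rewrite -[in RHS]fper subrK.
Qed.
Let a_mu : a * diag mu = diag lam * a.
Proof.
rewrite -(deg_diag _ a_deg); congr (_ * diag _).
by apply/funext => i; rewrite mu_lam.
Qed.
Let x_lam : x * diag lam = diag mu * x.
Proof.
rewrite -(deg_diag _ x_deg); congr (_ * diag _).
by apply/funext => i; rewrite -lam_x subrK.
Qed.

Definition fun1 : Z -> k := fun=> 1.
Definition funN (f : Z -> k) : Z -> k := fun i => - f i.
Definition funM (f g : Z -> k) : Z -> k := fun i => f i * g i.
Let dE := ((diagN : forall f, diag (funN f) = - diag f), (diag1 : diag fun1 = 1),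
  (fun f g => esym (diagM f g) : diag (funM f g) = diag f * diag g)).
Let pw := ga + gx.
Local Notation td y g1 g2 c := (tdiff y g1 g2 * wt c).

Definition Kal := td a fun1 fun1 0.
Definition Kom := td w fun1 fun1 0.
Definition Kxi := td x fun1 fun1 0.
(** From here to [KC3]: the noncommutative derivatives of wa - lam a w, xa - w - kap a x and xw - mu
    w x with respect to a, w, x. A letter to the left of the marked one acts through [l], a letter
    to its right through [r]; [Kep] is the derivative of the linear term. *)
Definition KA1 := td w fun1 lam ga.
Definition KB1 := td a (funN lam) (funN fun1) pw.
Definition KA2 := td x fun1 kap ga.
Definition Kep := - wt pw.
Definition KC2 := td a (funN kap) (funN fun1) gx.
Definition KB3 := td x fun1 mu pw.
Definition KC3 := td w (funN mu) (funN fun1) gx.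
(** The syzygy of the overlap x w a: x times the relation for wa, and the relation for xw times a,
    are reduced to a common form. The coefficients mu and kap are those collected on the way. *)
Definition KY1 := td x fun1 (funM mu kap) (ga + pw).
Definition KY2 := td w (funN mu) (funN mu) pw.
Definition KY3 := td a (funM mu kap) fun1 (gw + gx).

Let r_diagP f g u c : (forall i, f (i + c) = g i) ->
  r (diag f * u) * wt c = l (diag g) * r u * wt c.
Proof. by move=> fc; rewrite r_diagM_wt; congr (l (diag _) * _ * _); apply/funext. Qed.

Local Notation sE := (mul1r, mulr1, mulNr, mulrN, opprK, rmorphN, rmorph0, rmorph1).

Lemma K_wa : KA1 * Kal + KB1 * Kom = 0.
Proof.
rewrite /KA1 /Kal /KB1 /Kom; etransitivity.
  apply: (tdiff_square w_deg a_deg); rewrite ?addr0 ?dE ?sE //.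
  - by rewrite subrr.
  - by rewrite subrr.
rewrite !dE !sE {1}waE -!mulrA subrr ?sE add0r mulrDl mulNr.
rewrite waE -(mulrA (diag lam)) (r_diagP (g := lam)) ?subrr // => i.
by rewrite addr0.
Qed.

Lemma K_xw : KB3 * Kom + KC3 * Kxi = 0.
Proof.
rewrite /KB3 /Kom /KC3 /Kxi; etransitivity.
  apply: (tdiff_square x_deg w_deg); rewrite ?addr0 ?dE ?sE //.
  - by rewrite subrr.
  - by rewrite subrr.
rewrite !dE !sE {1}xwE -!mulrA subrr ?sE add0r mulrDl mulNr.
rewrite xwE -(mulrA (diag mu)) (r_diagP (g := mu)) ?subrr // => i.
by rewrite addr0.
Qed.

(** The square of differences in x and a does not close up, but leaves the difference of w, which
    the constant entry cancels. *)
Lemma K_xa : KA2 * Kal + Kep * Kom + KC2 * Kxi = 0.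
Proof.
rewrite addrAC; have -> : KA2 * Kal + KC2 * Kxi = (l w - r w) * wt 0.
  rewrite /KA2 /Kal /KC2 /Kxi; etransitivity.
    apply: (tdiff_square x_deg a_deg); rewrite ?addr0 ?dE ?sE //.
    - by rewrite subrr.
    - by rewrite subrr.
  rewrite !dE !sE xaE -!mulrA addrK !mulrDl; congr (_ + _).
  rewrite raddfD opprD mulrDl !mulNr.
  rewrite (r_diagP (g := kap)) => [|i]; last by rewrite addr0.
  by rewrite addrC subrK.
have := tdiff_wt fun1 fun1 0 w_deg; rewrite addr0 => wtE.
rewrite /Kep mulNr /Kom /pw -gwE wtE mulrA wtM -wtE.
by rewrite /tdiff !dE !sE subrr.
Qed.

(** In the right factor the coefficient mu of the relation for xw is shifted by the weight [ga], and
    [muE] turns it into lam. *)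
Lemma K_a : KY1 * KA1 + KY2 * KA2 = 0.
Proof.
rewrite /KY1 /KA1 /KY2 /KA2; etransitivity.
  apply: (tdiff_square x_deg w_deg); rewrite ?gwE 1?addrC // !dE ?sE.
  - by rewrite x_lam addNr.
  - by rewrite -(mulrA _ w) (w_diag kap_per) mulrA addNr.
rewrite !dE !sE {1}xwE subrr rmorph0 add0r mulrDl mulNr.
have e1 : r (x * w) * wt ga = l (diag lam) * r (w * x) * wt ga.
  by rewrite xwE -mulrA (r_diagP (g := lam)).
by rewrite -(mulrA _ (r (x * w))) e1 rmorphM !mulrA subrr.
Qed.

Lemma K_x : KY2 * KC2 + KY3 * KC3 = 0.
Proof.
rewrite /KY2 /KC2 /KY3 /KC3 /pw; etransitivity.
  apply: (tdiff_square w_deg a_deg); rewrite // !dE ?sE.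
  - by rewrite subrr.
  - by rewrite subrr.
rewrite !dE !sE.
have -> : diag mu * w * (diag kap * a) = diag mu * diag kap * a * (diag mu * w).
  rewrite -mulrA (mulrA w) (w_diag kap_per) -(mulrA (diag kap) w) waE.
  by rewrite -a_mu !mulrA.
rewrite subrr rmorph0 add0r mulrDl mulNr waE -(mulrA (diag lam)).
by rewrite (r_diagP (g := mu)) // ?mul1r subrr.
Qed.

Lemma K_w : KY1 * KB1 + KY2 * Kep + KY3 * KB3 = 0.
Proof.
rewrite addrAC; have -> : KY1 * KB1 + KY3 * KB3 = - (l (diag mu) * (l w - r w) * wt pw).
  rewrite /KY1 /KB1 /KY3 /KB3; etransitivity.
    apply: (tdiff_square x_deg a_deg); rewrite ?gwE 1?addrC // ?dE ?sE.
    - by rewrite subrr.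
    - by rewrite -(mulrA _ a) a_mu mulrA subrr.
  rewrite !dE !sE.
  have -> : - (x * (diag lam * a)) + diag mu * diag kap * a * x = - (diag mu * w).
    by rewrite mulrA x_lam -mulrA xaE mulrDr opprD !mulrA subrK.
  have e1 : r (x * a) * wt pw = r w * wt pw + l (diag kap) * r (a * x) * wt pw.
    rewrite xaE raddfD mulrDl -mulrA (r_diagP (g := kap)) // => i.
    by rewrite /pw -gwE kap_per.
  rewrite rmorphN !mulrDl !mulNr -(mulrA _ (r (x * a))) e1 mulrDr !rmorphM !mulrA.
  rewrite (addrCA (- (_ * r (a * x) * _))) addNr addr0 addrC.
  by rewrite mulrBr mulrBl opprB.
rewrite /KY2 /Kep mulrN -(mulrA (tdiff _ _ _)) wtM -opprD -mulrDl /tdiff !dE !sE.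
by rewrite mulrBr (addrC (- _)) addrA subrK subrr mul0r oppr0.
Qed.

Lemma is_tdiffE y d g1 g2 c : (forall i, g1 i != 0) -> (forall i, g2 i != 0) ->
  is_tdiff d y c (td y g1 g2 c).
Proof. by move=> h1 h2; exists g1, g2. Qed.

Let fun1_neq0 i : fun1 i != 0. Proof. exact: oner_neq0. Qed.
Let funN_neq0 f : (forall i, f i != 0) -> forall i, funN f i != 0.
Proof. by move=> fn0 i; rewrite oppr_eq0. Qed.
Let muka_neq0 i : funM mu kap i != 0.
Proof. by rewrite mulf_neq0. Qed.

Let tal : is_tdiff ga a 0 Kal. Proof. by apply: is_tdiffE. Qed.
Let tom : is_tdiff gw w 0 Kom. Proof. by apply: is_tdiffE. Qed.
Let txi : is_tdiff gx x 0 Kxi. Proof. by apply: is_tdiffE. Qed.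
Let tA1 : is_tdiff gw w ga KA1. Proof. by apply: is_tdiffE. Qed.
Let tB1 : is_tdiff ga a pw KB1. Proof. by apply: is_tdiffE; apply: funN_neq0. Qed.
Let tA2 : is_tdiff gx x ga KA2. Proof. by apply: is_tdiffE. Qed.
Let tC2 : is_tdiff ga a gx KC2. Proof. by apply: is_tdiffE; apply: funN_neq0. Qed.
Let tB3 : is_tdiff gx x pw KB3. Proof. by apply: is_tdiffE. Qed.
Let tC3 : is_tdiff gw w gx KC3. Proof. by apply: is_tdiffE; apply: funN_neq0. Qed.
Let tY1 : is_tdiff gx x (ga + pw) KY1. Proof. by apply: is_tdiffE. Qed.
Let tY2 : is_tdiff gw w pw KY2. Proof. by apply: is_tdiffE; apply: funN_neq0. Qed.
Let tY3 : is_tdiff ga a (gw + gx) KY3. Proof. by apply: is_tdiffE. Qed.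
Let hep : has_wt pw Kep. Proof. exact/has_wtN/wtM. Qed.
Let is_wt d y c z : is_tdiff d y c z -> has_wt c z.
Proof. exact: is_tdiff_wt. Qed.

Lemma koszul_left : koszul_exactness 0 ga pw gx (ga + pw) pw (gw + gx)
  (ga + (gw + gx)) Kal Kom Kxi KA1 KB1 KA2 Kep KC2 KB3 KC3 KY1 KY2 KY3.
Proof.
apply: koszul_exact => //; rewrite ?addr0 //.
- exact: is_wt tA2.
- exact: is_wt tB3.
- exact: is_wt tY1.
- exact: K_wa.
- exact: K_xa.
- exact: K_xw.
- exact: K_w.
exact: K_x.
Qed.

Section Dual.
Variable tau : {additive R -> R}.
Hypothesis tauM : forall u v, tau (u * v) = tau v * tau u.
Hypothesis taul : forall y, tau (l y) = r y.
Hypothesis taur : forall y, tau (r y) = l y.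

(** Flipping the entries and reversing the arrows gives a complex of the same shape: the last map
    consists of differences in x, w and a, which take the places of xi, om and al, with all weights
    negated. *)
Lemma koszul_right : koszul_exactness (- (ga + (gw + gx))) (- (gw + gx)) (- pw)
  (- (ga + pw)) (- gx) (- pw) (- ga) 0
  (tau KY3) (tau KY2) (tau KY1) (tau KC3) (tau KC2) (tau KB3) (tau Kep) (tau KB1)
  (tau KA2) (tau KA1) (tau Kxi) (tau Kom) (tau Kal).
Proof.
have sT d y c c' z : has_deg d y -> - (d + c) = c' -> is_tdiff d y c z ->
    is_tdiff d y c' (tau z).
  by move=> hy <-; apply: is_tdiff_swap.
have tau_wt b : tau (wt b) = wt (- b).
  rewrite raddf_sum [RHS](reindex_inj (addIr b)) /=; apply: eq_bigr => i _.
  by rewrite tauM taul taur addrK.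
have s2 u v u' v' : u * v + u' * v' = 0 -> tau v' * tau u' + tau v * tau u = 0.
  by move=> e0; rewrite -!tauM -raddfD addrC e0 raddf0.
have s3 u v u' v' u2 v2 : u * v + u' * v' + u2 * v2 = 0 ->
    tau v2 * tau u2 + tau v' * tau u' + tau v * tau u = 0.
  move=> e0; rewrite -!tauM -!raddfD /= [X in tau X](_ : _ = 0) ?raddf0 //.
  by rewrite -[RHS]e0 addrC addrA addrAC.
apply: koszul_exact; rewrite ?oppr0; try by rewrite /pw ?gwE; ring.
- by apply: (sT _ _ _ _ _ a_deg _ tY3).
- by apply: (sT _ _ _ _ _ w_deg _ tY2); rewrite /pw ?gwE; ring.
- by apply: (sT _ _ _ _ _ x_deg _ tY1); rewrite /pw ?gwE; ring.
- by apply: (sT _ _ _ _ _ w_deg _ tC3); rewrite /pw ?gwE; ring.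
- by apply: (sT _ _ _ _ _ a_deg _ tC2); rewrite /pw ?gwE; ring.
- by apply: (@is_wt gx x); apply: (sT _ _ _ _ _ x_deg _ tB3); rewrite /pw ?gwE; ring.
- by rewrite raddfN tau_wt; apply/has_wtN/wtM.
- by apply: (sT _ _ _ _ _ a_deg _ tB1); rewrite /pw ?gwE; ring.
- by apply: (@is_wt gx x); apply: (sT _ _ _ _ _ x_deg _ tA2); rewrite /pw ?gwE; ring.
- by apply: (sT _ _ _ _ _ w_deg _ tA1); rewrite /pw ?gwE; ring.
- by apply: (@is_wt gx x); apply: (sT _ _ _ _ _ x_deg _ txi); rewrite /pw ?gwE; ring.
- by apply: (sT _ _ _ _ _ w_deg _ tom); rewrite /pw ?gwE; ring.
- by apply: (sT _ _ _ _ _ a_deg _ tal); rewrite /pw ?gwE; ring.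
- exact/s2/K_x.
- exact/s3/K_w.
- exact/s2/K_a.
- exact/s3/K_xa.
exact/s2/K_wa.
Qed.
End Dual.

End Relations.

End ThreeVariables.
End Koszul.

(** * Resolution and Ext groups from a complex of ranks 1, 3, 3, 1 *)

Section KoszulResolution.
Variables (R : pzRingType) (M : lmodType R) (X : lmodType R^c) (g : M) (h : X).
Variables P0 Pa Pw Px Pwa Pxa Pxw Pt : R.
Variables al om xi A1 B1 A2 ep C2 B3 C3 Y1 Y2 Y3 : R.
Hypothesis idem : all (fun p => p * p == p) [:: P0; Pa; Pw; Px; Pwa; Pxa; Pxw; Pt].
Hypothesis typed : all (fun t => (t.1.1 * t.1.2 == t.1.2) && (t.1.2 * t.2 == t.1.2))
  [:: (Pa, al, P0); (Pw, om, P0); (Px, xi, P0);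
      (Pwa, A1, Pa); (Pwa, B1, Pw); (Pxa, A2, Pa); (Pxa, ep, Pw); (Pxa, C2, Px);
      (Pxw, B3, Pw); (Pxw, C3, Px); (Pt, Y1, Pwa); (Pt, Y2, Pxa); (Pt, Y3, Pxw)].
Hypothesis rel_wa : A1 * al + B1 * om = 0.
Hypothesis rel_xa : A2 * al + ep * om + C2 * xi = 0.
Hypothesis rel_xw : B3 * om + C3 * xi = 0.
Hypothesis rel_a : Y1 * A1 + Y2 * A2 = 0.
Hypothesis rel_w : Y1 * B1 + Y2 * ep + Y3 * B3 = 0.
Hypothesis rel_x : Y2 * C2 + Y3 * C3 = 0.

Hypothesis gP : P0 *: g = g.
Hypotheses (g_al : al *: g = 0) (g_om : om *: g = 0) (g_xi : xi *: g = 0).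
Hypothesis g_surj : forall y, exists z, y = z *: g.
Hypothesis left0 : forall z, z * P0 = z -> z *: g = 0 ->
  exists u1 u2 u3, z = u1 * al + u2 * om + u3 * xi.
Hypothesis left1 : forall u1 u2 u3, u1 * Pa = u1 -> u2 * Pw = u2 -> u3 * Px = u3 ->
  u1 * al + u2 * om + u3 * xi = 0 -> exists v1 v2 v3,
  [/\ u1 = v1 * A1 + v2 * A2, u2 = v1 * B1 + v2 * ep + v3 * B3 & u3 = v2 * C2 + v3 * C3].
Hypothesis left2 : forall v1 v2 v3, v1 * Pwa = v1 -> v2 * Pxa = v2 -> v3 * Pxw = v3 ->
  v1 * A1 + v2 * A2 = 0 -> v1 * B1 + v2 * ep + v3 * B3 = 0 -> v2 * C2 + v3 * C3 = 0 ->
  exists z, [/\ v1 = z * Y1, v2 = z * Y2 & v3 = z * Y3].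
Hypothesis left3 : forall z, z * Pt = z -> z * Y3 = 0 -> z = 0.

Hypothesis hP : (Pt : R^c) *: h = h.
Hypotheses (h_Y1 : (Y1 : R^c) *: h = 0) (h_Y2 : (Y2 : R^c) *: h = 0).
Hypothesis h_Y3 : (Y3 : R^c) *: h = 0.
Hypothesis h_surj : forall y, exists z : R, y = (z : R^c) *: h.
Hypothesis right3 : forall z, Pt * z = z -> (z : R^c) *: h = 0 ->
  exists v1 v2 v3, z = Y1 * v1 + Y2 * v2 + Y3 * v3.
Hypothesis right2 : forall v1 v2 v3, Pwa * v1 = v1 -> Pxa * v2 = v2 -> Pxw * v3 = v3 ->
  Y1 * v1 + Y2 * v2 + Y3 * v3 = 0 -> exists u1 u2 u3,
  [/\ v1 = A1 * u1 + B1 * u2, v2 = A2 * u1 + ep * u2 + C2 * u3 & v3 = B3 * u2 + C3 * u3].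
Hypothesis right1 : forall u1 u2 u3, Pa * u1 = u1 -> Pw * u2 = u2 -> Px * u3 = u3 ->
  A1 * u1 + B1 * u2 = 0 -> A2 * u1 + ep * u2 + C2 * u3 = 0 -> B3 * u2 + C3 * u3 = 0 ->
  exists z, [/\ u1 = al * z, u2 = om * z & u3 = xi * z].
Hypothesis right0 : forall z, P0 * z = z -> al * z = 0 -> z = 0.

(** Beyond degree 3 the default value gives rank 0, hence zero modules, so one description covers
    all degrees. *)
Definition krk (i : nat) : nat := nth 0 [:: 1; 3; 3; 1] i.
Definition kproj (i j : nat) : R :=
  nth 0 (nth [::] [:: [:: P0]; [:: Pa; Pw; Px]; [:: Pwa; Pxa; Pxw]; [:: Pt]] i) j.
Definition kdiff (i a b : nat) : R := nth 0 (nth [::] (nth [::] [::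
  [:: [:: al]; [:: om]; [:: xi]];
  [:: [:: A1; B1; 0]; [:: A2; ep; C2]; [:: 0; B3; C3]];
  [:: [:: Y1; Y2; Y3]] ] i) a) b.
Definition kA i : 'M[R]_(krk i) := diag_mx (\row_j kproj i j).
Definition kB i : 'M[R]_(krk i.+1, krk i) := \matrix_(a, b) kdiff i a b.

Lemma kAA i : kA i *m kA i = kA i.
Proof.
rewrite /kA mulmx_diag; congr diag_mx; apply/rowP => j; rewrite !mxE.
have /allP id := idem.
have kid p : p \in [:: P0; Pa; Pw; Px; Pwa; Pxa; Pxw; Pt] -> p * p = p.
  by move=> /id /eqP.
case: i j => [|[|[|[|i]]]] [[|[|[|j]]] lj] //; rewrite /kproj /= ?nth_nil ?mulr0 //;
  by rewrite kid // !inE eqxx ?orbT.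
Qed.

Lemma kAB i : kA i.+1 *m kB i = kB i.
Proof.
rewrite /kA mul_diag_mx; apply/matrixP => a b; rewrite !mxE.
have /= := typed; rewrite -!andbA => t.
(* Thirteen entries, each with a source and a target equation, give 26 conjuncts. *)
do 25! (case/andP: t => /eqP ? t); case/andP: t => /eqP ? _.
case: i a b => [|[|[|i]]] [[|[|[|a]]] la] [[|[|[|b]]] lb] //;
  by rewrite /kproj /kdiff /= ?nth_nil ?mulr0 ?mul0r.
Qed.

Lemma kBA i : kB i *m kA i = kB i.
Proof.
rewrite /kA mul_mx_diag; apply/matrixP => a b; rewrite !mxE.
have /= := typed; rewrite -!andbA => t.
do 25! (case/andP: t => /eqP ? t); case/andP: t => /eqP ? _.
case: i a b => [|[|[|i]]] [[|[|[|a]]] la] [[|[|[|b]]] lb] //;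
  by rewrite /kproj /kdiff /= ?nth_nil ?mulr0 ?mul0r.
Qed.

Lemma kBB i : kB i.+1 *m kB i = 0.
Proof.
apply/matrixP => a b; rewrite !mxE.
case: i a b => [|[|[|i]]] [[|[|[|a]]] la] [[|[|[|b]]] lb] //.
all: by rewrite !big_ord_recl big_ord0 !mxE /kdiff /= ?mul0r ?mulr0 ?addr0 ?add0r ?addrA //.
Qed.

Definition kaug (v : 'rV[R]_1) : M := v 0 0 *: g.
Fact kaug_linear : linear kaug.
Proof. by move=> c u v; rewrite /kaug !mxE scalerDl scalerA. Qed.
HB.instance Definition _ := GRing.isLinear.Build R _ M *:%R kaug kaug_linear.

Lemma kaugA (v : 'rV_(krk 0)) : kaug (v *m kA 0) = kaug v.
Proof. by rewrite /kaug /kA mul_mx_diag !mxE -scalerA /kproj /= gP. Qed.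

Lemma kaug_surj y : exists v, kaug v = y.
Proof. by have [z ->] := g_surj y; exists (\row_j z); rewrite /kaug mxE. Qed.

Lemma kaugB (v : 'rV_(krk 1)) : kaug (v *m kB 0) = 0.
Proof.
rewrite /kaug !mxE !big_ord_recl big_ord0 !mxE /kdiff /= addr0 !scalerDl -!scalerA.
by rewrite g_al g_om g_xi !scaler0 !addr0.
Qed.

Definition row3 (u1 u2 u3 : R) : 'rV[R]_3 := \row_j nth 0 [:: u1; u2; u3] j.
Definition col3 (u1 u2 u3 : R) : 'cV[R]_3 := \col_j nth 0 [:: u1; u2; u3] j.
Local Notation o0 := (@Ordinal 3 0 isT).
Local Notation o1 := (@Ordinal 3 1 isT).
Local Notation o2 := (@Ordinal 3 2 isT).

Lemma sum3 (F : 'I_3 -> R) : \sum_(j < 3) F j = F o0 + F o1 + F o2.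
Proof.
rewrite !big_ord_recl big_ord0 addr0 addrA.
by congr (F _ + F _ + F _); apply: val_inj.
Qed.

Lemma kexact0 (v : 'rV_(krk 0)) : v *m kA 0 = v -> kaug v = 0 ->
  exists u, v = u *m kB 0.
Proof.
move=> vA v0; have [|u1 [u2 [u3 vE]]] := left0 _ v0.
  by rewrite -[in RHS]vA /kA mul_mx_diag !mxE.
exists (row3 u1 u2 u3); apply/rowP => j; rewrite !mxE.
rewrite [RHS]sum3 !mxE /kdiff ord1 /=.
by [].
Qed.

Lemma kA_row i (v : 'rV[R]_(krk i)) (j : 'I_(krk i)) : v *m kA i = v -> v 0 j * kproj i j = v 0 j.
Proof. by move=> vA; rewrite -[in RHS]vA /kA mul_mx_diag !mxE. Qed.

Lemma kA_col i (v : 'cV[R]_(krk i)) (j : 'I_(krk i)) : kA i *m v = v -> kproj i j * v j 0 = v j 0.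
Proof. by move=> vA; rewrite -[in RHS]vA /kA mul_diag_mx !mxE. Qed.

Lemma kexactS i (v : 'rV_(krk i.+1)) : v *m kA i.+1 = v -> v *m kB i = 0 ->
  exists u, v = u *m kB i.+1.
Proof.
case: i v => [|[|[|i]]] v vA vB.
- have [||||v1 [v2 [v3 [e1 e2 e3]]]] := @left1 (v 0 o0) (v 0 o1) (v 0 o2).
  + exact: (@kA_row 1 v o0 vA).
  + exact: (@kA_row 1 v o1 vA).
  + exact: (@kA_row 1 v o2 vA).
  + by have := congr1 (fun A : 'rV_1 => A 0 0) vB; rewrite !mxE [LHS]sum3 !mxE.
  exists (row3 v1 v2 v3); apply/rowP => -[[|[|[|j]]] lj] //; rewrite !mxE [RHS]sum3 !mxE /kdiff /= ?mulr0 ?addr0 ?add0r;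
  [rewrite -e1|rewrite -e2|rewrite -e3]; congr (v 0 _); exact: val_inj.
- have vBj j := congr1 (fun A : 'rV_3 => A 0 j) vB.
  have [||||||z [e1 e2 e3]] := @left2 (v 0 o0) (v 0 o1) (v 0 o2).
  + exact: (@kA_row 2 v o0 vA).
  + exact: (@kA_row 2 v o1 vA).
  + exact: (@kA_row 2 v o2 vA).
  + by have := vBj o0; rewrite !mxE [LHS]sum3 !mxE /kdiff /= mulr0 addr0.
  + by have := vBj o1; rewrite !mxE [LHS]sum3 !mxE /kdiff /=.
  + by have := vBj o2; rewrite !mxE [LHS]sum3 !mxE /kdiff /= mulr0 add0r.
  exists (\row_j z); apply/rowP => -[[|[|[|j]]] lj] //; rewrite !mxE big_ord1 !mxE /kdiff /=;
  [rewrite -e1|rewrite -e2|rewrite -e3]; congr (v 0 _); exact: val_inj.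
- exists 0; rewrite mul0mx; apply/rowP => j; rewrite ord1 mxE; apply: left3.
    exact: (@kA_row 3 v 0 vA).
  by have := congr1 (fun A : 'rV_3 => A 0 o2) vB; rewrite !mxE big_ord1 !mxE.
exists 0; apply/rowP => -[j lj]; exfalso; move: lj; rewrite /krk /= nth_nil //.
Qed.

Lemma kcoexact i (w : 'cV[R]_(krk i)) : i <> 3%N -> kA i *m w = w -> kB i *m w = 0 ->
  mx_coboundary kB w.
Proof.
case: i w => [|[|[|[|i]]]] // w _ wA wB.
- have wBj j := congr1 (fun A : 'cV_3 => A j 0) wB.
  apply/colP => j; rewrite ord1 mxE; apply: right0.
    exact: (@kA_col 0 w 0 wA).
  by have := wBj o0; rewrite !mxE big_ord1 !mxE.
- have wBj j := congr1 (fun A : 'cV_3 => A j 0) wB.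
  have [||||||z [e1 e2 e3]] := @right1 (w o0 0) (w o1 0) (w o2 0).
  + exact: (@kA_col 1 w o0 wA).
  + exact: (@kA_col 1 w o1 wA).
  + exact: (@kA_col 1 w o2 wA).
  + by have := wBj o0; rewrite !mxE [LHS]sum3 !mxE /kdiff /= mul0r addr0.
  + by have := wBj o1; rewrite !mxE [LHS]sum3 !mxE /kdiff /=.
  + by have := wBj o2; rewrite !mxE [LHS]sum3 !mxE /kdiff /= mul0r add0r.
  exists (\col_j z); apply/colP => -[[|[|[|j]]] lj] //; rewrite !mxE big_ord1 !mxE /kdiff /=;
    [rewrite -e1|rewrite -e2|rewrite -e3]; congr (w _ 0); exact: val_inj.
- have [||||u1 [u2 [u3 [e1 e2 e3]]]] := @right2 (w o0 0) (w o1 0) (w o2 0).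
  + exact: (@kA_col 2 w o0 wA).
  + exact: (@kA_col 2 w o1 wA).
  + exact: (@kA_col 2 w o2 wA).
  + by have := congr1 (fun A : 'cV_1 => A 0 0) wB; rewrite !mxE [LHS]sum3 !mxE.
  exists (col3 u1 u2 u3); apply/colP => -[[|[|[|j]]] lj] //;
    rewrite !mxE [RHS]sum3 !mxE /kdiff /= ?mul0r ?addr0 ?add0r;
    [rewrite -e1|rewrite -e2|rewrite -e3]; congr (w _ 0); exact: val_inj.
exists 0; apply/colP => -[j lj]; exfalso; move: lj; rewrite /krk /= nth_nil //.
Qed.

Definition ktheta (w : 'cV[R]_1) : X := (w 0 0 : R^c) *: h.
Fact ktheta_zmod : zmod_morphism ktheta.
Proof. by move=> u v; rewrite /ktheta !mxE -scalerBl. Qed.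
HB.instance Definition _ :=
  GRing.isZmodMorphism.Build 'cV[R]_1 X ktheta ktheta_zmod.

Lemma conv_scalerA (b c : R) : ((b * c : R) : R^c) *: h = (c : R^c) *: ((b : R^c) *: h).
Proof. by rewrite scalerA. Qed.

Lemma conv_scalerD (b c : R) :
  ((b + c : R) : R^c) *: h = (b : R^c) *: h + (c : R^c) *: h.
Proof. exact: scalerDl. Qed.

Lemma koszul_calabi_yau :
  [/\ exists P : proj_resolution M, finite_length P /\ forall i, fin_gen (P i),
      Ext_iso M 3 X & forall i : nat, i <> 3%N -> Ext_vanishes M i].
Proof.
pose aug : {linear 'rV[R]_(krk 0) -> M} := kaug.
pose theta : {additive 'cV[R]_(krk 3) -> X} := ktheta.
split.
- exists (@mx_resolution _ _ _ _ _ aug kAA kAB kBA kBB kaugA kaug_surj kaugB kexact0 kexactS).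
  split; last by move=> i; apply: mx_resolution_fin_gen.
  apply: (@mx_resolution_finite _ _ _ _ _ _ _ _ _ _ _ _ _ _ _ 3).
  by move=> [|[|[|[|i]]]] //; rewrite /krk /= nth_nil.
- apply: (@mx_Ext_iso _ _ _ _ _ aug kAA kAB kBA kBB kaugA kaug_surj kaugB kexact0 kexactS 3 X theta).
  + by move=> c w; rewrite /theta /= /ktheta mxE conv_scalerA.
  + by move=> w; rewrite /theta /= /ktheta /kA mul_diag_mx !mxE conv_scalerA /kproj /= hP.
  + by move=> y; have [z ->] := h_surj y; exists (\col_j z); rewrite /theta /= /ktheta mxE.
  + move=> w [v ->]; rewrite /theta /= /ktheta !mxE [X in X *: _]sum3 !mxE /kdiff /=.
    by rewrite !conv_scalerD !conv_scalerA h_Y1 h_Y2 h_Y3 !scaler0 !addr0.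
  + move=> w wA w0; have [||v1 [v2 [v3 wE]]] := @right3 ((w : 'cV_1) 0 0) => //.
      exact: (@kA_col 3 w 0 wA).
    exists (col3 v1 v2 v3); apply/colP => j; rewrite ord1 [LHS]wE !mxE [RHS]sum3.
    by rewrite !mxE.
  by move=> w; apply/colP => -[j lj]; exfalso; move: lj; rewrite /krk /=.
move=> i i3.
apply: (@mx_Ext_vanishes _ _ _ _ _ aug kAA kAB kBA kBB kaugA kaug_surj kaugB kexact0 kexactS).
by move=> w; apply: kcoexact.
Qed.

End KoszulResolution.

(** * Iterated Ore extensions with a monomial basis *)

Section OreCalabiYau.
Variables (k : fieldType) (D : pzAlgType k) (N : nat).
Local Notation Z := 'I_N.+2.
Variables (e : Z -> D) (a w x : D) (ga gw gx : Z).
Hypothesis eM : forall i j, e i * e j = if i == j then e i else 0.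
Hypothesis e_sum : \sum_i e i = 1.
Hypotheses (a_deg : has_deg e ga a) (w_deg : has_deg e gw w) (x_deg : has_deg e gx x).
Variables lam kap mu : Z -> k.
Local Notation diag := (diag e).
Hypotheses (lam_neq0 : forall i, lam i != 0) (kap_neq0 : forall i, kap i != 0).
Hypothesis xaE : x * a = w + diag kap * a * x.
Hypothesis waE : w * a = diag lam * a * w.
Hypothesis xwE : x * w = diag mu * w * x.
Hypothesis gwE : gw = ga + gx.
Hypothesis lam_per : forall i, lam (i + gw) = lam i.
Hypothesis kap_per : forall i, kap (i + gw) = kap i.
Hypothesis muE : forall i, mu (i + ga) = lam i.

(* The index (s, j, t, i) stands for the monomial x^s w^j a^t e_i. *)
Definition pbw_index : choiceType := (nat * nat * nat * Z)%type.
Definition pbw (m : pbw_index) : D :=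
  x ^+ m.1.1.1 * w ^+ m.1.1.2 * a ^+ m.1.2 * e m.2.
Variable co : {additive D -> {malg k[pbw_index]}}.
Hypothesis coZ : forall c d, co (pzC c * d) = c *: co d.
Hypothesis co_pbw : forall m, co (pbw m) = << m >>.
Hypothesis pbw_span : forall d, exists F : seq (k * pbw_index),
  d = \sum_(c <- F) pzC c.1 * pbw c.2.

(** The linear extension of [pbw], composed with [co], fixes every monomial, hence everything they
    span. *)
Lemma pbw_coK d : d = \sum_(m <- msupp (co d)) pzC (co d)@_m * pbw m.
Proof.
have [F dE] := pbw_span d.
pose L : {malg k[pbw_index]} -> kspace D := malg_lift (V := kspace D) pbw.
have Lco y : L (co y) = \sum_(m <- msupp (co y)) pzC (co y)@_m * pbw m by [].
rewrite -Lco {2}dE raddf_sum /L linear_sum {1}dE /=; apply: eq_bigr => c _.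
by rewrite coZ linearZ /= co_pbw malg_liftU.
Qed.

Section Abstract.
Variables (R : pzRingType) (l : {rmorphism D -> R}) (r : {additive D -> R}).
Hypothesis E : enveloping l r.
Variable tau : {additive R -> R}.
Hypothesis tauM : forall u v, tau (u * v) = tau v * tau u.
Hypothesis taul : forall y, tau (l y) = r y.
Hypothesis taur : forall y, tau (r y) = l y.

Let en (m : pbw_index) : Z := m.2.
(** The vertex moves along with the exponent, since e_i a = a e_(i + ga). *)
Let sa (m : pbw_index) : pbw_index := (m.1.1, m.1.2.+1, m.2 + ga).
Let sw (m : pbw_index) : pbw_index := (m.1.1.1, m.1.1.2.+1, m.1.2, m.2 + gw).
Let sx (m : pbw_index) : pbw_index := (m.1.1.1.+1, m.1.1.2, m.1.2, m.2 + gx).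
Let da (m : pbw_index) := m.1.2.
Let dw (m : pbw_index) := m.1.1.2.
Let dx (m : pbw_index) := m.1.1.1.

Let bas_e m i : pbw m * e i = if en m == i then pbw m else 0.
Proof. by rewrite /pbw /en -mulrA eM; case: eqP => // _; rewrite mulr0. Qed.
Let sa_inj : injective sa.
Proof.
apply: (can_inj (g := fun m => (m.1.1, m.1.2.-1, m.2 - ga))) => -[[[s j] t] i].
by rewrite /sa /= addrK.
Qed.
Let sw_inj : {in @degA0 pbw_index da &, injective sw}.
Proof.
move=> m m' _ _; move: m m'.
apply: (can_inj (g := fun m => (m.1.1.1, m.1.1.2.-1, m.1.2, m.2 - gw))) => -[[[s j] t] i].
by rewrite /sw /= addrK.
Qed.
Let sx_inj : {in @degAW0 pbw_index da dw &, injective sx}.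
Proof.
move=> m m' _ _; move: m m'.
apply: (can_inj (g := fun m => (m.1.1.1.-1, m.1.1.2, m.1.2, m.2 - gx))) => -[[[s j] t] i].
by rewrite /sx /= addrK.
Qed.
Let saE m : pbw m * a = pbw (sa m).
Proof. by rewrite /pbw /= -mulrA a_deg exprSr !mulrA. Qed.
Let swE m : degA0 da m -> pbw m * w = pbw (sw m).
Proof.
by move=> /eqP m0; rewrite /pbw /= -/(da m) m0 !mulr1 -mulrA w_deg exprSr !mulrA.
Qed.
Let sxE m : degAW0 da dw m -> pbw m * x = pbw (sx m).
Proof.
case/andP=> /eqP m0 /eqP w0; rewrite /pbw /= -/(da m) -/(dw m) m0 w0 !mulr1.
by rewrite -mulrA x_deg exprSr !mulrA.
Qed.
Let da_dec m : da m != 0 -> exists m', m = sa m'.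
Proof.
case: m => [[[s j] [|t]] i] // _; exists (s, j, t, i - ga).
by rewrite /sa /= subrK.
Qed.
Let dw_dec m : degA0 da m -> dw m != 0 -> exists2 m', degA0 da m' & m = sw m'.
Proof.
case: m => [[[s [|j]] t] i] // t0 _; exists (s, j, t, i - gw) => //.
by rewrite /sw /= subrK.
Qed.
Let dx_dec m : degAW0 da dw m -> dx m != 0 -> exists2 m', degAW0 da dw m' & m = sx m'.
Proof.
case: m => [[[[|s] j] t] i] // t0 _; exists (s, j, t, i - gx) => //.
by rewrite /sx /= subrK.
Qed.
Let bas0 m : degAWX0 da dw dx m -> pbw m = e (en m).
Proof.
case/andP=> /andP[/eqP a0 /eqP w0] /eqP x0.
by rewrite /pbw -/(da m) -/(dw m) -/(dx m) a0 w0 x0 !mul1r.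
Qed.

Local Notation wt := (wt l r e).
Local Notation al := (Kal l r e a).
Local Notation om := (Kom l r e w).
Local Notation xi := (Kxi l r e x).
Local Notation A1 := (KA1 l r e w ga lam).
Local Notation B1 := (KB1 l r e a ga gx lam).
Local Notation A2 := (KA2 l r e x ga kap).
Local Notation ep := (Kep l r e ga gx).
Local Notation C2 := (KC2 l r e a gx kap).
Local Notation B3 := (KB3 l r e x ga gx mu).
Local Notation C3 := (KC3 l r e w gx mu).
Local Notation Y1 := (KY1 l r e x ga gx kap mu).
Local Notation Y2 := (KY2 l r e w ga gx mu).
Local Notation Y3 := (KY3 l r e a gw gx kap mu).

Let da_s m : da (sa m) = (da m).+1. Proof. by []. Qed.
Let dw_s m : degA0 da m -> dw (sw m) = (dw m).+1. Proof. by []. Qed.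
Let dx_s m : degAW0 da dw m -> dx (sx m) = (dx m).+1. Proof. by []. Qed.
Let sw_stable m : degA0 da m -> degA0 da (sw m). Proof. by []. Qed.
Let sx_stable m : degAW0 da dw m -> degAW0 da dw (sx m). Proof. by []. Qed.

Lemma ore_left : koszul_exactness l r e 0 ga (ga + gx) gx (ga + (ga + gx)) (ga + gx)
  (gw + gx) (ga + (gw + gx)) al om xi A1 B1 A2 ep C2 B3 C3 Y1 Y2 Y3.
Proof.
exact: (koszul_left E coZ pbw_coK co_pbw eM e_sum bas_e a_deg w_deg x_deg
  sa_inj saE da_s da_dec sw_stable sw_inj swE dw_s dw_dec
  sx_stable sx_inj sxE dx_s dx_dec bas0
  lam_neq0 kap_neq0 xaE waE xwE gwE lam_per kap_per muE).
Qed.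

Lemma ore_right : koszul_exactness l r e (- (ga + (gw + gx))) (- (gw + gx))
  (- (ga + gx)) (- (ga + (ga + gx))) (- gx) (- (ga + gx)) (- ga) 0
  (tau Y3) (tau Y2) (tau Y1) (tau C3) (tau C2) (tau B3) (tau ep) (tau B1)
  (tau A2) (tau A1) (tau xi) (tau om) (tau al).
Proof.
exact: (koszul_right E coZ pbw_coK co_pbw eM e_sum bas_e a_deg w_deg x_deg
  sa_inj saE da_s da_dec sw_stable sw_inj swE dw_s dw_dec
  sx_stable sx_inj sxE dx_s dx_dec bas0
  lam_neq0 kap_neq0 xaE waE xwE gwE lam_per kap_per muE tauM taul taur).
Qed.

Let tauK u : tau (tau u) = u.
Proof.
elim/(enveloping_ind E): u => [|u v IHu IHv|u v]; first by rewrite !raddf0.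
  by rewrite !raddfD /= IHu IHv.
by rewrite !tauM taul taur taur taul.
Qed.

Let tau_wt c : tau (wt c) = wt (- c).
Proof.
rewrite raddf_sum [RHS](reindex_inj (addIr c)) /=; apply: eq_bigr => i _.
by rewrite tauM taul taur addrK.
Qed.

Lemma wt_left c z : wt c * z = z -> has_wt l r e (- c) (tau z).
Proof. by move=> zE; rewrite /has_wt -tau_wt -tauM zE. Qed.

(** [g] and [h] stand for the element 1 of the regular and of the twisted bimodule. Each is free
    over the right factor; the left factor is absorbed directly at g and through nu at h. *)
Variables (M : lmodType R) (X : lmodType R^c) (g : M) (h : X).
Hypothesis g_bal : forall y, l y *: g = r y *: g.
Hypothesis g_inj : forall t, r t *: g = 0 -> t = 0.
Hypothesis g_surj : forall y, exists t, y = r t *: g.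
Variable nu : {rmorphism D -> D}.
Hypothesis nu_inj : injective nu.
Hypothesis nuC : forall c, nu (pzC c) = pzC c.
Hypothesis nu_e : forall i, nu (e i) = e (i + (ga + (gw + gx))).
Hypothesis h_bal : forall y, (l y : R^c) *: h = (r (nu y) : R^c) *: h.
Hypothesis h_inj : forall t, (r t : R^c) *: h = 0 -> t = 0.
Hypothesis h_surj : forall y, exists t, y = (r t : R^c) *: h.
Hypotheses (nu_x : nu x = x * diag (funM mu kap)) (nu_w : nu w = w).
Hypothesis nu_aE : diag (funM mu kap) * nu a = a.

Let wt0_g : wt 0 *: g = g.
Proof.
rewrite wtE scaler_suml -[RHS]scale1r -(enveloping_r1 E) -e_sum raddf_sum scaler_suml.
apply: eq_bigr => i _; rewrite addr0 (enveloping_lr E) -scalerA g_bal scalerA.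
by rewrite -(enveloping_rM E) eM eqxx.
Qed.

(** nu moves vertices by exactly the weight of the last term of the complex, so h is fixed by the
    idempotent of that term. *)
Let wtt_h : (wt (ga + (gw + gx)) : R^c) *: h = h.
Proof.
have h1 : (r 1 : R^c) *: h = h by rewrite (enveloping_r1 E); apply: scale1r.
have hD : {morph (fun u : R => (u : R^c) *: h) : u v / u + v} by move=> u v; apply: scalerDl.
have h0 : (0 : R^c) *: h = 0 by apply: scale0r.
rewrite -[RHS]h1 -e_sum wtE (big_morph _ hD h0) raddf_sum (big_morph _ hD h0).
rewrite [RHS](reindex_inj (addIr (ga + (gw + gx)))) /=; apply: eq_bigr => i _.
by rewrite conv_scalerA h_bal nu_e -conv_scalerA -(enveloping_rM E) eM eqxx.
Qed.

Let tdiff_l d y c c' g1 g2 : has_deg e d y -> d + c = c' ->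
  wt c' * (tdiff l r e y g1 g2 * wt c) == tdiff l r e y g1 g2 * wt c.
Proof. by move=> hy <-; rewrite (tdiff_wt E eM _ _ _ hy) mulrA (wtM E eM). Qed.
Let wt_r c u : u * wt c * wt c == u * wt c.
Proof. by rewrite -mulrA (wtM E eM). Qed.

Let diff_g y : tdiff l r e y (@fun1 k N) (@fun1 k N) *: g = 0.
Proof. by rewrite /tdiff -mulrBr -scalerA scalerBl g_bal subrr scaler0. Qed.

(** On h a difference becomes a twisted commutator; its vanishing for the last differential is what
    prescribes nu on a, w and x. *)
Let tdiff_h y g1 g2 : (tdiff l r e y g1 g2 : R^c) *: h =
  (r (nu (diag g1) * nu y - y * nu (diag g2)) : R^c) *: h.
Proof.
have hB u v : ((u - v : R) : R^c) *: h = (u : R^c) *: h - (v : R^c) *: h.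
  exact: scalerBl.
rewrite /tdiff hB raddfB /= hB -rmorphM h_bal rmorphM; congr (_ - _).
by rewrite conv_scalerA h_bal -conv_scalerA -(enveloping_rM E).
Qed.

Let gt := ga + (gw + gx).
Let gtE : gt = gw + gw.
Proof. by rewrite /gt gwE; ring. Qed.

(** nu rotates by gt = 2 gw, hence fixes diagonal elements of period gw. *)
Let nu_diag f : (forall i, f (i + gw) = f i) -> nu (diag f) = diag f.
Proof.
move=> fper; rewrite raddf_sum [RHS](reindex_inj (addIr gt)) /=.
apply: eq_bigr => i _; rewrite rmorphM nuC nu_e.
rewrite -/gt; congr (pzC _ * _).
by rewrite gtE addrA !fper.
Qed.

Let mu_per i : mu (i + gw) = mu i.
Proof. by rewrite -[i in LHS](subrK ga) addrAC !muE lam_per -{2}[i](subrK ga) muE. Qed.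

Let w_mu : w * diag mu = diag mu * w.
Proof.
rewrite -(deg_diag _ w_deg); congr (_ * diag _).
by apply/funext => i; rewrite -[in RHS]mu_per subrK.
Qed.

Let wtt_tdiff_h d y c g1 g2 : has_deg e d y -> d + c = gt ->
  ((tdiff l r e y g1 g2 * wt c : R) : R^c) *: h =
  (r (nu (diag g1) * nu y - y * nu (diag g2)) : R^c) *: h.
Proof.
by move=> hy dc; rewrite (tdiff_wt E eM _ _ _ hy) dc conv_scalerA wtt_h tdiff_h.
Qed.

Let r0_h : (r 0 : R^c) *: h = 0.
Proof. by rewrite raddf0; apply: scale0r. Qed.

Let mukap_per i : funM mu kap (i + gw) = funM mu kap i.
Proof. by rewrite /funM mu_per kap_per. Qed.

Let Y1_h : (Y1 : R^c) *: h = 0.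
Proof.
rewrite (wtt_tdiff_h _ _ x_deg); last by rewrite /gt gwE; ring.
by rewrite nu_x (nu_diag mukap_per) nu_diag // diag1 // mul1r subrr r0_h.
Qed.

Let Y2_h : (Y2 : R^c) *: h = 0.
Proof.
rewrite (wtt_tdiff_h _ _ w_deg); last by rewrite gtE gwE.
rewrite nu_w nu_diag => [|i]; last by rewrite /funN mu_per.
by rewrite diagN mulNr mulrN w_mu opprK addNr r0_h.
Qed.

Let Y3_h : (Y3 : R^c) *: h = 0.
Proof.
rewrite (wtt_tdiff_h _ _ a_deg) // (nu_diag mukap_per) nu_aE nu_diag // diag1 //.
by rewrite mulr1 subrr r0_h.
Qed.

Lemma ore_koszul :
  [/\ exists P : proj_resolution M, finite_length P /\ forall i, fin_gen (P i),
      Ext_iso M 3 X & forall i : nat, i <> 3%N -> Ext_vanishes M i].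
Proof.
have [L0 L1 L2 L3] := ore_left.
have [T0 T1 T2 T3] := ore_right.
apply: (@koszul_calabi_yau R M X g h (wt 0) (wt ga) (wt (ga + gx)) (wt gx)
  (wt (ga + (ga + gx))) (wt (ga + gx)) (wt (gw + gx)) (wt (ga + (gw + gx)))
  al om xi A1 B1 A2 ep C2 B3 C3 Y1 Y2 Y3).
- by rewrite /= !(wtM E eM) !eqxx.
- rewrite /= /Kep mulrN mulNr (wtM E eM) eqxx andbT.
  do ![apply/andP; split] => //; try exact: wt_r.
  all: try by apply: (tdiff_l _ _ a_deg); rewrite ?gwE; ring.
  all: try by apply: (tdiff_l _ _ w_deg); rewrite ?gwE; ring.
  all: try by apply: (tdiff_l _ _ x_deg); rewrite ?gwE; ring.
- by eapply K_wa; eassumption.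
- by eapply K_xa; eassumption.
- by eapply K_xw; eassumption.
- by eapply K_a; eassumption.
- by eapply K_w; eassumption.
- by eapply K_x; eassumption.
- exact: wt0_g.
- by rewrite /Kal -scalerA wt0_g diff_g.
- by rewrite /Kom -scalerA wt0_g diff_g.
- by rewrite /Kxi -scalerA wt0_g diff_g.
- by move=> y; have [t ->] := g_surj y; exists (r t).
- move=> z zP zg; have [u1 [u2 [u3 [t [_ _ _ zE]]]]] := L0 z zP.
  exists u1, u2, u3; rewrite zE; suff -> : t = 0 by rewrite raddf0 mul0r addr0.
  apply: g_inj; rewrite -[RHS]zg zE !scalerDl -!scalerA /Kal /Kom /Kxi.
  by rewrite wt0_g !diff_g !scaler0 !add0r.
- move=> u1 u2 u3 w1 w2 w3 uE.
  by have [v1 [v2 [v3 [_ _ _ ?]]]] := L1 u1 u2 u3 w1 w2 w3 uE; exists v1, v2, v3.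
- move=> v1 v2 v3 w1 w2 w3 e1 e2 e3.
  by have [z _ ?] := L2 v1 v2 v3 w1 w2 w3 e1 e2 e3; exists z.
- exact: L3.
- exact: wtt_h.
- exact: Y1_h.
- exact: Y2_h.
- exact: Y3_h.
- by move=> y; have [t ->] := h_surj y; exists (r t).
- move=> z zP zh; have [u1 [u2 [u3 [t [_ _ _ zE]]]]] := T0 _ (wt_left zP).
  exists (tau u3), (tau u2), (tau u1).
  have zE' : z = Y1 * tau u3 + Y2 * tau u2 + Y3 * tau u1 + wt gt * l t.
    rewrite -[LHS]tauK zE !(raddfD tau) /= !tauM !tauK taur tau_wt opprK.
    by congr (_ + _); rewrite addrC addrA addrAC.
  (* The three boundary terms vanish on h, so the remainder kills h as well; but it acts on h as
     nu(t). *)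
  rewrite zE'; suff -> : t = 0 by rewrite raddf0 mulr0 addr0.
  apply/nu_inj; rewrite rmorph0; apply: h_inj.
  rewrite -h_bal -{1}wtt_h -conv_scalerA -[RHS]zh zE' !conv_scalerD.
  rewrite (conv_scalerA _ Y1) (conv_scalerA _ Y2) (conv_scalerA _ Y3).
  by rewrite Y1_h Y2_h Y3_h !scaler0 !add0r.
- move=> v1 v2 v3 w1 w2 w3 vE.
  have [|u1 [u2 [u3 [_ _ _ [e1 e2 e3]]]]] :=
      T1 _ _ _ (wt_left w3) (wt_left w2) (wt_left w1).
    by rewrite -!tauM -!raddfD /= addrC addrA addrAC vE raddf0.
  exists (tau u3), (tau u2), (tau u1); split; rewrite -[LHS]tauK.
  + by rewrite e3 raddfD /= !tauM !tauK addrC.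
  + by rewrite e2 !(raddfD tau) /= !tauM !tauK addrC addrA addrAC.
  by rewrite e1 raddfD /= !tauM !tauK addrC.
- move=> u1 u2 u3 w1 w2 w3 e1 e2 e3.
  have [||||||z _ [z1 z2 z3]] := T2 (tau u3) (tau u2) (tau u1).
  + exact: wt_left.
  + exact: wt_left.
  + exact: wt_left.
  + by rewrite -!tauM -raddfD /= addrC e3 raddf0.
  + by rewrite -!tauM -!raddfD /= addrC addrA addrAC e2 raddf0.
  + by rewrite -!tauM -raddfD /= addrC e1 raddf0.
  exists (tau z); split; rewrite -[LHS]tauK.
  + by rewrite z3 tauM tauK.
  + by rewrite z2 tauM tauK.
  by rewrite z1 tauM tauK.
move=> z zP az; rewrite -[z]tauK (T3 (tau z)) ?raddf0 //.
  by rewrite -oppr0; apply: wt_left.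
by rewrite -tauM az raddf0.
Qed.

End Abstract.

(** Both modules are D generated by 1. The swap by nu makes [lft y] act on the 1 of U as nu(y), and
    the twist by nu' is the inverse bimodule. *)
Lemma ore_calabi_yau (nu nu' : {rmorphism D -> D}) :
  cancel nu nu' -> cancel nu' nu ->
  (forall c, nu (pzC c) = pzC c) -> (forall c, nu' (pzC c) = pzC c) ->
  (forall i, nu (e i) = e (i + (ga + (gw + gx)))) ->
  nu x = x * diag (funM mu kap) -> nu w = w -> diag (funM mu kap) * nu a = a ->
  twisted_calabi_yau D 3.
Proof.
move=> nuK nuK' nuC nuC' nu_e nu_x nu_w nu_a.
have [tau [tauM _ taul taur]] :=
  enveloping_swap (env_enveloping D) (nu := idfun) (fun=> erefl).
have [sw [swM sw1 swl swr]] := enveloping_swap (env_enveloping D) nuC.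
have [sw' [swM' sw1' swl' swr']] := enveloping_swap (env_enveloping D) nuC'.
pose U := twisted_bimod swM sw1; pose V := twisted_bimod swM' sw1'.
have l1 y : (lft y : env D) *: (1 : regbimod D) = y by rewrite lft_scale mulr1.
have r1 y : (rgt y : env D) *: (1 : regbimod D) = y by rewrite rgt_scale mul1r.
have Ul y : ((lft y : env D) : (env D)^c) *: (1 : U) = nu y.
  by rewrite twisted_scaleE swl r1.
have Ur y : ((rgt y : env D) : (env D)^c) *: (1 : U) = y.
  by rewrite twisted_scaleE swr l1.
have g_bal y : (lft y : env D) *: (1 : regbimod D) = rgt y *: (1 : regbimod D).
  by rewrite l1 r1.
have g_inj t : (rgt t : env D) *: (1 : regbimod D) = 0 -> t = 0 by rewrite r1.
have g_surj (y : regbimod D) : exists t, y = (rgt t : env D) *: (1 : regbimod D).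
  by exists y; rewrite r1.
have h_bal y : ((lft y : env D) : (env D)^c) *: (1 : U) =
    ((rgt (nu y) : env D) : (env D)^c) *: (1 : U) by rewrite Ul Ur.
have h_inj t : ((rgt t : env D) : (env D)^c) *: (1 : U) = 0 -> t = 0 by rewrite Ur.
have h_surj (y : U) : exists t, y = ((rgt t : env D) : (env D)^c) *: (1 : U).
  by exists y; rewrite Ur.
have [P Ext3 Ext_van] := @ore_koszul (env D) (@lft k D) (@rgt k D)
  (env_enveloping D) tau tauM taul taur (regbimod D) U (1 : D) (1 : D)
  g_bal g_inj g_surj nu (can_inj nuK) nuC nu_e h_bal h_inj h_surj nu_x nu_w nu_a.
split=> //; exists U; split; last by split.
exists V; split.
  exact: (twisted_tens_iso nuK nuK' swM sw1 swl swr swM' sw1' swl' swr').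
exact: (twisted_tens_iso nuK' nuK swM' sw1' swl' swr' swM sw1 swl swr).
Qed.
End OreCalabiYau.

(** * Path algebras *)

Section PathAction.
Variables (k : fieldType) (Q : quiver) (V : lmodType k).
Variables (ov : qvert Q -> V -> V) (oa : qarr Q -> V -> V).
Hypothesis ov_lin : forall i, linear (ov i).
Hypothesis oa_lin : forall b, linear (oa b).
Hypothesis ov_orth : forall i j v, ov i (ov j v) = if i == j then ov j v else 0.
Hypothesis ov_sum : forall v, \sum_i ov i v = v.
Hypothesis oa_src : forall b v, oa b (ov (qsrc b) v) = oa b v.
Hypothesis oa_tgt : forall b v, ov (qtgt b) (oa b v) = oa b v.

(** Paths compose from left to right, so they act on the right: the first arrow is applied first. *)
Definition path_op (p : qpath Q) (v : V) : V :=
  foldl (fun u b => oa b u) (ov (psrc p) v) (val p).2.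

Let lin0 (f : V -> V) : linear f -> f 0 = 0.
Proof. by move=> fl; have := fl (-1) 0 0; rewrite scaler0 addr0 scaleN1r addNr. Qed.

Lemma path_op_linear p : linear (path_op p).
Proof.
rewrite /path_op => c u v; rewrite ov_lin.
by elim/last_ind: (val p).2 => //= s b IHs; rewrite !foldl_rcons IHs oa_lin.
Qed.

Lemma path_op_tgt p v : ov (ptgt p) (path_op p v) = path_op p v.
Proof.
case: p => -[i s] /= ps; rewrite /path_op /ptgt /psrc /endpoint /=.
elim/last_ind: s ps => [_|s b _ _] /=; first by rewrite ov_orth eqxx.
by rewrite map_rcons last_rcons foldl_rcons oa_tgt.
Qed.

Lemma path_op_cat p q v :
  path_op q (path_op p v) = oapp (fun r => path_op r v) 0 (pcat p q).
Proof.
have [pq|pq] := eqVneq (ptgt p) (psrc q); last first.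
  rewrite pcat_None //= /path_op -/(path_op p v) -path_op_tgt ov_orth eq_sym (negPf pq).
  by elim: (val q).2 => //= b s IHs; rewrite (lin0 (oa_lin b)).
have [r -> rE] := pcatP pq; rewrite /= [in RHS]/path_op rE /= foldl_cat.
rewrite /psrc rE /= -/(psrc p) -/(path_op p v).
by rewrite {1}/path_op -pq path_op_tgt.
Qed.

Definition path_act (f : pathalg k Q) (v : V) : V :=
  malg_lift (fun p => path_op p v) f.

Lemma path_act_linearl v : linear (path_act^~ v).
Proof. by move=> c f g; rewrite /path_act linearP. Qed.

Lemma path_actD f g v : path_act (f + g) v = path_act f v + path_act g v.
Proof. by have := path_act_linearl v 1 f g; rewrite !scale1r. Qed.
Lemma path_actZ c f v : path_act (c *: f) v = c *: path_act f v.
Proof.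
have := path_act_linearl v c f 0; rewrite !addr0 => ->.
by rewrite /path_act linear0 addr0.
Qed.

Lemma path_actU p v : path_act (pmb k p) v = path_op p v.
Proof. exact: malg_liftU. Qed.

Lemma path_act_linear f : linear (path_act f).
Proof.
move=> c u v; rewrite /path_act /malg_lift scaler_sumr -big_split /=.
apply: eq_bigr => p _.
by rewrite path_op_linear scalerDr !scalerA mulrC.
Qed.

Lemma path_act0 f : path_act f 0 = 0.
Proof. exact/lin0/path_act_linear. Qed.

Lemma path_actM f g v : path_act (f * g) v = path_act g (path_act f v).
Proof.
apply: (pmalg_ext (f := fun f => path_act (f * g) v)
                  (g := fun f => path_act g (path_act f v))).
- by move=> c x y; rewrite mulrDl -pmalg_scalerAl path_actD path_actZ.
- by move=> c x y; rewrite path_actD path_actZ path_act_linear.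
move=> p.
apply: (pmalg_ext (f := fun g => path_act (pmb k p * g) v)
                  (g := fun g => path_act g (path_act (pmb k p) v))).
- by move=> c x y; rewrite mulrDr -pmalg_scalerAr path_actD path_actZ.
- by move=> c x y; rewrite path_actD path_actZ.
move=> q; rewrite -[pmb k p * _]/(pmalg_mul _ _) pmalg_mulbb !path_actU path_op_cat.
by rewrite -[pmul p q]/(pcat p q); case: (pcat p q) => [r|] /=;
  rewrite ?path_actU // /path_act linear0.
Qed.

Lemma path_act_vert i v : path_act (pvert k i) v = ov i v.
Proof. exact: path_actU. Qed.

Lemma path_act_arrow b v : path_act (parrow k b) v = oa b v.
Proof. by rewrite path_actU /path_op /= oa_src. Qed.

Lemma path_act1 v : path_act 1 v = v.
Proof.
have -> : 1 = \sum_(i <- enum (qvert Q)) pvert k i :> pathalg k Q.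
  by rewrite -[1]/(pmalg_one k _) /pmalg_one big_map.
rewrite -[RHS]ov_sum big_enum /=.
rewrite (big_morph (path_act^~ v) (id1 := 0) (op1 := +%R)).
- by apply: eq_bigr => i _; rewrite path_act_vert.
- by move=> f g; rewrite path_actD.
by rewrite /path_act linear0.
Qed.

Variable S : pathalg k Q -> Prop.
Hypothesis oS : forall f v, S f -> path_act f v = 0.

Lemma path_act_ideal f v : ideal_gen S f -> path_act f v = 0.
Proof.
have zm : zmod_morphism (path_act^~ v).
  by move=> g h; rewrite -scaleN1r addrC path_act_linearl scaleN1r addrC.
pose F : {additive pathalg k Q -> V} := HB.pack_for {additive pathalg k Q -> V}
  (path_act^~ v) (GRing.isZmodMorphism.Build _ _ _ zm).
apply: (@ideal_gen_vanish _ _ F S) => a s b Ss.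
by rewrite -[LHS]/(path_act _ _) !path_actM (oS _ Ss) path_act0.
Qed.

Definition quot_act (d : qring S) (v : V) : V := path_act (qrepr d) v.

Lemma quot_actE f v : quot_act (qproj S f) v = path_act f v.
Proof.
have : path_act (qrepr (qproj S f) - f) v = 0 by apply/path_act_ideal/qrepr_qproj.
rewrite -scaleN1r addrC path_act_linearl scaleN1r => /eqP.
by rewrite addrC subr_eq0 => /eqP.
Qed.

End PathAction.

Lemma malg_ind (k : fieldType) (K : choiceType) (P : {malg k[K]} -> Prop) :
  P 0 -> (forall f g, P f -> P g -> P (f + g)) -> (forall c f, P f -> P (c *: f)) ->
  (forall x, P << x >>) -> forall f, P f.
Proof.
move=> P0 PD PZ Pb f; rewrite [f]monalgE; elim/big_ind: _ => // x _.
have -> : << f@_x *g x >> = f@_x *: << x >> :> {malg k[K]}.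
  by apply/malgP => y; rewrite mcoeffZ !mcoeffU mulrnAr mulr1.
exact/PZ/Pb.
Qed.

Section PathGeneration.
Variables (k : fieldType) (Q : quiver).

Lemma pcat_parr (p : qpath Q) b : ptgt p = qsrc b ->
  exists2 r, pcat p (parr b) = Some r & val r = (psrc p, rcons (val p).2 b).
Proof.
move=> pb; have [r -> rE] := @pcatP _ p (parr b) pb; exists r => //.
by rewrite rE -cats1.
Qed.

(** Paths are built by appending arrows at the end, in accordance with right actions. *)
Lemma path_ind (P : pathalg k Q -> Prop) :
  P 0 -> (forall f g, P f -> P g -> P (f + g)) -> (forall c f, P f -> P (c *: f)) ->
  (forall i, P (pvert k i)) -> (forall f b, P f -> P (f * parrow k b)) ->
  forall f, P f.
Proof.
move=> P0 PD PZ Pv Pa f.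
have Pb p : P (pmb k p).
  case: p => -[i s] /= ps.
  elim/last_ind: s ps => [|s b IHs] ps.
    suff -> : exist _ (i, [::]) ps = ptriv i :> qpath Q by exact: Pv.
    exact: val_inj.
  have : composable i s && composable (endpoint i s) [:: b].
    by rewrite -composable_cat cats1.
  rewrite /= andbT => /andP[ps' /eqP sb].
  pose p' : qpath Q := exist (fun p => composable p.1 p.2) (i, s) ps'.
  have [r rE rv] := @pcat_parr p' b (esym sb).
  have -> : pmb k (exist _ (i, rcons s b) ps : qpath Q) = pmb k p' * parrow k b.
    rewrite -[RHS]/(pmalg_mul _ _) pmalg_mulbb -[pmul _ _]/(pcat p' (parr b)) rE /=.
    by congr (pmb k _); apply: val_inj; rewrite rv.
  by apply: Pa; apply: IHs.
exact: (malg_ind P0 PD PZ Pb f).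
Qed.

Lemma pvertM i j : pvert k i * pvert k j = if i == j then pvert k i else 0 :> pathalg k Q.
Proof.
rewrite -[LHS]/(pmalg_mul _ _) pmalg_mulbb -[pmul _ _]/(pcat (ptriv i) (ptriv j)).
case: eqP => [<-|/eqP ij]; last by rewrite pcat_None.
have [r -> rE] := @pcatP _ (ptriv i) (ptriv i) erefl.
by congr (pmb k _); apply: val_inj; rewrite rE.
Qed.

Lemma pvert_arrow (b : qarr Q) : pvert k (qsrc b) * parrow k b = parrow k b.
Proof.
rewrite -[LHS]/(pmalg_mul _ _) pmalg_mulbb -[pmul _ _]/(pcat (ptriv _) (parr b)).
have [r -> rE] := @pcat_parr (ptriv (qsrc b)) b erefl.
by congr (pmb k _); apply: val_inj; rewrite rE.
Qed.

Lemma pvert_arrow0 i (b : qarr Q) : i != qsrc b -> pvert k i * parrow k b = 0.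
Proof.
move=> ib; rewrite -[LHS]/(pmalg_mul _ _) pmalg_mulbb.
by rewrite -[pmul _ _]/(pcat (ptriv i) (parr b)) pcat_None.
Qed.

Lemma parrow_vert (b : qarr Q) : parrow k b * pvert k (qtgt b) = parrow k b.
Proof.
rewrite -[LHS]/(pmalg_mul _ _) pmalg_mulbb -[pmul _ _]/(pcat (parr b) (ptriv _)).
have [r -> rE] := @pcatP _ (parr b) (ptriv (qtgt b)) erefl.
by congr (pmb k _); apply: val_inj; rewrite rE.
Qed.

Lemma parrow_vert0 i (b : qarr Q) : qtgt b != i -> parrow k b * pvert k i = 0.
Proof.
move=> ib; rewrite -[LHS]/(pmalg_mul _ _) pmalg_mulbb.
by rewrite -[pmul _ _]/(pcat (parr b) (ptriv i)) pcat_None.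
Qed.

Lemma pvert_sum : \sum_i pvert k i = 1 :> pathalg k Q.
Proof. by rewrite -[RHS]/(pmalg_one k _) /pmalg_one big_map big_enum. Qed.

Lemma pathZ c (f : pathalg k Q) : c *: f = (pzC c : pathalg k Q) * f.
Proof.
rewrite -[pzC c]/(c *: (1 : pathalg k Q)) -[RHS]/((c *: (1 : pmalg k _)) * (f : pmalg k _)).
by rewrite -pmalg_scalerAl mul1r.
Qed.

Lemma parrow_neq0 (b : qarr Q) : parrow k b != 0.
Proof.
apply/eqP => /(congr1 (fun f : {malg k[qpath Q]} => f@_(parr b))) /eqP.
by rewrite mcoeffUU mcoeff0 oner_eq0.
Qed.

End PathGeneration.

(** * Presentation of the normal extension *)

Lemma ordS_add N (i : 'I_N.+2) : ordS i = i + 1.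
Proof. by apply: val_inj; rewrite /= modnDmr addn1. Qed.

Lemma ord_pred_sub N (i : 'I_N.+2) : ord_pred i = i - 1.
Proof. by apply: (can_inj (@ordSK _)); rewrite ord_predK ordS_add subrK. Qed.

(** The operators act on the right, so the product xa is [oa] after [ox]. Each relation is tested on
    one vertex component, where diagonal coefficients become scalars. *)
Record right_rep (k : fieldType) (N : nat) (ga gx gw : 'I_N.+2)
    (lam kap mu : 'I_N.+2 -> k) (V : lmodType k)
    (oe : 'I_N.+2 -> V -> V) (oa ox ow : V -> V) : Prop := RightRep {
  rep_e_linear : forall i, linear (oe i);
  rep_a_linear : linear oa;
  rep_x_linear : linear ox;
  rep_w_linear : linear ow;
  rep_eM : forall i j v, oe i (oe j v) = if i == j then oe j v else 0;
  rep_e_sum : forall v, \sum_i oe i v = v;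
  rep_a_deg : forall i v, oa (oe i v) = oe (i + ga) (oa v);
  rep_x_deg : forall i v, ox (oe i v) = oe (i + gx) (ox v);
  rep_w_deg : forall i v, ow (oe i v) = oe (i + gw) (ow v);
  rep_xa : forall i v, oa (ox (oe i v)) = ow (oe i v) + kap i *: ox (oa (oe i v));
  rep_wa : forall i v, oa (ow (oe i v)) = lam i *: ow (oa (oe i v));
  rep_xw : forall i v, ow (ox (oe i v)) = mu i *: ox (ow (oe i v)) }.

Lemma sum_delta (V : zmodType) (I : finType) (i : I) (P : pred I) (F : I -> V) :
  (forall j, P j = (i == j)) -> \sum_j (if P j then F j else 0) = F i.
Proof.
move=> PE; rewrite (bigD1 i) //= PE eqxx big1 ?addr0 // => j.
by rewrite PE eq_sym => /negPf ->.
Qed.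

Section OreRelations.
Variables (k : fieldType) (D : pzAlgType k) (N : nat).
Local Notation Z := 'I_N.+2.
Variables (e : Z -> D) (a x w : D) (rr : Z) (q p : Z -> k).
Hypothesis eM : forall i j, e i * e j = if i == j then e i else 0.
Hypothesis e_sum : \sum_i e i = 1.
Hypotheses (a_deg : has_deg e 1 a) (x_deg : has_deg e (- rr) x).
Hypothesis p_neq0 : forall i, p i != 0.
Hypothesis p_per : forall i, p (i + (1 - rr)) = p i.
Hypothesis wE : w = \sum_i (x * e i * (e i * a)
  - pzC (q i) * (e (i + rr) * a * (x * e (i + 1)))).
Hypothesis w_a : forall j, w * (e j * a) = pzC (p j) * (e (j - 1 + rr) * a) * w.
Hypothesis w_x : forall j,
  w * (x * e j) = pzC (p j)^-1 * (x * e (j - 1 + rr)) * w.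

(** The coefficient q_i belongs to a path that starts at vertex i + r; as a diagonal element on the
    left it is therefore i -> q(i - r). *)
Lemma rel_xa : x * a = w + diag e (fun i => q (i - rr)) * a * x.
Proof.
rewrite wE sumrB.
have -> : \sum_i x * e i * (e i * a) = x * a.
  transitivity (\sum_i x * e i * a).
    by apply: eq_bigr => i _; rewrite mulrA -[x * e i * e i]mulrA eM eqxx.
  by rewrite -mulr_suml -mulr_sumr e_sum mulr1.
suff -> : diag e (fun i => q (i - rr)) * a * x =
    \sum_i pzC (q i) * (e (i + rr) * a * (x * e (i + 1))) by rewrite subrK.
rewrite /diag !mulr_suml (reindex_inj (addIr rr)) /=; apply: eq_bigr => i _.
have ee : e (i + rr) * a * x = e (i + rr) * a * x * e (i + 1).
  rewrite -[X in X = _]mulrA -[X in _ = X * _]mulrA.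
  have -> : e (i + rr) * (a * x) = a * x * e (i + 1).
    by rewrite mulrA a_deg -mulrA x_deg mulrA; congr (_ * e _); ring.
  by rewrite -[RHS]mulrA eM eqxx.
by rewrite addrK -!mulrA; congr (_ * _); rewrite !mulrA.
Qed.

Lemma rel_w_deg : has_deg e (1 - rr) w.
Proof.
have -> : w = x * a - diag e (fun i => q (i - rr)) * a * x by rewrite rel_xa addrK.
have xa : has_deg e (1 - rr) (x * a) by rewrite addrC; apply: has_degM.
have dax : has_deg e (1 - rr) (diag e (fun i => q (i - rr)) * a * x).
  rewrite -[1]add0r; apply: has_degM => //; apply: has_degM => //.
  exact: diag_deg.
by move=> i; rewrite mulrBr mulrBl xa dax.
Qed.

Lemma rel_wa : w * a = diag e p * a * w.
Proof.
rewrite -[a in LHS]mul1r -e_sum mulr_suml mulr_sumr /diag !mulr_suml.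
rewrite [RHS](reindex_inj (addIr (rr - 1))) /=; apply: eq_bigr => i _.
have -> : p (i + (rr - 1)) = p i by rewrite -[LHS]p_per; congr (p _); ring.
have -> : e (i + (rr - 1)) = e (i - 1 + rr) by congr (e _); ring.
by rewrite w_a !mulrA.
Qed.

Lemma rel_xw : x * w = diag e (fun i => p (i - 1)) * w * x.
Proof.
have xew j : x * e (j - 1 + rr) * w = pzC (p j) * (w * x * e j).
  rewrite -[w * x * _]mulrA w_x !mulrA -rmorphM mulfV // rmorph1 mul1r.
  by rewrite -mulrA.
rewrite -[x]mulr1 -{1}e_sum mulr_sumr mulr_suml mulr1 /diag !mulr_suml.
rewrite [LHS](reindex_inj (addIr (rr - 1))) /=.
(* Since e_j w x = w x e_(j + 1 - 2r), the term ending in e_i is the one with j = i + 2r - 1. *)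
rewrite [RHS](reindex_inj (addIr (rr - 1 + rr))) /=; apply: eq_bigr => i _.
have -> : i + (rr - 1) = i - 1 + rr by ring.
rewrite xew.
have -> : p (i + (rr - 1 + rr) - 1) = p i.
  by rewrite -[LHS]p_per -[LHS]p_per; congr (p _); ring.
rewrite -!mulrA; congr (_ * _); rewrite !mulrA rel_w_deg -[RHS]mulrA x_deg mulrA.
by congr (_ * e _); ring.
Qed.

End OreRelations.

(** This lemma and the next perform a rewriting over an arbitrary ring, outside the quotient
    algebra. *)
Lemma rewrite_sub (D : pzRingType) (I : Type) (ea xe fa fx : I -> D) (i j m n : I) (c : D) :
  (forall i, ea i = fa i) -> (forall i, xe i = fx i) ->
  fx i * fa j - c * (fa m * fx n) = xe i * ea j - c * (ea m * xe n).
Proof. by move=> ae xe'; rewrite !ae !xe'. Qed.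

Lemma rewrite_normal (D : pzRingType) (I : Type) (e f : I -> D) (i j : I) (c w : D) :
  (forall i, e i = f i) -> w * f i = c * f j * w -> w * e i = c * e j * w.
Proof. by move=> ef; rewrite !ef. Qed.

Section OreQuiverAlgebra.
Variables (k : fieldType) (N : nat) (s : {perm 'I_N.+2}) (rr : 'I_N.+2).
Variables (q p : 'I_N.+2 -> k).
Variable phi : pathalg k (ore_quiver s) -> pathalg k (ore_quiver s).
Hypothesis sE : forall i, s i = i + rr.
Hypothesis p_neq0 : forall i, p i != 0.
Hypothesis p_per : forall i, p (i + (1 - rr)) = p i.
Hypothesis phi_a : forall i, phi (arr_a k s i) = p i *: arr_a k s (s (ord_pred i)).
Hypothesis phi_x : forall i, phi (arr_x k s i) = (p i)^-1 *: arr_x k s (s (ord_pred i)).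

Local Notation omega := (ore_omega s q).
Local Notation D := (normal_ext omega phi).
Local Notation Q := (ore_quiver s).
Local Notation rels := (fun x : pathalg k Q => exists b : qarr Q,
  x = omega * parrow k b - phi (parrow k b) * omega).

Definition ore_proj : {rmorphism pathalg k Q -> D} := @qproj (pathalg k Q) rels.

Definition ore_e (i : 'I_N.+2) : D := ore_proj (pvert k (i : qvert Q)).
Definition ore_a : D := ore_proj (\sum_i arr_a k s i).
Definition ore_x : D := ore_proj (\sum_i arr_x k s i).
Definition ore_w : D := ore_proj omega.
Definition ore_kap (i : 'I_N.+2) : k := q (i - rr).
Definition ore_mu (i : 'I_N.+2) : k := p (i - 1).

Lemma ore_projZ c f : ore_proj (c *: f) = pzC c * ore_proj f.
Proof. by rewrite pathZ rmorphM. Qed.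

Lemma ore_projM f g : ore_proj (f * g) = ore_proj f * ore_proj g.
Proof. exact: rmorphM. Qed.

Lemma ore_projB f g : ore_proj (f - g) = ore_proj f - ore_proj g.
Proof. exact: rmorphB. Qed.

Lemma ore_eM i j : ore_e i * ore_e j = if i == j then ore_e i else 0.
Proof.
rewrite /ore_e -rmorphM (pvertM k (i : qvert Q) (j : qvert Q)).
by case: ifP => // _; rewrite rmorph0.
Qed.

Lemma ore_e_sum : \sum_i ore_e i = 1.
Proof.
rewrite /ore_e -rmorph_sum -[RHS](rmorph1 ore_proj).
by congr (ore_proj _); exact: (pvert_sum k Q).
Qed.

Lemma vert_a i j : pvert k (i : qvert Q) * arr_a k s j = if i == j then arr_a k s j else 0.
Proof.
case: eqP => [->|/eqP ij]; first exact: (pvert_arrow k (inl j : qarr Q)).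
exact: (@pvert_arrow0 k Q i (inl j) ij).
Qed.

Lemma a_vert i j : arr_a k s j * pvert k (i : qvert Q) = if i == j + 1 then arr_a k s j else 0.
Proof.
rewrite -ordS_add; case: eqP => [->|/eqP ij]; first exact: (parrow_vert k (inl j : qarr Q)).
by apply: (@parrow_vert0 k Q i (inl j)); rewrite eq_sym.
Qed.

Lemma vert_x i j : pvert k (i : qvert Q) * arr_x k s j = if i == s j then arr_x k s j else 0.
Proof.
case: eqP => [->|/eqP ij]; first exact: (pvert_arrow k (inr j : qarr Q)).
exact: (@pvert_arrow0 k Q i (inr j) ij).
Qed.

Lemma x_vert i j : arr_x k s j * pvert k (i : qvert Q) = if i == j then arr_x k s j else 0.
Proof.
case: eqP => [->|/eqP ij]; first exact: (parrow_vert k (inr j : qarr Q)).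
by apply: (@parrow_vert0 k Q i (inr j)); rewrite eq_sym.
Qed.

Lemma ore_ea i : ore_e i * ore_a = ore_proj (arr_a k s i).
Proof.
transitivity (ore_proj (\sum_j pvert k (i : qvert Q) * arr_a k s j)).
  by rewrite -mulr_sumr rmorphM.
congr (ore_proj _); rewrite (eq_bigr _ (fun j _ => vert_a i j)).
exact: sum_delta.
Qed.

Lemma ore_ae i : ore_a * ore_e (i + 1) = ore_proj (arr_a k s i).
Proof.
transitivity (ore_proj (\sum_j arr_a k s j * pvert k (i + 1 : qvert Q))).
  by rewrite -mulr_suml rmorphM.
congr (ore_proj _); rewrite (eq_bigr _ (fun j _ => a_vert (i + 1) j)).
by apply: sum_delta => j; rewrite (inj_eq (addIr _)).
Qed.

Lemma ore_xe i : ore_x * ore_e i = ore_proj (arr_x k s i).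
Proof.
transitivity (ore_proj (\sum_j arr_x k s j * pvert k (i : qvert Q))).
  by rewrite -mulr_suml rmorphM.
congr (ore_proj _); rewrite (eq_bigr _ (fun j _ => x_vert i j)).
exact: sum_delta.
Qed.

Lemma ore_ex i : ore_e (i + rr) * ore_x = ore_proj (arr_x k s i).
Proof.
transitivity (ore_proj (\sum_j pvert k (i + rr : qvert Q) * arr_x k s j)).
  by rewrite -mulr_sumr rmorphM.
congr (ore_proj _); rewrite (eq_bigr _ (fun j _ => vert_x (i + rr) j)).
by apply: sum_delta => j; rewrite sE (inj_eq (addIr _)).
Qed.

Lemma ore_a_deg : has_deg ore_e 1 ore_a.
Proof. by move=> i; rewrite ore_ea ore_ae. Qed.

Lemma ore_x_deg : has_deg ore_e (- rr) ore_x.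
Proof. by move=> i; rewrite ore_xe -[in LHS](subrK rr i) ore_ex. Qed.

Lemma ore_rel b :
  ore_w * ore_proj (parrow k b) = ore_proj (phi (parrow k b)) * ore_w.
Proof.
rewrite /ore_w -ore_projM -ore_projM.
by apply/qproj_eq/ideal_gen_sub; exists b.
Qed.

Lemma ore_wE : ore_w = \sum_i (ore_x * ore_e i * (ore_e i * ore_a)
  - pzC (q i) * (ore_e (i + rr) * ore_a * (ore_x * ore_e (i + 1)))).
Proof.
transitivity (\sum_i ore_proj (arr_x k s i * arr_a k s i
    - q i *: (arr_a k s (s i) * arr_x k s (ordS i)))).
  exact: (rmorph_sum ore_proj).
apply: eq_bigr => i _.
rewrite ore_projB (ore_projM (arr_x k s i) (arr_a k s i)).
rewrite (ore_projZ (q i) (arr_a k s (s i) * arr_x k s (ordS i))).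
rewrite (ore_projM (arr_a k s (s i)) (arr_x k s (ordS i))).
rewrite sE ordS_add.
exact: (rewrite_sub _ _ _ _ _ ore_ea ore_xe).
Qed.

Lemma ore_w_a j : ore_w * (ore_e j * ore_a) =
  pzC (p j) * (ore_e (j - 1 + rr) * ore_a) * ore_w.
Proof.
have := ore_rel (inl j); rewrite -[parrow k _]/(arr_a k s j) phi_a.
rewrite (ore_projZ (p j) (arr_a k s (s (ord_pred j)))) sE ord_pred_sub.
exact: (rewrite_normal ore_ea).
Qed.

Lemma ore_w_x j : ore_w * (ore_x * ore_e j) =
  pzC (p j)^-1 * (ore_x * ore_e (j - 1 + rr)) * ore_w.
Proof.
have := ore_rel (inr j); rewrite -[parrow k _]/(arr_x k s j) phi_x.
rewrite (ore_projZ (p j)^-1 (arr_x k s (s (ord_pred j)))) sE ord_pred_sub.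
exact: (rewrite_normal ore_xe).
Qed.

(** Multiplying by an arrow amounts to multiplying by a or x and an idempotent; w, the image of
    omega, is a combination of such products. *)
Lemma ore_ind (P : D -> Prop) :
  P 1 -> (forall f g, P f -> P g -> P (f + g)) -> (forall c f, P f -> P (pzC c * f)) ->
  (forall f i, P f -> P (f * ore_e i)) -> (forall f, P f -> P (f * ore_a)) ->
  (forall f, P f -> P (f * ore_x)) -> forall f, P f.
Proof.
move=> P1 PD PZ Pe Pa Px f; rewrite -[f]qreprK -[qproj _ _]/(ore_proj (qrepr f)).
have Pe1 i : P (ore_e i) by rewrite -[ore_e i]mul1r; apply: Pe.
have P0 : P 0 by rewrite -(mul0r 1) -(rmorph0 (@pzC k D)); apply: PZ.
apply: (@path_ind k Q (fun g => P (ore_proj g))).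
- by rewrite rmorph0.
- by move=> g h Pg Ph; rewrite rmorphD; apply: PD.
- by move=> c g Pg; rewrite ore_projZ; apply: PZ.
- exact: Pe1.
move=> g [] i Pg; rewrite ore_projM.
- rewrite -[parrow k _]/(arr_a k s i) -ore_ea mulrA.
  exact/Pa/Pe.
rewrite -[parrow k _]/(arr_x k s i) -ore_xe mulrA.
exact/Pe/Px.
Qed.

Section Representation.
Variables (V : lmodType k) (oe : 'I_N.+2 -> V -> V) (oa ox ow : V -> V).
Hypothesis rep : right_rep 1 (- rr) (1 - rr) p ore_kap ore_mu oe oa ox ow.

(** An arrow acts as the full operator restricted to the component at its source. *)
Let opa (b : qarr Q) (v : V) : V :=
  match b with inl i => oa (oe i v) | inr i => ox (oe (s i) v) end.

Let linD (f : V -> V) u v : linear f -> f (u + v) = f u + f v.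
Proof. by move=> fl; have := fl 1 u v; rewrite !scale1r. Qed.
Let lin0 (f : V -> V) : linear f -> f 0 = 0.
Proof. by move=> fl; have := fl (-1) 0 0; rewrite scaler0 addr0 scaleN1r addNr. Qed.
Let linZ (f : V -> V) c v : linear f -> f (c *: v) = c *: f v.
Proof. by move=> fl; have := fl c v 0; rewrite (lin0 fl) !addr0. Qed.
Let lin_sum (I : finType) (f : V -> V) (F : I -> V) : linear f ->
  f (\sum_i F i) = \sum_i f (F i).
Proof.
by move=> fl; rewrite (big_morph f (fun u v => linD u v fl) (lin0 fl)).
Qed.

Lemma opa_linear b : linear (opa b).
Proof.
case: b => i c u v /=.
  by rewrite (rep_e_linear rep) (rep_a_linear rep).
by rewrite (rep_e_linear rep) (rep_x_linear rep).
Qed.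

Lemma opa_src b v : opa b (oe (qsrc b) v) = opa b v.
Proof. by case: b => i /=; rewrite (rep_eM rep) eqxx. Qed.

Let ov : qvert Q -> V -> V := oe.

Lemma opa_tgt b v : ov (qtgt b) (opa b v) = opa b v.
Proof.
case: b => i; rewrite /ov /=.
  by rewrite (rep_a_deg rep) ordS_add (rep_eM rep) eqxx.
by rewrite sE (rep_x_deg rep) addrK (rep_eM rep) eqxx.
Qed.

Let ov_lin i : linear (ov i). Proof. exact: (rep_e_linear rep). Qed.
Let ov_orth i j v : ov i (ov j v) = if i == j then ov j v else 0.
Proof. exact: (rep_eM rep). Qed.

Local Notation pact := (path_act ov opa).
Let pactM f g v : pact (f * g) v = pact g (pact f v).
Proof. exact: (path_actM ov_lin opa_linear ov_orth opa_tgt). Qed.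

Let pactB f g v : pact (f - g) v = pact f v - pact g v.
Proof. by rewrite -[- g]scaleN1r path_actD path_actZ scaleN1r. Qed.

Let pact_sum (I : finType) (F : I -> pathalg k Q) v :
  pact (\sum_i F i) v = \sum_i pact (F i) v.
Proof.
apply: (big_morph (pact^~ v)) => [f g|]; first exact: path_actD.
by rewrite -(scale0r 0) path_actZ scale0r.
Qed.

Lemma pact_a i v : pact (arr_a k s i) v = oa (oe i v).
Proof. exact: (@path_act_arrow k Q V ov opa opa_src (inl i)). Qed.

Lemma pact_x i v : pact (arr_x k s i) v = ox (oe (i + rr) v).
Proof.
by rewrite -sE; exact: (@path_act_arrow k Q V ov opa opa_src (inr i)).
Qed.

(** Both paths in the i-th summand of omega start at vertex i + r, where [rep_xa] evaluates their
    combination to [ow]. *)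
Lemma pact_w v : pact omega v = ow v.
Proof.
transitivity (\sum_i (pact (arr_x k s i * arr_a k s i) v -
    q i *: pact (arr_a k s (s i) * arr_x k s (ordS i)) v)).
  rewrite -[LHS]/(pact (\sum_i _) v) pact_sum; apply: eq_bigr => i _.
  by rewrite pactB path_actZ.
transitivity (\sum_i ow (oe (i + rr) v)); last first.
  rewrite -[in RHS](rep_e_sum rep v) (lin_sum _ (rep_w_linear rep)).
  by rewrite [RHS](reindex_inj (addIr rr)).
apply: eq_bigr => i _.
have xa : pact (arr_x k s i * arr_a k s i) v = oa (oe i (ox (oe (i + rr) v))).
  exact: etrans (pactM _ _ _) (etrans (congr1 (pact (arr_a k s i)) (pact_x i v)) (pact_a i _)).
have ax : pact (arr_a k s (s i) * arr_x k s (ordS i)) v =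
    ox (oe (ordS i + rr) (oa (oe (s i) v))).
  exact: etrans (pactM _ _ _)
    (etrans (congr1 (pact (arr_x k s (ordS i))) (pact_a (s i) v)) (pact_x (ordS i) _)).
apply: (etrans (congr2 (fun u v => u - q i *: v) xa ax)).
rewrite sE ordS_add.
have -> : oe i (ox (oe (i + rr) v)) = ox (oe (i + rr) v).
  by rewrite (rep_x_deg rep) addrK (rep_eM rep) eqxx.
have -> : oe (i + 1 + rr) (oa (oe (i + rr) v)) = oa (oe (i + rr) v).
  have -> : i + 1 + rr = i + rr + 1 by ring.
  by rewrite (rep_a_deg rep) (rep_eM rep) eqxx.
by rewrite (rep_xa rep) /ore_kap addrK addrK.
Qed.

(** The relation at a_i is [rep_wa] and the one at x_i is [rep_xw] read backwards; the periodicity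
    of p matches the vertices at which coefficients are read. *)
Lemma pact_rels f v : rels f -> pact f v = 0.
Proof.
case=> b ->; rewrite pactB; apply/eqP; rewrite subr_eq0; apply/eqP.
have wb : pact (omega * parrow k b) v = pact (parrow k b) (ow v).
  exact: etrans (pactM _ _ _) (congr1 (pact (parrow k b)) (pact_w v)).
have bw : pact (phi (parrow k b) * omega) v = ow (pact (phi (parrow k b)) v).
  exact: etrans (pactM _ _ _) (pact_w _).
apply: (etrans wb); apply: esym; apply: (etrans bw); apply: esym => {wb bw}.
case: b => i.
  rewrite -[parrow k _]/(arr_a k s i).
  apply: (etrans (pact_a i (ow v))); rewrite (_ : pact _ v = p i *: oa (oe (s (ord_pred i)) v)).
    2: by rewrite phi_a; apply: etrans (path_actZ _ _ _ _ _) (congr1 _ (pact_a _ _)).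
  rewrite sE ord_pred_sub (linZ _ _ (rep_w_linear rep)).
  have -> : oe i (ow v) = ow (oe (i - 1 + rr) v).
    by rewrite (rep_w_deg rep); congr (oe _ _); ring.
  rewrite (rep_wa rep); congr (_ *: _).
  by rewrite -[LHS]p_per; congr (p _); ring.
rewrite -[parrow k _]/(arr_x k s i).
apply: (etrans (pact_x i (ow v))).
rewrite (_ : pact _ v = (p i)^-1 *: ox (oe (s (ord_pred i) + rr) v)).
  2: by rewrite phi_x; apply: etrans (path_actZ _ _ _ _ _) (congr1 _ (pact_x _ _)).
rewrite sE ord_pred_sub (linZ _ _ (rep_w_linear rep)).
have -> : oe (i + rr) (ow v) = ow (oe (i - 1 + rr + rr) v).
  by rewrite (rep_w_deg rep); congr (oe _ _); ring.
rewrite (rep_xw rep) scalerA.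
have -> : ore_mu (i - 1 + rr + rr) = p i.
  by rewrite /ore_mu -[LHS]p_per -[LHS]p_per; congr (p _); ring.
by rewrite mulVf // scale1r.
Qed.

Lemma ore_representation : exists act : D -> V -> V,
  [/\ forall d d' v, act (d + d') v = act d v + act d' v,
      forall c d v, act (pzC c * d) v = c *: act d v,
      forall v, act 1 v = v,
      forall d d' v, act (d * d') v = act d' (act d v) &
      [/\ forall i v, act (ore_e i) v = oe i v, forall v, act ore_a v = oa v,
          forall v, act ore_x v = ox v & forall v, act ore_w v = ow v]].
Proof.
pose act : D -> V -> V := @quot_act k Q V ov opa rels.
have actE f v : act (ore_proj f) v = pact f v.
  exact: (quot_actE ov_lin opa_linear ov_orth opa_tgt pact_rels).
have projK (d : D) : exists f, d = ore_proj f by exists (qrepr d); rewrite -[LHS]qreprK.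
exists act; split.
- move=> d d' v; have [f ->] := projK d; have [g ->] := projK d'.
  by rewrite -(rmorphD ore_proj) !actE path_actD.
- move=> c d v; have [f ->] := projK d.
  by rewrite -ore_projZ !actE path_actZ.
- by move=> v; rewrite -(rmorph1 ore_proj) actE path_act1 //; apply: (rep_e_sum rep).
- move=> d d' v; have [f ->] := projK d; have [g ->] := projK d'.
  by rewrite -ore_projM !actE pactM.
split=> [i v|v|v|v]; rewrite actE.
- exact: path_act_vert.
- rewrite pact_sum -[in RHS](rep_e_sum rep v) (lin_sum _ (rep_a_linear rep)).
  by apply: eq_bigr => i _; rewrite pact_a.
- rewrite pact_sum -[in RHS](rep_e_sum rep v) (lin_sum _ (rep_x_linear rep)).
  by rewrite [RHS](reindex_inj (addIr rr)); apply: eq_bigr => i _; rewrite pact_x.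
exact: pact_w.
Qed.

End Representation.

End OreQuiverAlgebra.

(** * The monomial basis *)

Section MonomialSpan.
Variables (k : fieldType) (D : pzAlgType k) (N : nat).
Local Notation Z := 'I_N.+2.
Variables (e : Z -> D) (a w x : D) (ga gw gx : Z).
Hypothesis eM : forall i j, e i * e j = if i == j then e i else 0.
Hypothesis e_sum : \sum_i e i = 1.
Hypotheses (a_deg : has_deg e ga a) (w_deg : has_deg e gw w) (x_deg : has_deg e gx x).
Variables lam kap mu : Z -> k.
Hypotheses (lam_neq0 : forall i, lam i != 0) (kap_neq0 : forall i, kap i != 0).
Hypothesis mu_neq0 : forall i, mu i != 0.
Hypothesis xaE : x * a = w + diag e kap * a * x.
Hypothesis waE : w * a = diag e lam * a * w.
Hypothesis xwE : x * w = diag e mu * w * x.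

Local Notation mon := (pbw e a w x).

Definition in_span (d : D) := exists F : seq (k * pbw_index N),
  d = \sum_(c <- F) pzC c.1 * mon c.2.

Lemma in_spanD d d' : in_span d -> in_span d' -> in_span (d + d').
Proof. by move=> [F ->] [G ->]; exists (F ++ G); rewrite big_cat. Qed.

Lemma in_spanZ c d : in_span d -> in_span (pzC c * d).
Proof.
move=> [F ->]; exists [seq (c * u.1, u.2) | u <- F].
rewrite big_map mulr_sumr; apply: eq_bigr => u _ /=.
by rewrite rmorphM mulrA.
Qed.

Lemma in_span_mon m : in_span (mon m).
Proof. by exists [:: (1, m)]; rewrite big_seq1 rmorph1 mul1r. Qed.

Lemma in_span0 : in_span 0.
Proof. by exists [::]; rewrite big_nil. Qed.

Lemma in_spanB d d' : in_span d -> in_span d' -> in_span (d - d').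
Proof.
move=> hd hd'; apply: in_spanD => //.
by rewrite -mulN1r -(rmorphN1 (@pzC k D)); apply: in_spanZ.
Qed.

Lemma in_span_mulr y : (forall m, in_span (mon m * y)) ->
  forall d, in_span d -> in_span (d * y).
Proof.
move=> hy d [F ->]; rewrite mulr_suml.
elim/big_ind: _ => [|u v|c _]; [exact: in_span0 | exact: in_spanD |].
by rewrite -mulrA; apply: in_spanZ.
Qed.

Lemma mon_e m i : mon m * e i = if m.2 == i then mon m else 0.
Proof. by rewrite /pbw -mulrA eM; case: ifP; rewrite // mulr0. Qed.

Lemma mon_a s j l i : mon (s, j, l, i) * a = mon (s, j, l.+1, i + ga).
Proof. by rewrite /pbw /= -mulrA a_deg exprSr !mulrA. Qed.

Lemma mon_w s j i : mon (s, j, 0, i) * w = mon (s, j.+1, 0, i + gw).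
Proof. by rewrite /pbw /= expr0 !mulr1 -mulrA w_deg exprSr !mulrA. Qed.

Lemma mon_x s i : mon (s, 0, 0, i) * x = mon (s.+1, 0, 0, i + gx).
Proof. by rewrite /pbw /= !expr0 !mulr1 -mulrA x_deg exprSr !mulrA. Qed.

Lemma mon_absorb s j l i : mon (s, j, l, i) = mon (s, j, l, i) * e i.
Proof. by rewrite mon_e eqxx. Qed.

(** The monomial ends in e_i, which evaluates a diagonal coefficient at i. *)
Lemma mon_pull s j l i f y : mon (s, j, l, i) * (diag e f * y) =
  pzC (f i) * (mon (s, j, l, i) * y).
Proof.
rewrite {1}mon_absorb -mulrA [e i * _]mulrA e_diag //.
move: (mon_absorb s j l i); set m := mon _ => mE.
by rewrite -[pzC _ * e _ * y]mulrA (mulrA m) -pzC_central -mulrA (mulrA m) -mE.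
Qed.

(** The relation for wa solved for aw; this and the next two lemmas lower an exponent by one and
    drive the inductions below. *)
Lemma mon_aw s j l i : mon (s, j, l.+1, i) * w =
  pzC (lam (i - ga))^-1 * (mon (s, j, l, i - ga) * w * a).
Proof.
rewrite -{1}(subrK ga i) -mon_a -[_ * w * a]mulrA waE -[diag _ _ * _ * _]mulrA mon_pull.
by rewrite (mulrA (pzC _)) -rmorphM mulVf // rmorph1 mul1r mulrA.
Qed.

Lemma mon_ax s j l i : mon (s, j, l.+1, i) * x =
  pzC (kap (i - ga))^-1 * (mon (s, j, l, i - ga) * x * a - mon (s, j, l, i - ga) * w).
Proof.
rewrite -{1}(subrK ga i) -mon_a -[_ * x * a]mulrA xaE [mon _ * (_ + _)]mulrDr [_ + _ - _]addrC addKr.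
rewrite -[diag _ _ * _ * _]mulrA mon_pull.
by rewrite (mulrA (pzC _)) -rmorphM mulVf // rmorph1 mul1r mulrA.
Qed.

Lemma mon_wx s j i : mon (s, j.+1, 0, i) * x =
  pzC (mu (i - gw))^-1 * (mon (s, j, 0, i - gw) * x * w).
Proof.
rewrite -{1}(subrK gw i) -mon_w -[_ * x * w]mulrA xwE -[diag _ _ * _ * _]mulrA mon_pull.
by rewrite (mulrA (pzC _)) -rmorphM mulVf // rmorph1 mul1r mulrA.
Qed.

Lemma in_span_a d : in_span d -> in_span (d * a).
Proof.
by apply: in_span_mulr => -[[[s j] l] i]; rewrite mon_a; apply: in_span_mon.
Qed.

Lemma in_span_mon_w s j l i : in_span (mon (s, j, l, i) * w).
Proof.
elim: l i => [|l IHl] i; first by rewrite mon_w; apply: in_span_mon.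
by rewrite mon_aw; apply/in_spanZ/in_span_a.
Qed.

Lemma in_span_w d : in_span d -> in_span (d * w).
Proof. by apply: in_span_mulr => -[[[s j] l] i]; apply: in_span_mon_w. Qed.

(** Induction on the exponent of a, then on that of w: x moves left past them, and the extra w
    produced by each a is covered by [in_span_mon_w]. *)
Lemma in_span_x d : in_span d -> in_span (d * x).
Proof.
apply: in_span_mulr => -[[[s j] l] i].
elim: l i => [|l IHl] i; last first.
  by rewrite mon_ax; apply/in_spanZ/in_spanB; [apply: in_span_a | apply: in_span_mon_w].
elim: j i => [|j IHj] i; first by rewrite mon_x; apply: in_span_mon.
by rewrite mon_wx; apply/in_spanZ/in_span_w.
Qed.

Lemma in_span_e i d : in_span d -> in_span (d * e i).
Proof.
apply: in_span_mulr => m; rewrite mon_e.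
by case: ifP => _; [apply: in_span_mon | apply: in_span0].
Qed.

Lemma in_span1 : in_span 1.
Proof.
rewrite -e_sum; elim/big_ind: _ => [|u v|i _]; [exact: in_span0 | exact: in_spanD |].
rewrite (_ : e i = mon (0, 0, 0, i)); first exact: in_span_mon.
by rewrite /pbw /= !expr0 !mul1r.
Qed.

End MonomialSpan.

(** Resolution of the overlap a w x. With X = m x and W = m w for a monomial m, the two sides are (m
    a) x w and a multiple of (m a) w x, where a has been moved to the right; the hypotheses are the
    induction hypothesis for m and the relations at X and W. *)
Lemma xw_step (k : fieldType) (V : lmodType k) (fa fw fx : {linear V -> V})
    (l m c : k) (X W : V) : l != 0 -> m != 0 -> c != 0 ->
  fw X = m *: fx W -> fa (fw X) = m *: fw (fa X) -> fa (fx W) = fw W + c *: fx (fa W) ->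
  fw (c^-1 *: (fa X - W)) = l *: fx (l^-1 *: fa W).
Proof.
move=> l0 m0 c0 wxE waX xaW; have -> : fx (l^-1 *: fa W) = l^-1 *: fx (fa W) by rewrite linearZ.
rewrite scalerA mulfV // scale1r linearZ /= linearB /=.
have -> : fw (fa X) = fa (fx W) by apply: (scalerI m0); rewrite -waX wxE linearZ.
by rewrite xaW addrC addKr scalerA mulVf // scale1r.
Qed.

(* The right action of the generators on the span of the monomials, as forced
   by the commutation relations. *)
Section MonomialModule.
Variables (k : fieldType) (N : nat).
Local Notation Z := 'I_N.+2.
Variables (ga gw gx : Z) (lam kap mu : Z -> k).
Hypotheses (lam_neq0 : forall i, lam i != 0) (kap_neq0 : forall i, kap i != 0).
Hypothesis mu_neq0 : forall i, mu i != 0.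
Hypothesis gwE : gw = ga + gx.
Hypothesis lam_per : forall i, lam (i + gw) = lam i.
Hypothesis kap_per : forall i, kap (i + gw) = kap i.
Hypothesis muE : forall i, mu (i + ga) = lam i.

Local Notation V := {malg k[pbw_index N]}.
Local Notation "'m[ s , j , l , i ]" := (<< ((s, j, l, i) : pbw_index N) >> : V)
  (format "''m[' s ,  j ,  l ,  i ]").

Definition mact_e (i : Z) : V -> V :=
  malg_lift (V := V) (fun m : pbw_index N => if i == m.2 then << m >> else 0).
HB.instance Definition _ i := GRing.Linear.on (mact_e i).

Definition mact_a : V -> V :=
  malg_lift (V := V) (fun m : pbw_index N => 'm[m.1.1.1, m.1.1.2, m.1.2.+1, m.2 + ga]).
HB.instance Definition _ := GRing.Linear.on mact_a.

Fixpoint mon_act_w (s j l : nat) (i : Z) : V :=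
  if l is l'.+1 then (lam (i - ga))^-1 *: mact_a (mon_act_w s j l' (i - ga))
  else 'm[s, j.+1, 0%N, i + gw].

Definition mact_w : V -> V :=
  malg_lift (V := V) (fun m : pbw_index N => mon_act_w m.1.1.1 m.1.1.2 m.1.2 m.2).
HB.instance Definition _ := GRing.Linear.on mact_w.

Fixpoint mon_act_x0 (s j : nat) (i : Z) : V :=
  if j is j'.+1 then (mu (i - gw))^-1 *: mact_w (mon_act_x0 s j' (i - gw))
  else 'm[s.+1, 0%N, 0%N, i + gx].

Fixpoint mon_act_x (s j l : nat) (i : Z) : V :=
  if l is l'.+1 then (kap (i - ga))^-1 *:
    (mact_a (mon_act_x s j l' (i - ga)) - mon_act_w s j l' (i - ga))
  else mon_act_x0 s j i.

Definition mact_x : V -> V :=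
  malg_lift (V := V) (fun m : pbw_index N => mon_act_x m.1.1.1 m.1.1.2 m.1.2 m.2).
HB.instance Definition _ := GRing.Linear.on mact_x.

Lemma mact_eU i s j l i' :
  mact_e i 'm[s, j, l, i'] = if i == i' then 'm[s, j, l, i'] else 0.
Proof. exact: malg_liftU. Qed.
Lemma mact_aU s j l i : mact_a 'm[s, j, l, i] = 'm[s, j, l.+1, i + ga].
Proof. exact: malg_liftU. Qed.
Lemma mact_wU s j l i : mact_w 'm[s, j, l, i] = mon_act_w s j l i.
Proof. exact: malg_liftU. Qed.
Lemma mact_xU s j l i : mact_x 'm[s, j, l, i] = mon_act_x s j l i.
Proof. exact: malg_liftU. Qed.

Lemma mact_eM i j v : mact_e i (mact_e j v) = if i == j then mact_e j v else 0.
Proof.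
pose f : {linear V -> V} := mact_e i \o mact_e j.
have [->|ij] := eqVneq i j.
  apply: (malg_linear_ext (f := mact_e j \o mact_e j) (g := mact_e j)) => [||[[[s l] m] i']].
  - exact: linearP.
  - exact: linearP.
  by rewrite /= mact_eU; case: eqP => [->|_]; rewrite ?linear0 // mact_eU eqxx.
apply: (malg_linear_ext (f := f) (g := fun=> 0)) => [||[[[s l] m] i']].
- exact: linearP.
- by move=> c u u'; rewrite scaler0 addr0.
by rewrite /= mact_eU; case: eqP => [<-|_]; rewrite ?linear0 // mact_eU (negPf ij).
Qed.

Lemma mact_e_sum v : \sum_i mact_e i v = v.
Proof.
apply: (malg_linear_ext (f := fun v => \sum_i mact_e i v) (g := id)) => // [c u u'|[[[s j] l] i]].
  by rewrite scaler_sumr -big_split; apply: eq_bigr => i _; rewrite linearP.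
rewrite (bigD1 i) //= mact_eU eqxx big1 ?addr0 // => i' ii'.
by rewrite mact_eU (negPf ii').
Qed.

Lemma mact_deg (y : {linear V -> V}) g :
  (forall s j l i, mact_e (i + g) (y 'm[s, j, l, i]) = y 'm[s, j, l, i]) ->
  forall i v, y (mact_e i v) = mact_e (i + g) (y v).
Proof.
move=> yg i; apply: (malg_linear_ext (f := y \o mact_e i) (g := mact_e (i + g) \o y)).
- exact: linearP.
- exact: linearP.
move=> [[[s j] l] i'] /=; rewrite mact_eU -yg mact_eM (inj_eq (addIr _)).
by case: eqP => [<-|_]; rewrite ?linear0 // yg.
Qed.

Lemma mact_a_deg i v : mact_a (mact_e i v) = mact_e (i + ga) (mact_a v).
Proof. by apply: (mact_deg (y := mact_a)) => s j l i' /=; rewrite mact_aU mact_eU eqxx. Qed.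

Lemma mact_w_deg i v : mact_w (mact_e i v) = mact_e (i + gw) (mact_w v).
Proof.
apply: (mact_deg (y := mact_w)) => s j l {}i /=; rewrite mact_wU; elim: l i => [|l IHl] i /=.
  by rewrite mact_eU eqxx.
have -> : i + gw = i - ga + gw + ga by ring.
by rewrite linearZ /= -mact_a_deg IHl.
Qed.

Lemma mact_x_deg i v : mact_x (mact_e i v) = mact_e (i + gx) (mact_x v).
Proof.
apply: (mact_deg (y := mact_x)) => s j l {}i /=; rewrite mact_xU; elim: l i => [|l IHl] i /=.
  elim: j i => [|j IHj] i /=; first by rewrite mact_eU eqxx.
  have -> : i + gx = i - gw + gx + gw by ring.
  by rewrite linearZ /= -mact_w_deg IHj.
rewrite linearZ /= linearB /=.
have {1}-> : i + gx = i - ga + gx + ga by ring.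
rewrite -mact_a_deg IHl; have -> : i + gx = i - ga + gw by rewrite gwE; ring.
by rewrite -mact_wU -mact_w_deg mact_eU eqxx.
Qed.

Lemma mact_ext (f g : {linear V -> V}) i :
  (forall s j l, f 'm[s, j, l, i] = g 'm[s, j, l, i]) ->
  forall v, f (mact_e i v) = g (mact_e i v).
Proof.
move=> fg; apply: (malg_linear_ext (f := f \o mact_e i) (g := g \o mact_e i)).
- exact: linearP.
- exact: linearP.
by move=> [[[s j] l] i'] /=; rewrite mact_eU; case: eqP => [<-|_]; rewrite ?linear0.
Qed.

Lemma mact_wa i v : mact_a (mact_w (mact_e i v)) = lam i *: mact_w (mact_a (mact_e i v)).
Proof.
apply: (mact_ext (f := mact_a \o mact_w) (g := lam i \*: (mact_w \o mact_a))) => s j l /=.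
by rewrite mact_aU !mact_wU /= addrK scalerA mulfV // scale1r.
Qed.

Lemma mact_xa i v : mact_a (mact_x (mact_e i v)) =
  mact_w (mact_e i v) + kap i *: mact_x (mact_a (mact_e i v)).
Proof.
apply: (mact_ext (f := mact_a \o mact_x)
                 (g := mact_w \+ (kap i \*: (mact_x \o mact_a)))) => s j l /=.
rewrite mact_aU mact_wU !mact_xU /= addrK scalerA mulfV // scale1r.
by rewrite addrC subrK.
Qed.

Lemma mact_xw i v : mact_w (mact_x (mact_e i v)) = mu i *: mact_x (mact_w (mact_e i v)).
Proof.
apply: (mact_ext (f := mact_w \o mact_x) (g := mu i \*: (mact_x \o mact_w))) => s j l /=.
rewrite mact_wU mact_xU; elim: l i => [|l IHl] {}i.
  by rewrite mact_xU /= addrK scalerA mulfV // scale1r.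
have XE := mact_x_deg (i - ga) 'm[s, j, l, i - ga].
have WE := mact_w_deg (i - ga) 'm[s, j, l, i - ga].
rewrite mact_eU eqxx mact_xU in XE; rewrite mact_eU eqxx mact_wU in WE.
have {IHl} := IHl (i - ga).
rewrite /=; move: (mon_act_x _ _ _ _) (mon_act_w _ _ _ _) XE WE => X W XE WE wxE.
(* x moves the vertex by gx = gw - ga, and lam has period gw. *)
have lamE : lam (i - ga + gx) = mu (i - ga).
  by rewrite -{2}(subrK ga (i - ga)) muE -[RHS]lam_per gwE; congr (lam _); ring.
have muiE : mu i = lam (i - ga) by rewrite -muE subrK.
have waX := mact_wa (i - ga + gx) X; rewrite -XE lamE in waX.
have xaW := mact_xa (i - ga + gw) W; rewrite -WE kap_per in xaW.
by rewrite muiE; apply: (xw_step (fa := mact_a) (fw := mact_w) (fx := mact_x) _ _ _ wxE waX xaW).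
Qed.

Lemma monomial_rep : right_rep ga gx gw lam kap mu mact_e mact_a mact_x mact_w.
Proof.
split=> *; try exact: linearP.
- exact: mact_eM.
- exact: mact_e_sum.
- exact: mact_a_deg.
- exact: mact_x_deg.
- exact: mact_w_deg.
- exact: mact_xa.
- exact: mact_wa.
exact: mact_xw.
Qed.

End MonomialModule.

(** * The Calabi-Yau property from the presentation *)

Section OrePresentation.
Variables (k : fieldType) (D : pzAlgType k) (N : nat).
Local Notation Z := 'I_N.+2.
Variables (e : Z -> D) (a w x : D) (ga gw gx : Z).
Hypothesis eM : forall i j, e i * e j = if i == j then e i else 0.
Hypothesis e_sum : \sum_i e i = 1.
Hypotheses (a_deg : has_deg e ga a) (w_deg : has_deg e gw w) (x_deg : has_deg e gx x).
Variables lam kap mu : Z -> k.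
Local Notation diag := (diag e).
Hypotheses (lam_neq0 : forall i, lam i != 0) (kap_neq0 : forall i, kap i != 0).
Hypothesis xaE : x * a = w + diag kap * a * x.
Hypothesis waE : w * a = diag lam * a * w.
Hypothesis xwE : x * w = diag mu * w * x.
Hypothesis gwE : gw = ga + gx.
Hypothesis lam_per : forall i, lam (i + gw) = lam i.
Hypothesis kap_per : forall i, kap (i + gw) = kap i.
Hypothesis muE : forall i, mu (i + ga) = lam i.

Definition extends_rep (V : lmodType k) (oe : Z -> V -> V) (oa ox ow : V -> V)
    (act : D -> V -> V) : Prop :=
  [/\ forall d d' v, act (d + d') v = act d v + act d' v,
      forall c d v, act (pzC c * d) v = c *: act d v,
      forall v, act 1 v = v,
      forall d d' v, act (d * d') v = act d' (act d v) &
      [/\ forall i v, act (e i) v = oe i v, forall v, act a v = oa v,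
          forall v, act x v = ox v & forall v, act w v = ow v]].

(** With [gen_ind], this is the universal property of the presentation. It is applied to the
    monomial module, for linear independence, and to D itself, for the twisting automorphism. *)
Hypothesis rep_extends : forall (V : lmodType k) oe oa ox ow,
  right_rep ga gx gw lam kap mu oe oa ox ow ->
  exists act, @extends_rep V oe oa ox ow act.
Hypothesis gen_ind : forall P : D -> Prop,
  P 1 -> (forall f g, P f -> P g -> P (f + g)) -> (forall c f, P f -> P (pzC c * f)) ->
  (forall f i, P f -> P (f * e i)) -> (forall f, P f -> P (f * a)) ->
  (forall f, P f -> P (f * x)) -> forall f, P f.

Let mu_neq0 i : mu i != 0. Proof. by rewrite -[i](subrK ga) muE. Qed.
Let mu_per i : mu (i + gw) = mu i.
Proof. by rewrite -[i in RHS](subrK ga) -[i in LHS](subrK ga) addrAC !muE lam_per. Qed.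

Local Notation V := {malg k[pbw_index N]}.

Let sum_mon (s j l : nat) : V := \sum_(i : Z) << ((s, j, l, i) : pbw_index N) >>.

(** The vector [sum_mon 0 0 0] plays the part of 1, the sum of all e_i; a monomial of D sends it to
    the corresponding basis vector, so acting on it reads off coordinates. *)
Lemma pbw_coords : exists co : {additive D -> V},
  (forall c d, co (pzC c * d) = c *: co d) /\
  (forall m, co (pbw e a w x m) = << m >>).
Proof.
have [act [actD actZ act1 actM [act_e act_a act_x act_w]]] := rep_extends
  (monomial_rep lam_neq0 kap_neq0 mu_neq0 gwE lam_per kap_per muE).
pose co d := act d (sum_mon 0 0 0).
have coB : zmod_morphism co.
  move=> d d'; rewrite /co actD; congr (_ + _).
  by rewrite -mulN1r -(rmorphN1 (@pzC k D)) actZ scaleN1r.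
exists (HB.pack_for {additive D -> V} co (GRing.isZmodMorphism.Build _ _ _ coB)).
split=> [c d|[[[s j] l] i]] /=; first exact: actZ.
rewrite /co /pbw /= !actM.
have -> : act (x ^+ s) (sum_mon 0 0 0) = sum_mon s 0 0.
  elim: s => [|s IHs]; first by rewrite act1.
  rewrite exprSr actM IHs act_x /sum_mon linear_sum [RHS](reindex_inj (addIr gx)).
  by apply: eq_bigr => i' _; apply: mact_xU.
have -> : act (w ^+ j) (sum_mon s 0 0) = sum_mon s j 0.
  elim: j => [|j IHj]; first by rewrite act1.
  rewrite exprSr actM IHj act_w /sum_mon linear_sum [RHS](reindex_inj (addIr gw)).
  by apply: eq_bigr => i' _; apply: mact_wU.
have -> : act (a ^+ l) (sum_mon s j 0) = sum_mon s j l.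
  elim: l => [|l IHl]; first by rewrite act1.
  rewrite exprSr actM IHl act_a /sum_mon linear_sum [RHS](reindex_inj (addIr ga)).
  by apply: eq_bigr => i' _; apply: mact_aU.
rewrite act_e /sum_mon linear_sum (eq_bigr _ (fun i' _ => mact_eU k i s j l i')).
exact: sum_delta.
Qed.

Lemma pbw_spans d : exists F : seq (k * pbw_index N),
  d = \sum_(c <- F) pzC c.1 * pbw e a w x c.2.
Proof.
apply: (gen_ind (P := in_span e a w x)) => [|f g|c f|f i|f|f].
- exact: in_span1.
- exact: in_spanD.
- exact: in_spanZ.
- exact: in_span_e.
- exact: (in_span_a a_deg).
exact: (in_span_x eM a_deg w_deg x_deg lam_neq0 kap_neq0 mu_neq0 xaE waE xwE).
Qed.

Let diag_comm d y f : has_deg e d y -> (forall i, f (i + d) = f i) ->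
  diag f * y = y * diag f.
Proof.
move=> yd fd; rewrite -(deg_diag _ yd); congr (_ * _).
by apply: eq_bigr => i _; rewrite -fd subrK.
Qed.

Let mulVdiag f y : (forall i, f i != 0) -> diag f * (diag (fun i => (f i)^-1) * y) = y.
Proof.
move=> f0; rewrite mulrA diagM // (_ : diag _ = 1) ?mul1r // -[RHS](diag1 e_sum).
by apply: eq_bigr => i _; rewrite mulfV.
Qed.

Section Twist.
Variables (c : Z) (f : Z -> k).
Hypothesis f_neq0 : forall i, f i != 0.
Hypothesis f_per : forall i, f (i + gw) = f i.
Hypothesis lam_c : forall i, lam (i + c) = lam i.
Hypothesis kap_c : forall i, kap (i + c) = kap i.
Hypothesis mu_c : forall i, mu (i + c) = mu i.

Let f' (i : Z) := (f i)^-1.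
Let f'_per i : f' (i + gw) = f' i. Proof. by rewrite /f' f_per. Qed.
Let fK y : diag f * (diag f' * y) = y. Proof. exact: mulVdiag. Qed.
Let fK' y : diag f' * (diag f * y) = y.
Proof.
rewrite -[in LHS](_ : diag (fun i => (f' i)^-1) = diag f); last first.
  by apply: eq_bigr => i _; rewrite /f' invrK.
by apply: mulVdiag => i; rewrite invr_eq0.
Qed.

Let mulr_op (y : D) (v : kspace D) : kspace D := (v : D) * y.
Let mulr_op_linear y : linear (mulr_op y).
Proof. by move=> b u v; rewrite /mulr_op [LHS]mulrDl -[in LHS]mulrA. Qed.

Let pull i v g y : v * (e (i + c) * (diag g * y)) = pzC (g (i + c)) * (v * (e (i + c) * y)).
Proof.
rewrite (mulrA (e _)) e_diag // -(mulrA (pzC _)) mulrA -pzC_central.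
by rewrite -mulrA.
Qed.

Let ed i g : e i * diag g = diag g * e i.
Proof. by rewrite e_diag // diag_e. Qed.

Let fax : diag f * (a * x) = a * x * diag f.
Proof. by apply: (diag_comm (d := gw)) => //; rewrite gwE; apply: has_degM. Qed.

(** The factors f^-1 at a and f at x cancel in xa, and also in ax because f commutes with ax, of
    degree gw; so w can stay fixed. *)
Lemma twist_rep : right_rep ga gx gw lam kap mu (V := kspace D)
  (fun i => mulr_op (e (i + c))) (mulr_op (diag f' * a)) (mulr_op (x * diag f)) (mulr_op w).
Proof.
split=> [i||||i j v|v|i v|i v|i v|i v|i v|i v]; try exact: mulr_op_linear.
- rewrite /mulr_op -mulrA eM (inj_eq (addIr _)) eq_sym.
  by case: ifP => _; rewrite ?mulr0.
- rewrite -[RHS]mulr1 -e_sum mulr_sumr [RHS](reindex_inj (addIr c)).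
  by [].
- rewrite /mulr_op -!mulrA; congr (_ * _).
  by rewrite addrAC -a_deg !mulrA ed.
- rewrite /mulr_op -!mulrA; congr (_ * _).
  by rewrite -ed [LHS]mulrA x_deg -mulrA addrAC.
- by rewrite /mulr_op -!mulrA w_deg addrAC.
- rewrite /mulr_op -!mulrA [diag f * (diag f' * a)]fK.
  rewrite -[_ *: _]/(pzC (kap i) * (_ : D)) [a * (x * diag f)]mulrA -fax fK'.
  by rewrite xaE mulrDr mulrDr -[diag kap * a * x]mulrA pull kap_c.
- rewrite /mulr_op -[_ *: _]/(pzC (lam i) * (_ : D)) -!mulrA.
  rewrite -[w * (diag f' * a)](_ : diag lam * (diag f' * (a * w)) = _) ?pull ?lam_c //.
  rewrite [RHS]mulrA -(diag_comm w_deg) // -mulrA waE -mulrA !mulrA !diagM //.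
  by congr (_ * _ * _); apply: eq_bigr => j _; rewrite mulrC.
rewrite /mulr_op -[_ *: _]/(pzC (mu i) * (_ : D)) -!mulrA.
rewrite -[x * (diag f * w)](_ : diag mu * (w * (x * diag f)) = _) ?pull ?mu_c //.
by rewrite (diag_comm w_deg) // [RHS]mulrA xwE -!mulrA.
Qed.

(** A right action of D on itself that commutes with left multiplications is given by an
    endomorphism: nu(d) is the image of 1 under d. *)
Lemma twist_morphism : exists nu : {rmorphism D -> D},
  [/\ forall b, nu (pzC b) = pzC b, forall i, nu (e i) = e (i + c),
      nu a = diag f' * a, nu x = x * diag f & nu w = w].
Proof.
have [act [actD actZ act1 actM [act_e act_a act_x act_w]]] := rep_extends twist_rep.
have actl d u v : act d (u * v : D) = u * act d v :> D.
  elim/gen_ind: d u v => [u v|g h IHg IHh u v|b g IHg u v|g i IHg u v|g IHg u v|g IHg u v].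
  - by rewrite !act1.
  - by rewrite !actD IHg IHh mulrDr.
  - rewrite !actZ IHg -[LHS]/(pzC b * _ : D) -[b *: _]/(pzC b * _ : D).
    by rewrite !mulrA pzC_central.
  - by rewrite !actM IHg !act_e /mulr_op mulrA.
  - by rewrite !actM IHg !act_a /mulr_op -mulrA.
  by rewrite !actM IHg !act_x /mulr_op -mulrA.
pose nu (d : D) : D := act d 1.
have nuB : zmod_morphism nu.
  move=> d d'; rewrite /nu actD; congr (_ + _).
  by rewrite -mulN1r -(rmorphN1 (@pzC k D)) actZ scaleN1r.
have nuM : monoid_morphism nu.
  by split=> [|d d']; rewrite /nu ?act1 // actM -[X in act d' X]mulr1 actl.
exists (HB.pack_for {rmorphism D -> D} nu (GRing.isZmodMorphism.Build _ _ _ nuB)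
  (GRing.isMonoidMorphism.Build _ _ _ nuM)).
split=> [b|i|||] /=; rewrite /nu.
- by rewrite -[pzC b]mulr1 actZ act1.
- by rewrite act_e /mulr_op mul1r.
- by rewrite act_a /mulr_op mul1r.
- by rewrite act_x /mulr_op mul1r.
by rewrite act_w /mulr_op mul1r.
Qed.

End Twist.

Lemma twist_cancel (c : Z) (f g : Z -> k) (nu nu' : {rmorphism D -> D}) :
  (forall i, f i * g i = 1) -> (forall i, f (i + c) = f i) ->
  [/\ forall b, nu (pzC b) = pzC b, forall i, nu (e i) = e (i + c),
      nu a = diag g * a & nu x = x * diag f] ->
  [/\ forall b, nu' (pzC b) = pzC b, forall i, nu' (e i) = e (i - c),
      nu' a = diag f * a & nu' x = x * diag g] ->
  cancel nu nu'.
Proof.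
move=> fg fc [nuC nu_e nu_a nu_x] [nuC' nu_e' nu_a' nu_x'].
have gc i : g (i + c) = g i.
  have f0 : f i != 0 by apply: contraTneq (oner_neq0 k) => f0; rewrite -(fg i) f0 mul0r eqxx.
  by apply: (mulfI f0); rewrite -{1}fc !fg.
have nu_diag h : (forall i, h (i + c) = h i) -> nu' (diag h) = diag h.
  move=> hc; rewrite /diag rmorph_sum [RHS](reindex_inj (addIr (- c))).
  apply: eq_bigr => i _; rewrite rmorphM nuC' nu_e' /=.
  by congr (pzC _ * _); rewrite -[RHS]hc subrK.
have fg1 : diag f * diag g = 1.
  by rewrite diagM // -[RHS](diag1 e_sum); apply: eq_bigr => i _; rewrite fg.
have gf1 : diag g * diag f = 1.
  rewrite diagM // -[RHS](diag1 e_sum); apply: eq_bigr => i _.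
  by rewrite mulrC fg.
elim/gen_ind => [|u v IHu IHv|b u IHu|u i IHu|u IHu|u IHu].
- by rewrite !rmorph1.
- by rewrite !rmorphD IHu IHv.
- by rewrite !rmorphM nuC nuC' IHu.
- by rewrite !rmorphM nu_e nu_e' addrK IHu.
- by rewrite !rmorphM nu_a rmorphM nu_a' nu_diag // IHu (mulrA (diag g)) gf1 mul1r.
by rewrite !rmorphM nu_x rmorphM nu_x' nu_diag // IHu -(mulrA x) gf1 mulr1.
Qed.

Theorem ore_presentation_calabi_yau : twisted_calabi_yau D 3.
Proof.
have [co [coZ co_pbw]] := pbw_coords.
pose f := funM mu kap; pose g i := (f i)^-1.
have f0 i : f i != 0 by rewrite mulf_neq0.
have g0 i : g i != 0 by rewrite invr_eq0.
have fg i : f i * g i = 1 by rewrite mulfV.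
have fper i : f (i + gw) = f i by rewrite /f /funM mu_per kap_per.
have gper i : g (i + gw) = g i by rewrite /g fper.
(* The top weight equals 2 gw, so coefficients of period gw are invariant under it. *)
pose c := ga + (gw + gx).
have per2 (h : Z -> k) : (forall i, h (i + gw) = h i) -> forall i, h (i + c) = h i.
  by move=> hp i; rewrite -[RHS]hp -[RHS]hp; congr (h _); rewrite /c gwE; ring.
have perN (h : Z -> k) : (forall i, h (i + gw) = h i) -> forall i, h (i - c) = h i.
  by move=> hp i; rewrite -(per2 h hp) subrK.
have [nu [nuC nu_e nu_a nu_x nu_w]] := twist_morphism f0 fper
  (per2 _ lam_per) (per2 _ kap_per) (per2 _ mu_per).
have [nu' [nuC' nu_e' nu_a' nu_x' _]] := twist_morphism g0 gper
  (perN _ lam_per) (perN _ kap_per) (perN _ mu_per).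
have gK : diag (fun i => (g i)^-1) = diag f.
  by apply: eq_bigr => i _; rewrite /g invrK.
rewrite gK in nu_a'.
apply: (ore_calabi_yau eM e_sum a_deg w_deg x_deg lam_neq0 kap_neq0 xaE waE xwE gwE
  lam_per kap_per muE coZ co_pbw pbw_spans (nu := nu) (nu' := nu')) => //.
- exact: (twist_cancel fg (per2 _ fper)).
- apply: (@twist_cancel (- c) g f) => [i||//|].
  + by rewrite mulrC fg.
  + exact: (perN _ gper).
  by split=> // i; rewrite opprK nu_e.
by rewrite nu_a mulVdiag.
Qed.

End OrePresentation.

(** * Rotations of the cyclic quiver *)

Lemma rotation_calabi_yau (k : fieldType) (N : nat) (s : {perm 'I_N.+2})
    (rr : 'I_N.+2) (q p : 'I_N.+2 -> k)
    (phi : pathalg k (ore_quiver s) -> pathalg k (ore_quiver s)) :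
  (forall i, s i = i + rr) -> (forall i, q i != 0) -> (forall i, p i != 0) ->
  (forall i, q (i + (1 - rr)) = q i) -> (forall i, p (i + (1 - rr)) = p i) ->
  (forall i, phi (arr_a k s i) = p i *: arr_a k s (s (ord_pred i))) ->
  (forall i, phi (arr_x k s i) = (p i)^-1 *: arr_x k s (s (ord_pred i))) ->
  twisted_calabi_yau (normal_ext (ore_omega s q) phi) 3.
Proof.
move=> sE q0 p0 q_per p_per phi_a phi_x.
have eM := ore_eM q phi; have e1 := ore_e_sum q phi.
have a_deg := ore_a_deg q phi; have x_deg := ore_x_deg q phi sE.
have wE := ore_wE q phi sE.
have w_a := ore_w_a q sE phi_a; have w_x := ore_w_x q sE phi_x.
apply: (@ore_presentation_calabi_yau k _ N (ore_e q phi) (ore_a q phi) (ore_w q phi)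
  (ore_x q phi) 1 (1 - rr) (- rr) eM e1 a_deg (rel_w_deg eM e1 a_deg x_deg wE) x_deg
  p (ore_kap rr q) (ore_mu p) p0 (fun i => q0 _) (rel_xa eM e1 a_deg x_deg wE)
  (rel_wa e1 p_per w_a) (rel_xw eM e1 a_deg x_deg p0 p_per wE w_x) erefl p_per).
- by move=> i; rewrite /ore_kap addrAC q_per.
- by move=> i; rewrite /ore_mu addrK.
- by move=> V oe oa ox ow rep; apply: (ore_representation sE p0 p_per phi_a phi_x rep).
exact: ore_ind.
Qed.

(** The equality a_i = a_i e_(i+1) is mapped to one between nonzero multiples of a_(s i), so
    e_(s(i+1)) must sit at the target of that arrow. *)
Lemma cyclic_automorphism_rotation (k : fieldType) (n : nat) (s : 'I_n -> 'I_n)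
    (q : 'I_n -> k) (sigma : pathalg k (cyclic_quiver n) -> pathalg k (cyclic_quiver n)) :
  (forall i, q i != 0) -> monoid_morphism sigma ->
  (forall i : 'I_n, sigma (pvert k (i : qvert (cyclic_quiver n))) =
     pvert k (s i : qvert (cyclic_quiver n))) ->
  (forall i : 'I_n, sigma (parrow k (i : qarr (cyclic_quiver n))) =
     q i *: parrow k (s i : qarr (cyclic_quiver n))) ->
  forall i, s (ordS i) = ordS (s i).
Proof.
move=> q0 [_ sM] sv sa i; apply/eqP; apply: contraT => si.
pose Q := cyclic_quiver n.
have z : parrow k (s i : qarr Q) * pvert k (s (ordS i) : qvert Q) = 0.
  by apply: parrow_vert0; rewrite eq_sym.
have sb : sigma (parrow k (i : qarr Q) * pvert k (ordS i : qvert Q)) =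
    sigma (parrow k (i : qarr Q)) := congr1 sigma (parrow_vert k (i : qarr Q)).
have {sb} qz : q i *: parrow k (s i : qarr Q) = 0.
  apply: etrans (esym (sa i)) _; apply: etrans (esym sb) _; apply: etrans (sM _ _) _.
  apply: etrans (congr2 *%R (sa i) (sv (ordS i))) _.
  apply: etrans (esym (pmalg_scalerAl _ _ _)) _.
  by apply: etrans (congr1 _ z) (scaler0 _ _).
by move/eqP: qz; rewrite scaler_eq0 (negPf (q0 i)) (negPf (parrow_neq0 k _)).
Qed.

Theorem theorem2 (k : closedFieldType) (hk : [pchar k] =i pred0)
  (n : nat) (hn : (3 <= n)%N)
  (s : {perm 'I_n}) (q : 'I_n -> k) (hq : forall i, q i != 0)
  (sigma : pathalg k (cyclic_quiver n) -> pathalg k (cyclic_quiver n))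
  (hsigma : graded_automorphism sigma)
  (hsigma_e : forall i : 'I_n,
     sigma (pvert k (i : qvert (cyclic_quiver n))) =
     pvert k (s i : qvert (cyclic_quiver n)))
  (hsigma_a : forall i : 'I_n,
     sigma (parrow k (i : qarr (cyclic_quiver n))) =
     q i *: parrow k (s i : qarr (cyclic_quiver n)))
  (hqs : forall i, q i = q (s (ord_pred i)))
  (p : 'I_n -> k) (hp : forall i, p i != 0)
  (hps : forall i, p (s i) = p (ordS i))
  (phi : pathalg k (ore_quiver s) -> pathalg k (ore_quiver s))
  (hphi : graded_automorphism phi)
  (hphi_e : forall i : 'I_n,
     phi (pvert k (i : qvert (ore_quiver s))) =
     pvert k (s (ord_pred i) : qvert (ore_quiver s)))
  (hphi_a : forall i, phi (arr_a k s i) =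
     p i *: arr_a k s (s (ord_pred i)))
  (hphi_x : forall i, phi (arr_x k s i) =
     (p i)^-1 *: arr_x k s (s (ord_pred i))) :
  twisted_calabi_yau (normal_ext (ore_omega s q) phi) 3.
Proof.
(* Writing n as N + 2 turns the index set into the ring Z/n, where rotations are additions. *)
case: n hn s q hq sigma hsigma hsigma_e hsigma_a hqs p hp hps phi hphi hphi_e hphi_a hphi_x
  => [|[|N]] // _ s q q0 sigma [_ sigmaM _ _] sigma_e sigma_a q_s p p0 p_s phi _ _ phi_a phi_x.
have sS := cyclic_automorphism_rotation q0 sigmaM sigma_e sigma_a.
(* A map commuting with the successor is the rotation by its value at 0. *)
have sE (i : 'I_N.+2) : s i = i + s 0.
  have sn (m : nat) : s m%:R = m%:R + s 0.
    elim: m => [|m IHm]; first by rewrite add0r.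
    by rewrite -natr1 -ordS_add sS IHm !ordS_add addrAC.
  by rewrite -(natr_Zp i).
(* The conditions on q and p both become invariance under rotation by 1 - s(0). *)
apply: (@rotation_calabi_yau k N s (s 0) q p phi sE q0 p0 _ _ phi_a phi_x) => i.
  by rewrite q_s ord_pred_sub sE; congr (q _); ring.
have := p_s (i - s 0); rewrite ordS_add sE subrK => ->.
by congr (p _); ring.
Qed.
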